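(* Let $m\geq3$ and for $i=1,\ldots,m$ let $\chi_i$ be a Dirichlet character modulo $q_i$; put $\chi=\chi_1\cdots\chi_m$ and $q^*=\max(q_1,\ldots,q_m)$. Then for any Dirichlet character $\psi$ modulo $\ell$ and any $\varepsilon>0$, $$\sum_{b=1}^{\ell-1}\psi(b)\prod_{i=1}^mL\left(\chi_i,b/\ell,\tfrac12\right)=\ell^{m/2}L\left(\chi\psi,\tfrac m2\right)+O_{m,\varepsilon}\big((q^* )^{m/4+\varepsilon}\ell+(q^* )^{1/4+\varepsilon}\ell^{m/2-1/2+\varepsilon}\big).$$
   Context: For a Dirichlet character $\chi$ and integers $b,\ell\geq1$, $L(\chi,b/\ell,s):=\ell^s\sum_{n\geq1,\ n\equiv b\bmod\ell}\chi(n)n^{-s}$ for $\mathrm{Re}\, s>1$, extended meromorphically in $s$. $L(\chi,s)=\sum_{n\geq1}\chi(n)n^{-s}$; $\chi\psi$ is the product character. *)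

(* Defs.v *)
From Stdlib Require Import Reals Arith.
From Coquelicot Require Import Coquelicot.
Open Scope R_scope.

Fixpoint Csum1 (f : nat -> C) (n : nat) : C :=
  match n with O => RtoC 0 | S n' => Cplus (Csum1 f n') (f n) end.
Fixpoint Cprod1 (f : nat -> C) (n : nat) : C :=
  match n with O => RtoC 1 | S n' => Cmult (Cprod1 f n') (f n) end.
Fixpoint natmax1 (f : nat -> nat) (n : nat) : nat :=
  match n with O => O | S n' => Nat.max (natmax1 f n') (f n) end.

Definition cpow (x : nat) (s : C) : C :=
  let r := ln (INR x) in
  (exp (Re s * r) * cos (Im s * r), exp (Re s * r) * sin (Im s * r)).

Record is_dirichlet_char (q : nat) (chi : nat -> C) : Prop := {
  dc_q_pos : (0 < q)%nat;
  dc_periodic : forall n, chi (n + q)%nat = chi n;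
  dc_one : chi 1%nat = RtoC 1;
  dc_mult : forall a b, chi (a * b)%nat = Cmult (chi a) (chi b);
  dc_zero : forall n, chi n = RtoC 0 <-> Nat.gcd n q <> 1%nat }.

(* terms of  l^s * sum_{n>=1, n = b mod l} chi(n) n^{-s}  (index k <-> n = k+1) *)
Definition hurL_term (chi : nat -> C) (b l : nat) (s : C) (k : nat) : C :=
  if Nat.eqb ((k + 1) mod l) (b mod l)
  then Cmult (cpow l s) (Cmult (chi (k + 1)%nat) (cpow (k + 1) (Copp s)))
  else RtoC 0.

(* F is the meromorphic continuation of s |-> L(chi, b/l, s): it is holomorphic
   on C \ {1} (connected, so F is unique) and equals the series for Re s > 1. *)
Definition is_L_continuation (chi : nat -> C) (b l : nat) (F : C -> C) : Prop :=
  (forall z : C, z <> RtoC 1 ->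
     ex_derive (K := C_AbsRing) (V := C_NormedModule) F z) /\
  (forall s : C, 1 < Re s -> is_series (hurL_term chi b l s) (F s)).

Definition L_term (chi : nat -> C) (s : C) (k : nat) : C :=
  Cmult (chi (k + 1)%nat) (cpow (k + 1) (Copp s)).

(* Main.v *)
Require Import Defs.
From Stdlib Require Import Reals Arith Lra Lia Classical ClassicalEpsilon List Permutation.
From Coquelicot Require Import Coquelicot.
Open Scope R_scope.

(* Write f(n) = chi(b + n l), a q-periodic function with mean c, and x = b/l, so that
   L(chi, b/l, s) = sum_{n >= 0} f(n) (n+x)^(-s).  The regularised partial sums over k periods,
   G_k(s) = sum_{n <= kq} f(n) (n+x)^(-s) - c (kq+x)^(1-s) / (1-s), converge locally uniformly on
   Re s > 0, s <> 1, so by unique continuation their limit at 1/2 is the value of the given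
   continuation F.  The n = 0 term is chi(b) (l/b)^(1/2); partial summation against the
   Polya-Vinogradov bound sum_{1 <= n <= N} (f(n) - c) << q^(1/2+eps) shows that the remaining terms
   contribute O(q^(1/4+eps)).  Expanding the product over i, the leading terms give a partial sum
   of the series of L(chi psi, m/2) and all mixed terms are dominated by the two extreme ones.

   The Polya-Vinogradov bound holds for imprimitive characters and arbitrary progressions because
   the Gauss sums satisfy |G(a)|^2 <= q gcd(a,q), which follows from the invariance of |G| under
   units and Parseval's identity.  Unique continuation is proved from Goursat's theorem: if D
   vanishes on the far side of a rectangle, then the integral of D(z) exp(lam z^2) over the near
   side is exponentially smaller than the peak which D(0) <> 0 would produce as lam grows. *)

(** * Goursat's theorem *)

(** The continuation is known only through holomorphy off 1 and the series on [Re s > 1], so its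
    value at 1/2 has to be reached from that half-plane. The pole at 1 blocks the straight path;
    hence the detour above it, and the factor [1 - s] carried throughout. The exponent 1/4 is half
    of the Polya-Vinogradov exponent: if partial sums are bounded by B, the weight n^(-1/2) is
    summed trivially up to n about B and by parts beyond, and each range costs B^(1/2). With X =
    (l/b)^(1/2) and E the error of one factor, the product differs from its leading term by at most
    a constant times E X^(m-1) + E^m. Summed over b, the first gives l^((m-1)/2) times a harmonic
    sum, because (m-1)/2 >= 1 for m >= 3, and the second gives l E^m. The tail of the series at m/2
    is O(l^(1-m/2)); multiplied by l^(m/2) it costs O(l), which the first error term covers. *)

Lemma RInt_near_const (g : R -> R) (a b k e : R) :
  a <= b -> ex_RInt g a b -> (forall t, a <= t <= b -> Rabs (g t - k) <= e) ->
  Rabs (RInt g a b - k * (b - a)) <= e * (b - a).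
Proof.
  intros Hab Hg Hk.
  replace (RInt g a b - k * (b - a)) with (RInt (fun t => g t - k) a b).
  - rewrite (Rmult_comm e). apply abs_RInt_le_const; auto.
    apply (ex_RInt_minus (V := R_NormedModule) g (fun _ => k)); auto. apply ex_RInt_const.
  - rewrite (RInt_minus (V := R_CompleteNormedModule) g (fun _ => k)); auto.
    + rewrite RInt_const. unfold minus, plus, opp, scal; simpl. unfold mult; simpl. ring.
    + apply ex_RInt_const.
Qed.

(* Cauchy-Riemann differentiability of the pair (U, V) as a function of x + iy. *)
Definition CR_diff (U V : R -> R -> R) (x y : R) : Prop :=
  exists b1 b2, forall eps, 0 < eps -> exists d, 0 < d /\
  forall x' y', Rabs (x' - x) < d -> Rabs (y' - y) < d ->
    Rabs (U x' y' - (U x y + b1 * (x' - x) - b2 * (y' - y)))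
      <= eps * (Rabs (x' - x) + Rabs (y' - y)) /\
    Rabs (V x' y' - (V x y + b2 * (x' - x) + b1 * (y' - y)))
      <= eps * (Rabs (x' - x) + Rabs (y' - y)).

Lemma continuous_of_lipschitz_at (f : R -> R) (x M d : R) :
  0 < d -> (forall x', Rabs (x' - x) < d -> Rabs (f x' - f x) <= M * Rabs (x' - x)) ->
  continuous f x.
Proof.
  intros Hd H. apply continuity_pt_filterlim.
  intros eps Heps. set (M' := Rabs M + 1).
  assert (HM' : 0 < M') by (unfold M'; pose proof (Rabs_pos M); lra).
  exists (Rmin d (eps / M')). split.
  - apply Rmin_pos; auto. apply Rdiv_lt_0_compat; auto.
  - intros x' [_ Hx']. simpl in *. unfold R_dist in *.
    pose proof (Rmin_l d (eps / M')). pose proof (Rmin_r d (eps / M')).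
    apply Rle_lt_trans with (M * Rabs (x' - x)); [apply H; lra|].
    apply Rle_lt_trans with (M' * Rabs (x' - x)).
    + apply Rmult_le_compat_r; [apply Rabs_pos|]. unfold M'. pose proof (Rle_abs M). lra.
    + apply Rlt_le_trans with (M' * (eps / M')); [|right; field; lra].
      apply Rmult_lt_compat_l; lra.
Qed.

Lemma CR_diff_continuous_x U V x y :
  CR_diff U V x y -> continuous (fun t => U t y) x /\ continuous (fun t => V t y) x.
Proof.
  intros (b1 & b2 & H). destruct (H 1 Rlt_0_1) as (d & Hd & Hb).
  split; apply (continuous_of_lipschitz_at _ _ (1 + Rabs b1 + Rabs b2) d Hd);
    intros x' Hx'; destruct (Hb x' y Hx') as [H1 H2];
    try (replace (y - y) with 0 by ring; rewrite Rabs_R0; lra);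
    replace (y - y) with 0 in * by ring; rewrite Rabs_R0 in H1, H2.
  - replace (U x' y - U x y) with
      ((U x' y - (U x y + b1 * (x' - x) - b2 * 0)) + b1 * (x' - x)) by ring.
    eapply Rle_trans; [apply Rabs_triang|]. rewrite Rabs_mult.
    pose proof (Rabs_pos b2). pose proof (Rabs_pos (x' - x)). nra.
  - replace (V x' y - V x y) with
      ((V x' y - (V x y + b2 * (x' - x) + b1 * 0)) + b2 * (x' - x)) by ring.
    eapply Rle_trans; [apply Rabs_triang|]. rewrite Rabs_mult.
    pose proof (Rabs_pos b1). pose proof (Rabs_pos (x' - x)). nra.
Qed.

Lemma CR_diff_continuous_y U V x y :
  CR_diff U V x y -> continuous (fun t => U x t) y /\ continuous (fun t => V x t) y.
Proof.
  intros (b1 & b2 & H). destruct (H 1 Rlt_0_1) as (d & Hd & Hb).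
  split; apply (continuous_of_lipschitz_at _ _ (1 + Rabs b1 + Rabs b2) d Hd);
    intros y' Hy'; assert (Hx : Rabs (x - x) < d)
      by (replace (x - x) with 0 by ring; rewrite Rabs_R0; lra);
    destruct (Hb x y' Hx Hy') as [H1 H2];
    replace (x - x) with 0 in * by ring; rewrite Rabs_R0 in H1, H2.
  - replace (U x y' - U x y) with
      ((U x y' - (U x y + b1 * 0 - b2 * (y' - y))) + - b2 * (y' - y)) by ring.
    eapply Rle_trans; [apply Rabs_triang|]. rewrite Rabs_mult, Rabs_Ropp.
    pose proof (Rabs_pos b1). pose proof (Rabs_pos (y' - y)). nra.
  - replace (V x y' - V x y) with
      ((V x y' - (V x y + b2 * 0 + b1 * (y' - y))) + b1 * (y' - y)) by ring.
    eapply Rle_trans; [apply Rabs_triang|]. rewrite Rabs_mult.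
    pose proof (Rabs_pos b2). pose proof (Rabs_pos (y' - y)). nra.
Qed.

(* The imaginary part of the integral of U + iV around the rectangle. *)
Definition rect_int (U V : R -> R -> R) (x1 x2 y1 y2 : R) : R :=
  RInt (fun x => V x y1 - V x y2) x1 x2 + RInt (fun y => U x2 y - U x1 y) y1 y2.

Definition CR_on (U V : R -> R -> R) (x1 x2 y1 y2 : R) : Prop :=
  forall x y, x1 <= x <= x2 -> y1 <= y <= y2 -> CR_diff U V x y.

Lemma CR_on_ex_RInt_x U V x1 x2 y1 y2 a b y y' :
  CR_on U V x1 x2 y1 y2 -> x1 <= a -> a <= b -> b <= x2 -> y1 <= y <= y2 -> y1 <= y' <= y2 ->
  ex_RInt (fun x => V x y - V x y') a b.
Proof.
  intros H Ha Hab Hb Hy Hy'.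
  apply (ex_RInt_minus (V := R_NormedModule) (fun x => V x y) (fun x => V x y'));
  apply (ex_RInt_continuous (V := R_CompleteNormedModule)); intros z Hz;
  rewrite Rmin_left, Rmax_right in Hz; auto; apply (CR_diff_continuous_x U V); apply H; lra.
Qed.

Lemma CR_on_ex_RInt_y U V x1 x2 y1 y2 a b x x' :
  CR_on U V x1 x2 y1 y2 -> y1 <= a -> a <= b -> b <= y2 -> x1 <= x <= x2 -> x1 <= x' <= x2 ->
  ex_RInt (fun y => U x y - U x' y) a b.
Proof.
  intros H Ha Hab Hb Hy Hy'.
  apply (ex_RInt_minus (V := R_NormedModule) (fun y => U x y) (fun y => U x' y));
  apply (ex_RInt_continuous (V := R_CompleteNormedModule)); intros z Hz;
  rewrite Rmin_left, Rmax_right in Hz; auto; apply (CR_diff_continuous_y U V); apply H; lra.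
Qed.

Lemma CR_on_sub U V x1 x2 y1 y2 a1 a2 b1 b2 :
  CR_on U V x1 x2 y1 y2 -> x1 <= a1 -> a2 <= x2 -> y1 <= b1 -> b2 <= y2 ->
  CR_on U V a1 a2 b1 b2.
Proof. intros H ? ? ? ? x y Hx Hy. apply H; lra. Qed.

Lemma rect_int_split_x U V x1 xm x2 y1 y2 :
  CR_on U V x1 x2 y1 y2 -> x1 <= xm <= x2 -> y1 <= y2 ->
  rect_int U V x1 x2 y1 y2 = rect_int U V x1 xm y1 y2 + rect_int U V xm x2 y1 y2.
Proof.
  intros H Hx Hy. unfold rect_int.
  rewrite <- (RInt_Chasles (V := R_CompleteNormedModule) (fun x => V x y1 - V x y2) x1 xm x2).
  2-3: apply (CR_on_ex_RInt_x U V x1 x2 y1 y2); auto; lra.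
  replace (RInt (fun y => U x2 y - U x1 y) y1 y2) with
    (RInt (fun y => U xm y - U x1 y) y1 y2 + RInt (fun y => U x2 y - U xm y) y1 y2).
  - unfold plus; simpl. ring.
  - rewrite <- (RInt_plus (V := R_CompleteNormedModule)).
    + apply RInt_ext. intros. unfold plus; simpl. ring.
    + apply (CR_on_ex_RInt_y U V x1 x2 y1 y2); auto; lra.
    + apply (CR_on_ex_RInt_y U V x1 x2 y1 y2); auto; lra.
Qed.

Lemma rect_int_split_y U V x1 x2 y1 ym y2 :
  CR_on U V x1 x2 y1 y2 -> x1 <= x2 -> y1 <= ym <= y2 ->
  rect_int U V x1 x2 y1 y2 = rect_int U V x1 x2 y1 ym + rect_int U V x1 x2 ym y2.
Proof.
  intros H Hx Hy. unfold rect_int.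
  rewrite <- (RInt_Chasles (V := R_CompleteNormedModule) (fun y => U x2 y - U x1 y) y1 ym y2).
  2-3: apply (CR_on_ex_RInt_y U V x1 x2 y1 y2); auto; lra.
  replace (RInt (fun x => V x y1 - V x y2) x1 x2) with
    (RInt (fun x => V x y1 - V x ym) x1 x2 + RInt (fun x => V x ym - V x y2) x1 x2).
  - unfold plus; simpl. ring.
  - rewrite <- (RInt_plus (V := R_CompleteNormedModule)).
    + apply RInt_ext. intros. unfold plus; simpl. ring.
    + apply (CR_on_ex_RInt_x U V x1 x2 y1 y2); auto; lra.
    + apply (CR_on_ex_RInt_x U V x1 x2 y1 y2); auto; lra.
Qed.

(** For the affine part of [U + iV] the two integrals are [- b1 X Y] and [b1 X Y], which cancel. The
    remainder of each pair of opposite sides is at most [eps (X + Y)] pointwise, over a total length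
    [X + Y]. *)
Lemma rect_int_local U V x y : CR_diff U V x y ->
  forall eps, 0 < eps -> exists d, 0 < d /\
  forall x1 y1 X Y, 0 <= X < d -> 0 <= Y < d -> x1 <= x <= x1 + X -> y1 <= y <= y1 + Y ->
  CR_on U V x1 (x1 + X) y1 (y1 + Y) ->
  Rabs (rect_int U V x1 (x1 + X) y1 (y1 + Y)) <= eps * (X + Y) ^ 2.
Proof.
  intros (b1 & b2 & H) eps Heps.
  destruct (H (eps / 2)) as (d & Hd & Hb); [lra|].
  exists d. split; auto. intros x1 y1 X Y HX HY Hx Hy HCR.
  assert (Hpt : forall x' y', x1 <= x' <= x1 + X -> y1 <= y' <= y1 + Y ->
    Rabs (U x' y' - (U x y + b1 * (x' - x) - b2 * (y' - y))) <= eps / 2 * (X + Y) /\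
    Rabs (V x' y' - (V x y + b2 * (x' - x) + b1 * (y' - y))) <= eps / 2 * (X + Y)).
  { intros x' y' Hx' Hy'.
    assert (A1 : Rabs (x' - x) <= X) by (apply Rabs_le; lra).
    assert (A2 : Rabs (y' - y) <= Y) by (apply Rabs_le; lra).
    destruct (Hb x' y') as [B1 B2]; try lra.
    assert (eps / 2 * (Rabs (x' - x) + Rabs (y' - y)) <= eps / 2 * (X + Y))
      by (apply Rmult_le_compat_l; lra).
    split; lra. }
  unfold rect_int.
  set (I1 := RInt _ x1 _). set (I2 := RInt _ y1 _).
  assert (E1 : Rabs (I1 - (- b1 * Y) * (x1 + X - x1)) <= eps * (X + Y) * (x1 + X - x1)).
  { apply RInt_near_const; [lra| |].
    - apply (CR_on_ex_RInt_x U V x1 (x1 + X) y1 (y1 + Y)); auto; lra.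
    - intros t Ht. destruct (Hpt t y1) as [_ P1]; try lra.
      destruct (Hpt t (y1 + Y)) as [_ P2]; try lra.
      apply Rabs_le_between in P1, P2. apply Rabs_le. lra. }
  assert (E2 : Rabs (I2 - (b1 * X) * (y1 + Y - y1)) <= eps * (X + Y) * (y1 + Y - y1)).
  { apply RInt_near_const; [lra| |].
    - apply (CR_on_ex_RInt_y U V x1 (x1 + X) y1 (y1 + Y)); auto; lra.
    - intros t Ht. destruct (Hpt x1 t) as [P1 _]; try lra.
      destruct (Hpt (x1 + X) t) as [P2 _]; try lra.
      apply Rabs_le_between in P1, P2. apply Rabs_le. lra. }
  apply Rabs_le_between in E1, E2. apply Rabs_le. nra.
Qed.

(** The intervals [[u n, u n + L / 2^n]] are nested; the supremum of their left ends lies in all of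
    them. *)
Lemma nested_limit (u : nat -> R) (L : R) : 0 <= L ->
  (forall n, u n <= u (S n) <= u n + L / 2 ^ S n) ->
  exists z, forall n, u n <= z <= u n + L / 2 ^ n.
Proof.
  intros HL Hu.
  assert (Hmono : forall n k, u n <= u (n + k)%nat).
  { intros n k; induction k; [rewrite Nat.add_0_r; lra|].
    rewrite Nat.add_succ_r. pose proof (Hu (n + k)%nat). lra. }
  assert (Hright : forall n k, u (n + k)%nat + L / 2 ^ (n + k) <= u n + L / 2 ^ n).
  { intros n k; induction k; [rewrite Nat.add_0_r; lra|].
    rewrite Nat.add_succ_r. pose proof (Hu (n + k)%nat).
    assert (L / 2 ^ (n + k) = 2 * (L / 2 ^ S (n + k))).
    { simpl. field. apply pow_nonzero; lra. }
    lra. }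
  assert (Hpos : forall n, 0 <= L / 2 ^ n).
  { intros n. apply Rmult_le_pos; auto. left. apply Rinv_0_lt_compat, pow_lt; lra. }
  assert (Hub : forall n m, u m <= u n + L / 2 ^ n).
  { intros n m. destruct (Nat.le_ge_cases n m) as [H|H].
    - replace m with (n + (m - n))%nat by lia.
      pose proof (Hright n (m - n)%nat). pose proof (Hpos (n + (m - n))%nat). lra.
    - replace n with (m + (n - m))%nat by lia.
      pose proof (Hmono m (n - m)%nat). pose proof (Hpos (m + (n - m))%nat). lra. }
  destruct (completeness (fun r => exists n, r = u n)) as [z [Hz1 Hz2]].
  - exists (u 0%nat + L / 2 ^ 0). intros r [n ->]. apply Hub.
  - exists (u 0%nat), 0%nat; auto.
  - exists z. intros n. split.
    + apply Hz1. now exists n.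
    + apply Hz2. intros r [m ->]. apply Hub.
Qed.

Lemma pow2_inv_small (L d : R) : 0 <= L -> 0 < d -> exists n, L / 2 ^ n < d.
Proof.
  intros HL Hd.
  destruct (Pow_x_infinity 2) with (b := L / d + 1) as [n Hn].
  - rewrite Rabs_pos_eq; lra.
  - exists n. specialize (Hn n (Nat.le_refl _)).
    assert (P : 0 < 2 ^ n) by (apply pow_lt; lra).
    rewrite Rabs_pos_eq in Hn; [|lra].
    apply Rmult_lt_reg_r with (2 ^ n); auto.
    replace (L / 2 ^ n * 2 ^ n) with L by (field; lra).
    apply Rlt_le_trans with (d * (L / d + 1)); [|apply Rmult_le_compat_l; lra].
    replace (d * (L / d + 1)) with (L + d) by (field; lra). lra.
Qed.

(* Goursat's bisection argument. *)
Lemma rect_int_zero U V x0 y0 X Y : 0 <= X -> 0 <= Y ->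
  CR_on U V x0 (x0 + X) y0 (y0 + Y) -> rect_int U V x0 (x0 + X) y0 (y0 + Y) = 0.
Proof.
  intros HX HY HCR.
  destruct (Req_dec (rect_int U V x0 (x0 + X) y0 (y0 + Y)) 0) as [|Hne]; auto. exfalso.
  set (c := Rabs (rect_int U V x0 (x0 + X) y0 (y0 + Y))).
  assert (Hc : 0 < c) by now apply Rabs_pos_lt.
  (* The invariant of the bisection: a piece of depth [k] with lower left corner [p] whose integral
     keeps at least the share [4^(-k)] of the original modulus. *)
  set (Bad := fun (k : nat) (p : R * R) =>
    x0 <= fst p /\ fst p + X / 2 ^ k <= x0 + X /\ y0 <= snd p /\ snd p + Y / 2 ^ k <= y0 + Y /\
    c / 4 ^ k <= Rabs (rect_int U V (fst p) (fst p + X / 2 ^ k) (snd p) (snd p + Y / 2 ^ k))).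
  assert (Hpos : forall L n, 0 <= L -> 0 <= L / 2 ^ n).
  { intros L n HL. apply Rmult_le_pos; auto. left. apply Rinv_0_lt_compat, pow_lt; lra. }
  assert (step : forall k p, Bad k p -> exists p', Bad (S k) p' /\
    fst p <= fst p' <= fst p + X / 2 ^ S k /\ snd p <= snd p' <= snd p + Y / 2 ^ S k).
  { intros k [x y] (B1 & B2 & B3 & B4 & B5). simpl fst in *; simpl snd in *.
    assert (EX : X / 2 ^ k = 2 * (X / 2 ^ S k)) by (simpl; field; apply pow_nonzero; lra).
    assert (EY : Y / 2 ^ k = 2 * (Y / 2 ^ S k)) by (simpl; field; apply pow_nonzero; lra).
    assert (E4 : c / 4 ^ k = 4 * (c / 4 ^ S k)) by (simpl; field; apply pow_nonzero; lra).
    pose proof (Hpos X (S k) HX) as PX. pose proof (Hpos Y (S k) HY) as PY.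
    set (a := X / 2 ^ S k) in *. set (b := Y / 2 ^ S k) in *.
    rewrite EX in B2, B5. rewrite EY in B4, B5. rewrite E4 in B5.
    assert (Hsplit : rect_int U V x (x + 2 * a) y (y + 2 * b) =
      rect_int U V x (x + a) y (y + b) + rect_int U V x (x + a) (y + b) (y + b + b) +
      (rect_int U V (x + a) (x + a + a) y (y + b) +
       rect_int U V (x + a) (x + a + a) (y + b) (y + b + b))).
    { replace (x + 2 * a) with (x + a + a) by ring.
      replace (y + 2 * b) with (y + b + b) by ring.
      rewrite (rect_int_split_x U V x (x + a) (x + a + a)); try lra.
      2: eapply CR_on_sub; eauto; lra.
      rewrite (rect_int_split_y U V x (x + a) y (y + b) (y + b + b)); try lra.
      2: eapply CR_on_sub; eauto; lra.
      rewrite (rect_int_split_y U V (x + a) (x + a + a) y (y + b) (y + b + b)); try lra.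
      eapply CR_on_sub; eauto; lra. }
    rewrite Hsplit in B5.
    set (e := c / 4 ^ S k) in *.
    set (J1 := rect_int U V x (x + a) y (y + b)) in *.
    set (J2 := rect_int U V x (x + a) (y + b) (y + b + b)) in *.
    set (J3 := rect_int U V (x + a) (x + a + a) y (y + b)) in *.
    set (J4 := rect_int U V (x + a) (x + a + a) (y + b) (y + b + b)) in *.
    assert (HJ : e <= Rabs J1 \/ e <= Rabs J2 \/ e <= Rabs J3 \/ e <= Rabs J4).
    { pose proof (Rabs_triang (J1 + J2) (J3 + J4)). pose proof (Rabs_triang J1 J2).
      pose proof (Rabs_triang J3 J4).
      destruct (Rle_dec e (Rabs J1)); [now left|].
      destruct (Rle_dec e (Rabs J2)); [now right; left|].
      destruct (Rle_dec e (Rabs J3)); [now right; right; left|].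
      right; right; right. lra. }
    unfold Bad. fold a b e.
    destruct HJ as [H|[H|[H|H]]];
    [exists (x, y)|exists (x, y + b)|exists (x + a, y)|exists (x + a, y + b)];
    simpl fst; simpl snd; repeat split; auto; lra. }
  assert (Bad0 : Bad 0%nat (x0, y0)).
  { unfold Bad; simpl fst; simpl snd. simpl pow. rewrite !Rdiv_1_r. repeat split; try lra.
    apply Rle_refl. }
  (* The corner is chosen together with its proof of [Bad], so that the recursion can feed the
     invariant to the next choice. *)
  set (next := fun k (s : {p | Bad k p}) =>
    constructive_indefinite_description _ (step k (proj1_sig s) (proj2_sig s))).
  set (seqs := fix go (n : nat) : {p | Bad n p} :=
    match n with
    | O => exist _ (x0, y0) Bad0
    | S n' => let s := next n' (go n') in exist _ (proj1_sig s) (proj1 (proj2_sig s))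
    end).
  set (p := fun n => proj1_sig (seqs n)).
  assert (Hp : forall n, Bad n (p n)) by (intros n; apply (proj2_sig (seqs n))).
  assert (Hstep : forall n, fst (p n) <= fst (p (S n)) <= fst (p n) + X / 2 ^ S n /\
                            snd (p n) <= snd (p (S n)) <= snd (p n) + Y / 2 ^ S n).
  { intros n. exact (proj2 (proj2_sig (next n (seqs n)))). }
  destruct (nested_limit (fun n => fst (p n)) X HX) as [zx Hzx]; [intros n; apply Hstep|].
  destruct (nested_limit (fun n => snd (p n)) Y HY) as [zy Hzy]; [intros n; apply Hstep|].
  assert (Hin : CR_diff U V zx zy).
  { pose proof (Hzx 0%nat) as Z1. pose proof (Hzy 0%nat) as Z2.
    destruct (Hp 0%nat) as (B1 & B2 & B3 & B4 & _). apply HCR; lra. }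
  (* After rescaling by [4^n] the local bound is then below [c / 2], against the lower bound [c];
     the [+ 1] covers [X + Y = 0]. *)
  set (eps := c / (2 * ((X + Y) ^ 2 + 1))).
  assert (Hq : 0 <= (X + Y) ^ 2) by apply pow2_ge_0.
  assert (Heps : 0 < eps) by (apply Rdiv_lt_0_compat; lra).
  destruct (rect_int_local U V zx zy Hin eps Heps) as (d & Hd & Hloc).
  destruct (pow2_inv_small (X + Y) d) as [n Hn]; [lra|lra|].
  assert (Esum : (X + Y) / 2 ^ n = X / 2 ^ n + Y / 2 ^ n) by (field; apply pow_nonzero; lra).
  pose proof (Hpos X n HX) as PX. pose proof (Hpos Y n HY) as PY.
  destruct (Hp n) as (B1 & B2 & B3 & B4 & B5).
  assert (HJ : Rabs (rect_int U V (fst (p n)) (fst (p n) + X / 2 ^ n)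
                     (snd (p n)) (snd (p n) + Y / 2 ^ n)) <= eps * (X / 2 ^ n + Y / 2 ^ n) ^ 2).
  { apply Hloc; try lra; auto. eapply CR_on_sub; eauto; lra. }
  rewrite <- Esum in HJ.
  assert (P4 : 0 < 4 ^ n) by (apply pow_lt; lra).
  assert (E4 : ((X + Y) / 2 ^ n) ^ 2 = (X + Y) ^ 2 / 4 ^ n).
  { unfold Rdiv. rewrite Rpow_mult_distr. f_equal. rewrite pow_inv, <- pow_mult, Nat.mul_comm.
    rewrite pow_mult. do 2 f_equal. ring. }
  rewrite E4 in HJ.
  assert (Hcc : c <= eps * (X + Y) ^ 2).
  { assert (c / 4 ^ n <= eps * ((X + Y) ^ 2 / 4 ^ n)) by lra.
    apply Rmult_le_reg_r with (/ 4 ^ n); [now apply Rinv_0_lt_compat|]. unfold Rdiv in *. lra. }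
  assert (Eeps : eps * (2 * ((X + Y) ^ 2 + 1)) = c) by (unfold eps; field; lra).
  nra.
Qed.

(** * Complex derivatives *)

Lemma Rabs_fst_le (z : C) : Rabs (fst z) <= Cmod z.
Proof. eapply Rle_trans; [apply Rmax_l|apply Rmax_Cmod]. Qed.

Lemma Rabs_snd_le (z : C) : Rabs (snd z) <= Cmod z.
Proof. eapply Rle_trans; [apply Rmax_r|apply Rmax_Cmod]. Qed.

Lemma Cmod_le_sum (z : C) : Cmod z <= Rabs (fst z) + Rabs (snd z).
Proof.
  destruct z as [x y]. simpl.
  replace (x, y) with (Cplus (RtoC x) (Cmult Ci (RtoC y)))
    by (unfold Cplus, Cmult, RtoC, Ci; simpl; f_equal; ring).
  eapply Rle_trans; [apply Cmod_triangle|].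
  rewrite Cmod_mult, !Cmod_R, Cmod_Ci. lra.
Qed.

Lemma Cmod_sub_triangle (x y z : C) :
  Cmod (Cminus x z) <= Cmod (Cminus x y) + Cmod (Cminus y z).
Proof.
  replace (Cminus x z) with (Cplus (Cminus x y) (Cminus y z)) by ring. apply Cmod_triangle.
Qed.

Lemma Cmod_sub_sym (x y : C) : Cmod (Cminus x y) = Cmod (Cminus y x).
Proof. rewrite <- Cmod_opp. f_equal. ring. Qed.

Lemma Cmod_le_sub (x y : C) : Cmod x <= Cmod y + Cmod (Cminus x y).
Proof. replace x with (Cplus y (Cminus x y)) at 1 by ring. apply Cmod_triangle. Qed.

(** The increment form has no quotient, so composition needs no case split on whether the inner
    increment vanishes. *)
Definition cderiv (f : C -> C) (z l : C) : Prop :=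
  forall eps, 0 < eps -> exists d, 0 < d /\
  forall h, Cmod h < d ->
    Cmod (Cminus (Cminus (f (Cplus z h)) (f z)) (Cmult l h)) <= eps * Cmod h.

Definition cdiff (f : C -> C) (z : C) : Prop := exists l, cderiv f z l.

Lemma ex_derive_cdiff (f : C -> C) (z : C) :
  ex_derive (K := C_AbsRing) (V := C_NormedModule) f z -> cdiff f z.
Proof.
  intros [l [_ H]]. exists l. intros eps Heps.
  assert (Hlim : is_filter_lim (locally (T := AbsRing_UniformSpace C_AbsRing) z) z)
    by (intros P HP; exact HP).
  destruct (H z Hlim (mkposreal eps Heps)) as [[d Hd] Hb].
  exists d. split; auto. intros h Hh.
  specialize (Hb (Cplus z h)). simpl in Hb.
  assert (Hball : ball (M := AbsRing_UniformSpace C_AbsRing) z d (Cplus z h)).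
  { change (Cmod (Cplus (Cplus z h) (Copp z)) < d).
    replace (Cplus (Cplus z h) (Copp z)) with h by ring. exact Hh. }
  specialize (Hb Hball).
  change (Cmod (Cplus (Cplus (f (Cplus z h)) (Copp (f z)))
            (Copp (Cmult (Cplus (Cplus z h) (Copp z)) l)))
          <= eps * Cmod (Cplus (Cplus z h) (Copp z))) in Hb.
  replace (Cplus (Cplus z h) (Copp z)) with h in Hb by ring.
  replace (Cminus (Cminus (f (Cplus z h)) (f z)) (Cmult l h)) with
    (Cplus (Cplus (f (Cplus z h)) (Copp (f z))) (Copp (Cmult h l))) by ring.
  exact Hb.
Qed.

Lemma cderiv_lipschitz f z l : cderiv f z l -> exists d, 0 < d /\
  forall h, Cmod h < d -> Cmod (Cminus (f (Cplus z h)) (f z)) <= (Cmod l + 1) * Cmod h.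
Proof.
  intros H. destruct (H 1 Rlt_0_1) as (d & Hd & Hb). exists d. split; auto.
  intros h Hh. specialize (Hb h Hh).
  eapply Rle_trans; [apply (Cmod_le_sub _ (Cmult l h))|]. rewrite Cmod_mult. lra.
Qed.

Lemma cdiff_const c z : cdiff (fun _ => c) z.
Proof.
  exists (RtoC 0). intros eps He. exists 1. split; [lra|]. intros h _.
  replace (Cminus (Cminus c c) (Cmult (RtoC 0) h)) with (RtoC 0) by ring.
  rewrite Cmod_0. apply Rmult_le_pos; [lra|apply Cmod_ge_0].
Qed.

Lemma cdiff_affine a b z : cdiff (fun s => Cplus a (Cmult b s)) z.
Proof.
  exists b. intros eps He. exists 1. split; [lra|]. intros h _.
  replace (Cminus _ _) with (RtoC 0) by ring.
  rewrite Cmod_0. apply Rmult_le_pos; [lra|apply Cmod_ge_0].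
Qed.

Lemma cdiff_ext f g z : (forall s, f s = g s) -> cdiff f z -> cdiff g z.
Proof.
  intros E [l H]. exists l. intros eps He. destruct (H eps He) as (d & Hd & Hb).
  exists d. split; auto. intros h Hh. rewrite <- !E. auto.
Qed.

Lemma cdiff_plus f g z : cdiff f z -> cdiff g z -> cdiff (fun s => Cplus (f s) (g s)) z.
Proof.
  intros [l Hf] [m Hg]. exists (Cplus l m). intros eps He.
  destruct (Hf (eps / 2)) as (d1 & Hd1 & H1); [lra|].
  destruct (Hg (eps / 2)) as (d2 & Hd2 & H2); [lra|].
  exists (Rmin d1 d2). split; [now apply Rmin_pos|]. intros h Hh.
  pose proof (Rmin_l d1 d2). pose proof (Rmin_r d1 d2).
  specialize (H1 h ltac:(lra)). specialize (H2 h ltac:(lra)).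
  replace (Cminus _ _) with
    (Cplus (Cminus (Cminus (f (Cplus z h)) (f z)) (Cmult l h))
           (Cminus (Cminus (g (Cplus z h)) (g z)) (Cmult m h))) by ring.
  eapply Rle_trans; [apply Cmod_triangle|]. lra.
Qed.

Lemma cdiff_mult f g z : cdiff f z -> cdiff g z -> cdiff (fun s => Cmult (f s) (g s)) z.
Proof.
  intros [l Hf] [m Hg]. exists (Cplus (Cmult l (g z)) (Cmult (f z) m)). intros eps He.
  (* [A] adds up the coefficients of the three remainders of a product; the third, the product of
     both increments, is quadratic in [h] and is made small by [Cmod h < eps / A]. *)
  set (A := Cmod (f z) + Cmod (g z) + (Cmod l + 1) * (Cmod m + 1) + 1).
  pose proof (Cmod_ge_0 (f z)). pose proof (Cmod_ge_0 (g z)).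
  pose proof (Cmod_ge_0 l). pose proof (Cmod_ge_0 m).
  assert (HB : 0 < (Cmod l + 1) * (Cmod m + 1)) by (apply Rmult_lt_0_compat; lra).
  assert (HA : 0 < A) by (unfold A; lra).
  assert (He' : 0 < eps / A) by now apply Rdiv_lt_0_compat.
  destruct (Hf _ He') as (d1 & Hd1 & B1). destruct (Hg _ He') as (d2 & Hd2 & B2).
  destruct (cderiv_lipschitz _ _ _ Hf) as (d3 & Hd3 & B3).
  destruct (cderiv_lipschitz _ _ _ Hg) as (d4 & Hd4 & B4).
  exists (Rmin (Rmin d1 d2) (Rmin (Rmin d3 d4) (eps / A))). split.
  { repeat apply Rmin_pos; auto. }
  intros h Hh.
  assert (G : Cmod h < d1 /\ Cmod h < d2 /\ Cmod h < d3 /\ Cmod h < d4 /\ Cmod h < eps / A).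
  { pose proof (Rmin_l (Rmin d1 d2) (Rmin (Rmin d3 d4) (eps / A))).
    pose proof (Rmin_r (Rmin d1 d2) (Rmin (Rmin d3 d4) (eps / A))).
    pose proof (Rmin_l d1 d2). pose proof (Rmin_r d1 d2).
    pose proof (Rmin_l (Rmin d3 d4) (eps / A)). pose proof (Rmin_r (Rmin d3 d4) (eps / A)).
    pose proof (Rmin_l d3 d4). pose proof (Rmin_r d3 d4). repeat split; lra. }
  destruct G as (G1 & G2 & G3 & G4 & G5).
  specialize (B1 h G1). specialize (B2 h G2). specialize (B3 h G3). specialize (B4 h G4).
  replace (Cminus _ _) with
    (Cplus (Cplus (Cmult (Cminus (Cminus (f (Cplus z h)) (f z)) (Cmult l h)) (g z))
                  (Cmult (f z) (Cminus (Cminus (g (Cplus z h)) (g z)) (Cmult m h))))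
           (Cmult (Cminus (f (Cplus z h)) (f z)) (Cminus (g (Cplus z h)) (g z)))) by ring.
  eapply Rle_trans; [apply Cmod_triangle|].
  eapply Rle_trans; [apply Rplus_le_compat_r, Cmod_triangle|].
  rewrite !Cmod_mult.
  pose proof (Cmod_ge_0 h) as Hh0.
  set (r := Cmod h) in *. set (e1 := eps / A) in *.
  assert (K1 : Cmod (Cminus (f (Cplus z h)) (f z)) * Cmod (Cminus (g (Cplus z h)) (g z)) <=
     ((Cmod l + 1) * r) * ((Cmod m + 1) * r))
    by (apply Rmult_le_compat; auto using Cmod_ge_0).
  assert (K2 : ((Cmod l + 1) * r) * ((Cmod m + 1) * r) <= ((Cmod l + 1) * (Cmod m + 1)) * (e1 * r)).
  { replace ((Cmod l + 1) * r * ((Cmod m + 1) * r)) with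
      ((Cmod l + 1) * (Cmod m + 1) * (r * r)) by ring.
    apply Rmult_le_compat_l; [lra|]. apply Rmult_le_compat_r; lra. }
  assert (K3 := Rmult_le_compat_r _ _ _ (Cmod_ge_0 (g z)) B1).
  assert (K4 := Rmult_le_compat_l _ _ _ (Cmod_ge_0 (f z)) B2).
  assert (E : eps * r = A * (e1 * r)) by (unfold e1; field; lra).
  assert (0 <= e1 * r) by (apply Rmult_le_pos; lra).
  rewrite E. unfold A. lra.
Qed.

Lemma cdiff_comp f g z : cdiff f z -> cdiff g (f z) -> cdiff (fun s => g (f s)) z.
Proof.
  intros [l Hf] [m Hg]. exists (Cmult m l). intros eps He.
  pose proof (Cmod_ge_0 l). pose proof (Cmod_ge_0 m).
  set (A := Cmod l + 1 + Cmod m).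
  assert (HA : 0 < A) by (unfold A; lra).
  assert (He' : 0 < eps / A) by now apply Rdiv_lt_0_compat.
  destruct (Hf _ He') as (d1 & Hd1 & B1). destruct (Hg _ He') as (d2 & Hd2 & B2).
  destruct (cderiv_lipschitz _ _ _ Hf) as (d3 & Hd3 & B3).
  assert (Hd4 : 0 < d2 / (Cmod l + 1)) by (apply Rdiv_lt_0_compat; lra).
  exists (Rmin d1 (Rmin d3 (d2 / (Cmod l + 1)))). split.
  { repeat apply Rmin_pos; auto. }
  intros h Hh.
  pose proof (Rmin_l d1 (Rmin d3 (d2 / (Cmod l + 1)))).
  pose proof (Rmin_r d1 (Rmin d3 (d2 / (Cmod l + 1)))).
  pose proof (Rmin_l d3 (d2 / (Cmod l + 1))). pose proof (Rmin_r d3 (d2 / (Cmod l + 1))).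
  specialize (B1 h ltac:(lra)). specialize (B3 h ltac:(lra)).
  set (k := Cminus (f (Cplus z h)) (f z)) in *.
  assert (Hk : Cmod k < d2).
  { eapply Rle_lt_trans; [apply B3|].
    apply Rlt_le_trans with ((Cmod l + 1) * (d2 / (Cmod l + 1))).
    - apply Rmult_lt_compat_l; lra.
    - right. field. lra. }
  specialize (B2 k Hk).
  replace (Cplus (f z) k) with (f (Cplus z h)) in B2 by (unfold k; ring).
  replace (Cminus _ _) with
    (Cplus (Cminus (Cminus (g (f (Cplus z h))) (g (f z))) (Cmult m k))
           (Cmult m (Cminus k (Cmult l h)))) by ring.
  eapply Rle_trans; [apply Cmod_triangle|]. rewrite Cmod_mult.
  assert (K3 := Rmult_le_compat_l _ _ _ (Cmod_ge_0 m) B1).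
  assert (K4 : eps / A * Cmod k <= eps / A * ((Cmod l + 1) * Cmod h))
    by (apply Rmult_le_compat_l; lra).
  assert (E : eps * Cmod h = A * (eps / A * Cmod h)) by (field; lra).
  rewrite E. unfold A at 1. lra.
Qed.

(** * The complex exponential *)

Definition cexp (z : C) : C := (exp (fst z) * cos (snd z), exp (fst z) * sin (snd z)).

Lemma cexp_plus a b : cexp (Cplus a b) = Cmult (cexp a) (cexp b).
Proof.
  destruct a as [a1 a2], b as [b1 b2]. unfold cexp, Cmult, Cplus; simpl.
  rewrite exp_plus, cos_plus, sin_plus. f_equal; ring.
Qed.

Lemma cexp_0 : cexp (RtoC 0) = RtoC 1.
Proof. unfold cexp, RtoC; simpl. rewrite exp_0, cos_0, sin_0. f_equal; ring. Qed.

Lemma Cmod_cexp z : Cmod (cexp z) = exp (fst z).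
Proof.
  unfold Cmod, cexp; simpl.
  replace (_ + _) with (Rsqr (exp (fst z)) * (Rsqr (sin (snd z)) + Rsqr (cos (snd z))))
    by (unfold Rsqr; ring).
  rewrite sin2_cos2, Rmult_1_r. apply sqrt_Rsqr. left; apply exp_pos.
Qed.

Lemma derivable_pt_lim_0_bound f l : derivable_pt_lim f 0 l ->
  forall eps, 0 < eps -> exists d, 0 < d /\
  forall h, Rabs h < d -> Rabs (f h - f 0 - l * h) <= eps * Rabs h.
Proof.
  intros H eps He. destruct (H eps He) as [[d Hd] Hb]. exists d. split; auto.
  intros h Hh. destruct (Req_dec h 0) as [->|Hh0].
  - replace (f 0 - f 0 - l * 0) with 0 by ring. rewrite Rabs_R0. lra.
  - specialize (Hb h Hh0 Hh). rewrite Rplus_0_l in Hb.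
    replace (f h - f 0 - l * h) with (((f h - f 0) / h - l) * h) by (field; auto).
    rewrite Rabs_mult. apply Rmult_le_compat_r; [apply Rabs_pos|lra].
Qed.

Lemma cderiv_cexp_0 : cderiv cexp (RtoC 0) (RtoC 1).
Proof.
  (* The two coordinates contribute [4 e r] and [5 e r], so [eps / 14] leaves room. The cap 1 keeps
     [a <= 1], hence [exp a <= 3]. *)
  intros eps He. set (e := Rmin (eps / 14) 1).
  assert (H0 : 0 < e) by (apply Rmin_pos; lra).
  assert (H14 : e <= eps / 14) by apply Rmin_l.
  assert (He1 : e <= 1) by apply Rmin_r. clearbody e.
  destruct (derivable_pt_lim_0_bound exp 1 derivable_pt_lim_exp_0 e H0) as (d1 & Hd1 & H1).
  destruct (derivable_pt_lim_0_bound sin 1 derivable_pt_lim_sin_0 e H0) as (d2 & Hd2 & H2).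
  assert (Hcos : derivable_pt_lim cos 0 0).
  { replace 0 with (- sin 0) at 2 by (rewrite sin_0; ring). apply derivable_pt_lim_cos. }
  destruct (derivable_pt_lim_0_bound cos 0 Hcos e H0) as (d3 & Hd3 & H3).
  exists (Rmin (Rmin d1 d2) (Rmin d3 e)). split; [repeat apply Rmin_pos; auto|].
  intros [a b] Hh.
  pose proof (Rmin_l (Rmin d1 d2) (Rmin d3 e)). pose proof (Rmin_r (Rmin d1 d2) (Rmin d3 e)).
  pose proof (Rmin_l d1 d2). pose proof (Rmin_r d1 d2).
  pose proof (Rmin_l d3 e). pose proof (Rmin_r d3 e).
  pose proof (Rabs_fst_le (a, b)) as Ha. pose proof (Rabs_snd_le (a, b)) as Hb.
  simpl fst in Ha. simpl snd in Hb.
  replace (Cplus (RtoC 0) (a, b)) with ((a, b) : C)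
    by (unfold Cplus, RtoC; simpl; f_equal; ring).
  rewrite cexp_0. specialize (H1 a ltac:(lra)). specialize (H2 b ltac:(lra)).
  specialize (H3 b ltac:(lra)). rewrite exp_0 in H1. rewrite sin_0 in H2. rewrite cos_0 in H3.
  set (r := Cmod (a, b)) in *.
  assert (Hexp : exp a <= 3).
  { apply Rle_trans with (exp 1); [|apply exp_le_3].
    destruct (Req_dec a 1) as [->|]; [lra|]. left. apply exp_increasing.
    pose proof (Rle_abs a). lra. }
  pose proof (exp_pos a).
  eapply Rle_trans; [apply Cmod_le_sum|].
  unfold cexp, Cminus, Cplus, Copp, Cmult, RtoC; simpl.
  replace (exp a * cos b + - (1) + - (1 * a - 0 * b)) with
    ((exp a - 1 - 1 * a) + exp a * (cos b - 1 - 0 * b)) by ring.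
  replace (exp a * sin b + -0 + - (1 * b + 0 * a)) with
    ((exp a) * (sin b - 0 - 1 * b) + ((exp a - 1 - 1 * a) + a) * b) by ring.
  assert (Rabs (exp a - 1 - 1 * a + exp a * (cos b - 1 - 0 * b)) <= e * r + 3 * (e * r)).
  { eapply Rle_trans; [apply Rabs_triang|]. apply Rplus_le_compat.
    - eapply Rle_trans; [apply H1|]. apply Rmult_le_compat_l; lra.
    - rewrite Rabs_mult. rewrite (Rabs_pos_eq (exp a)); [|lra].
      apply Rmult_le_compat; [lra|apply Rabs_pos|lra|].
      eapply Rle_trans; [apply H3|]. apply Rmult_le_compat_l; lra. }
  assert (Rabs (exp a * (sin b - 0 - 1 * b) + (exp a - 1 - 1 * a + a) * b) <=
     3 * (e * r) + (2 * e) * r).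
  { eapply Rle_trans; [apply Rabs_triang|]. apply Rplus_le_compat.
    - rewrite Rabs_mult. rewrite (Rabs_pos_eq (exp a)); [|lra].
      apply Rmult_le_compat; [lra|apply Rabs_pos|lra|].
      eapply Rle_trans; [apply H2|]. apply Rmult_le_compat_l; lra.
    - rewrite Rabs_mult. apply Rmult_le_compat; [apply Rabs_pos|apply Rabs_pos| |lra].
      eapply Rle_trans; [apply Rabs_triang|].
      assert (e * Rabs a <= 1 * e) by (rewrite Rmult_comm; apply Rmult_le_compat_r; lra). lra. }
  assert (0 <= r) by apply Cmod_ge_0.
  assert (e * r <= eps / 14 * r) by (apply Rmult_le_compat_r; lra).
  assert (0 <= eps / 14 * r) by (apply Rmult_le_pos; lra). lra.
Qed.

Lemma cdiff_cexp z : cdiff cexp z.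
Proof.
  exists (cexp z). intros eps He. pose proof (Cmod_ge_0 (cexp z)).
  destruct (cderiv_cexp_0 (eps / (Cmod (cexp z) + 1))) as (d & Hd & Hb).
  { apply Rdiv_lt_0_compat; lra. }
  exists d. split; auto. intros h Hh. specialize (Hb h Hh).
  replace (Cplus (RtoC 0) h) with h in Hb by ring.
  rewrite cexp_0 in Hb. rewrite cexp_plus.
  replace (Cminus _ _) with
    (Cmult (cexp z) (Cminus (Cminus (cexp h) (RtoC 1)) (Cmult (RtoC 1) h))) by ring.
  rewrite Cmod_mult.
  apply Rle_trans with (Cmod (cexp z) * (eps / (Cmod (cexp z) + 1) * Cmod h)).
  - apply Rmult_le_compat_l; lra.
  - replace (eps * Cmod h) with ((Cmod (cexp z) + 1) * (eps / (Cmod (cexp z) + 1) * Cmod h))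
      by (field; lra).
    apply Rmult_le_compat_r; [|lra]. apply Rmult_le_pos; [|apply Cmod_ge_0].
    left. apply Rdiv_lt_0_compat; lra.
Qed.

Lemma cdiff_CR f x y : cdiff f (x, y) ->
  CR_diff (fun x y => fst (f (x, y))) (fun x y => snd (f (x, y))) x y.
Proof.
  intros [[b1 b2] H]. exists b1, b2. intros eps He.
  destruct (H eps He) as (d & Hd & Hb). exists (d / 2). split; [lra|].
  intros x' y' Hx Hy.
  assert (Hh : Cmod (x' - x, y' - y) <= Rabs (x' - x) + Rabs (y' - y)) by apply Cmod_le_sum.
  specialize (Hb (x' - x, y' - y) ltac:(lra)).
  replace (Cplus (x, y) (x' - x, y' - y)) with ((x', y') : C) in Hb
    by (unfold Cplus; simpl; f_equal; ring).
  assert (Hb' : Cmod (Cminus (Cminus (f (x', y')) (f (x, y))) (Cmult (b1, b2) (x' - x, y' - y)))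
    <= eps * (Rabs (x' - x) + Rabs (y' - y))).
  { eapply Rle_trans; [apply Hb|]. apply Rmult_le_compat_l; lra. }
  pose proof (Rabs_fst_le (Cminus (Cminus (f (x', y')) (f (x, y))) (Cmult (b1, b2) (x' - x, y' - y)))) as H1.
  pose proof (Rabs_snd_le (Cminus (Cminus (f (x', y')) (f (x, y))) (Cmult (b1, b2) (x' - x, y' - y)))) as H2.
  simpl in H1, H2. split.
  - eapply Rle_trans; [|apply Hb']. eapply Rle_trans; [|apply H1]. right. f_equal. ring.
  - eapply Rle_trans; [|apply Hb']. eapply Rle_trans; [|apply H2]. right. f_equal. ring.
Qed.

Lemma cdiff_segment_bounded (f : C -> C) (z w : C) :
  (forall t, 0 <= t <= 1 -> cdiff f (Cplus z (Cmult (RtoC t) w))) ->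
  exists M, 0 <= M /\ forall t, 0 <= t <= 1 -> Cmod (f (Cplus z (Cmult (RtoC t) w))) <= M.
Proof.
  intros H.
  destruct (continuity_ab_maj (fun t => Cmod (f (Cplus z (Cmult (RtoC t) w)))) 0 1)
    as (M & HM & _); [lra| |].
  - intros t Ht. apply continuity_pt_filterlim.
    destruct (H t Ht) as [l Hl].
    destruct (cderiv_lipschitz _ _ _ Hl) as (d & Hd & Hb).
    pose proof (Cmod_ge_0 w). pose proof (Cmod_ge_0 l).
    apply (continuous_of_lipschitz_at (fun t => Cmod (f (Cplus z (Cmult (RtoC t) w)))) t
             ((Cmod l + 1) * Cmod w) (d / (Cmod w + 1))).
    + apply Rdiv_lt_0_compat; lra.
    + intros t' Ht'.
      specialize (Hb (Cmult (RtoC (t' - t)) w)).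
      rewrite Cmod_mult, Cmod_R in Hb.
      replace (Cplus (Cplus z (Cmult (RtoC t) w)) (Cmult (RtoC (t' - t)) w)) with
        (Cplus z (Cmult (RtoC t') w)) in Hb by (rewrite RtoC_minus; ring).
      apply Rle_trans with (Cmod (Cminus (f (Cplus z (Cmult (RtoC t') w))) (f (Cplus z (Cmult (RtoC t) w))))).
      * pose proof (Cmod_le_sub (f (Cplus z (Cmult (RtoC t') w))) (f (Cplus z (Cmult (RtoC t) w)))).
        pose proof (Cmod_le_sub (f (Cplus z (Cmult (RtoC t) w))) (f (Cplus z (Cmult (RtoC t') w)))) as K.
        rewrite (Cmod_sub_sym (f (Cplus z (Cmult (RtoC t) w)))) in K.
        apply Rabs_le. lra.
      * eapply Rle_trans; [apply Hb|right; ring].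
        apply Rle_lt_trans with (Rabs (t' - t) * (Cmod w + 1)).
        { apply Rmult_le_compat_l; [apply Rabs_pos|lra]. }
        apply Rlt_le_trans with (d / (Cmod w + 1) * (Cmod w + 1)); [|right; field; lra].
        apply Rmult_lt_compat_r; lra.
  - exists (Cmod (f (Cplus z (Cmult (RtoC M) w)))). split; [apply Cmod_ge_0|].
    intros t Ht. apply (HM t Ht).
Qed.

(** * Unique continuation *)

Lemma RInt_le_const (g : R -> R) (a b k : R) :
  a <= b -> ex_RInt g a b -> (forall t, a < t < b -> g t <= k) -> RInt g a b <= k * (b - a).
Proof.
  intros Hab Hg Hk. replace (k * (b - a)) with (RInt (fun _ => k) a b).
  - apply RInt_le; auto. apply ex_RInt_const.
  - rewrite RInt_const. unfold scal; simpl. unfold mult; simpl. ring.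
Qed.

Lemma exp_le_mono x y : x <= y -> exp x <= exp y.
Proof. intros [H| ->]; [left; now apply exp_increasing|lra]. Qed.

(* With the weight exp(lam z^2) the integral over the imaginary axis is dominated by a
   Gaussian peak at 0, while on the rest of the rectangle either the weight is exponentially
   smaller (horizontal edges, because dl < b) or g itself is small (right edge). *)
Lemma gaussian_peak_bound (g : C -> C) (dl b lam eta e e' M : R) :
  0 < dl -> 0 < lam -> 0 < eta <= b -> 0 <= e -> 0 <= e' -> 0 <= M ->
  (forall x y, 0 <= x <= dl -> - b <= y <= b -> cdiff g (x, y)) ->
  (forall x, 0 <= x <= dl -> Cmod (g (x, - b)) <= M /\ Cmod (g (x, b)) <= M) ->
  (forall y, - b <= y <= b -> Cmod (g (0, y)) <= M) ->
  (forall y, - b <= y <= b -> Cmod (g (dl, y)) <= e') ->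
  (forall y, - eta <= y <= eta -> e / 2 <= fst (g (0, y))) ->
  e / 2 * eta * exp (- lam * eta ^ 2 / 4) <=
    2 * b * M * exp (- lam * eta ^ 2) + 2 * dl * M * exp (lam * (dl ^ 2 - b ^ 2))
    + 2 * b * e' * exp (lam * dl ^ 2).
Proof.
  intros Hdl Hlam [Heta Hetab] He He' HM Hdiff Hhor Hleft Hright Hpeak.
  set (W := fun z : C => cexp (Cmult (RtoC lam) (Cmult z z))).
  set (H := fun z : C => Cmult (g z) (W z)).
  assert (HW : forall x y, Cmod (W (x, y)) = exp (lam * (x ^ 2 - y ^ 2))).
  { intros. unfold W. rewrite Cmod_cexp. f_equal. simpl. ring. }
  assert (HCR : CR_on (fun x y => fst (H (x, y))) (fun x y => snd (H (x, y))) 0 (0 + dl) (- b) (- b + 2 * b)).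
  { intros x y Hx Hy. apply cdiff_CR. unfold H. apply cdiff_mult; [apply Hdiff; lra|].
    unfold W. apply (cdiff_comp (fun z => Cmult (RtoC lam) (Cmult z z)) cexp); [|apply cdiff_cexp].
    apply cdiff_mult; [apply cdiff_const|].
    assert (cdiff (fun z => z) (x, y)).
    { apply (cdiff_ext (fun s => Cplus (RtoC 0) (Cmult (RtoC 1) s))); [intros; ring|apply cdiff_affine]. }
    now apply cdiff_mult. }
  pose proof (rect_int_zero _ _ 0 (- b) dl (2 * b) ltac:(lra) ltac:(lra) HCR) as HZ.
  unfold rect_int in HZ.
  set (U := fun x y => fst (H (x, y))) in *. set (V := fun x y => snd (H (x, y))) in *.
  replace (0 + dl) with dl in * by ring. replace (- b + 2 * b) with b in * by ring.
  change (RInt (fun x => V x (- b) - V x b) 0 dl +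
          RInt (fun y => U dl y - U 0 y) (- b) b = 0) in HZ.
  assert (Hb1 : Rabs (RInt (fun x => V x (- b) - V x b) 0 dl) <=
     2 * M * exp (lam * (dl ^ 2 - b ^ 2)) * dl).
  { apply Rle_trans with ((dl - 0) * (2 * M * exp (lam * (dl ^ 2 - b ^ 2)))); [|lra].
    apply abs_RInt_le_const.
    - lra.
    - apply (CR_on_ex_RInt_x U V 0 dl (- b) b); auto; lra.
    - intros x Hx. destruct (Hhor x Hx) as [H1 H2].
      assert (E1 : Rabs (V x (- b)) <= M * exp (lam * (dl ^ 2 - b ^ 2))).
      { unfold V. eapply Rle_trans; [apply Rabs_snd_le|]. unfold H. rewrite Cmod_mult, HW.
        apply Rmult_le_compat; auto using Cmod_ge_0; [left; apply exp_pos|].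
        apply exp_le_mono. apply Rmult_le_compat_l; [lra|]. nra. }
      assert (E2 : Rabs (V x b) <= M * exp (lam * (dl ^ 2 - b ^ 2))).
      { unfold V. eapply Rle_trans; [apply Rabs_snd_le|]. unfold H. rewrite Cmod_mult, HW.
        apply Rmult_le_compat; auto using Cmod_ge_0; [left; apply exp_pos|].
        apply exp_le_mono. apply Rmult_le_compat_l; [lra|]. nra. }
      apply Rabs_le_between in E1, E2. apply Rabs_le. rewrite Rmult_assoc. lra. }
  (* [P] bounds the right edge, [Q] the negative part of the left edge, [T] the peak. The peak is
     measured only for [|y| <= eta / 2], where the weight is at least [exp (- lam eta^2 / 4)];
     negative values can occur only beyond [eta], where the weight is at most [exp (- lam eta^2)].
     This gap lets a large [lam] win. *)
  set (P := e' * exp (lam * dl ^ 2)). set (Q := M * exp (- lam * eta ^ 2)).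
  set (T := e / 2 * exp (- lam * eta ^ 2 / 4)).
  assert (HP : forall y, - b <= y <= b -> U dl y <= P).
  { intros y Hy. eapply Rle_trans; [apply Rle_abs|]. unfold U.
    eapply Rle_trans; [apply Rabs_fst_le|]. unfold H. rewrite Cmod_mult, HW.
    apply Rmult_le_compat; auto using Cmod_ge_0; [left; apply exp_pos|].
    apply exp_le_mono. apply Rmult_le_compat_l; [lra|]. nra. }
  assert (HU0 : forall y, U 0 y = fst (g (0, y)) * exp (- lam * y ^ 2)).
  { intros y. unfold U, H, W.
    replace (Cmult (RtoC lam) (Cmult (0, y) (0, y))) with (RtoC (- lam * y ^ 2))
      by (unfold Cmult, RtoC; simpl; f_equal; ring).
    unfold cexp, RtoC; simpl. rewrite cos_0, sin_0. ring. }
  assert (Hexpos := exp_pos).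
  assert (HQ0 : 0 <= Q) by (apply Rmult_le_pos; [lra|left; apply exp_pos]).
  assert (Hout : forall y, - b <= y <= b -> eta / 2 <= Rabs y -> - U 0 y <= Q).
  { intros y Hy Hy2. rewrite HU0. destruct (Rle_dec (Rabs y) eta) as [Hle|Hgt].
    - assert (e / 2 <= fst (g (0, y))) by (apply Hpeak; apply Rabs_le_between; auto).
      pose proof (Hexpos (- lam * y ^ 2)). nra.
    - assert (Hg : - fst (g (0, y)) <= M).
      { eapply Rle_trans; [|apply (Hleft y Hy)].
        eapply Rle_trans; [|apply Rabs_fst_le]. rewrite <- Rabs_Ropp. apply Rle_abs. }
      unfold Q. apply Rle_trans with (M * exp (- lam * y ^ 2)).
      + replace (- (fst (g (0, y)) * exp (- lam * y ^ 2))) with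
          (- fst (g (0, y)) * exp (- lam * y ^ 2)) by ring.
        apply Rmult_le_compat_r; auto. left; apply exp_pos.
      + apply Rmult_le_compat_l; auto. apply exp_le_mono.
        assert (eta ^ 2 <= y ^ 2) by (rewrite <- (pow2_abs y); apply pow_incr; lra). nra. }
  assert (Hin : forall y, - (eta / 2) <= y <= eta / 2 -> T <= U 0 y).
  { intros y Hy. rewrite HU0. unfold T. apply Rmult_le_compat; [lra|left; apply exp_pos| |].
    - apply Hpeak; lra.
    - apply exp_le_mono. assert (y ^ 2 <= (eta / 2) ^ 2) by nra. nra. }
  assert (Hex : forall c d, - b <= c -> c <= d -> d <= b -> ex_RInt (fun y => U dl y - U 0 y) c d).
  { intros. apply (CR_on_ex_RInt_y U V 0 dl (- b) b); auto; lra. }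
  assert (HI : RInt (fun y => U dl y - U 0 y) (- b) b <= 2 * b * (P + Q) - T * eta).
  { rewrite <- (RInt_Chasles (V := R_CompleteNormedModule) _ (- b) (- (eta / 2)) b);
      try (apply Hex; lra).
    rewrite <- (RInt_Chasles (V := R_CompleteNormedModule) _ (- (eta / 2)) (eta / 2) b);
      try (apply Hex; lra).
    unfold plus; simpl.
    assert (I1 : RInt (fun y => U dl y - U 0 y) (- b) (- (eta / 2)) <= (P + Q) * (- (eta / 2) - - b)).
    { apply RInt_le_const; [lra|apply Hex; lra|]. intros y Hy.
      pose proof (HP y ltac:(lra)).
      pose proof (Hout y ltac:(lra) ltac:(rewrite Rabs_left; lra)). lra. }
    assert (I2 : RInt (fun y => U dl y - U 0 y) (- (eta / 2)) (eta / 2) <=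
       (P + Q - T) * (eta / 2 - - (eta / 2))).
    { apply RInt_le_const; [lra|apply Hex; lra|]. intros y Hy.
      pose proof (HP y ltac:(lra)). pose proof (Hin y ltac:(lra)). lra. }
    assert (I3 : RInt (fun y => U dl y - U 0 y) (eta / 2) b <= (P + Q) * (b - eta / 2)).
    { apply RInt_le_const; [lra|apply Hex; lra|]. intros y Hy.
      pose proof (HP y ltac:(lra)).
      pose proof (Hout y ltac:(lra) ltac:(rewrite Rabs_pos_eq; lra)). lra. }
    lra. }
  apply Rabs_le_between in Hb1. unfold P, Q, T in HI. lra.
Qed.

Lemma segment_bound_h (f : C -> C) (a y : R) : 0 <= a ->
  (forall x, 0 <= x <= a -> cdiff f (x, y)) ->
  exists M, 0 <= M /\ forall x, 0 <= x <= a -> Cmod (f (x, y)) <= M.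
Proof.
  intros Ha H. destruct (Req_dec a 0) as [->|Hne].
  - exists (Cmod (f (0, y))). split; [apply Cmod_ge_0|]. intros x Hx.
    replace x with 0 by lra. lra.
  - destruct (cdiff_segment_bounded f (0, y) (RtoC a)) as (M & HM & Hb).
    + intros t Ht.
      replace (Cplus _ _) with ((t * a, y) : C)
        by (unfold Cplus, Cmult, RtoC; simpl; f_equal; ring).
      apply H. nra.
    + exists M. split; auto. intros x Hx. specialize (Hb (x / a)).
      replace (Cplus _ _) with ((x, y) : C) in Hb
        by (unfold Cplus, Cmult, RtoC; simpl; f_equal; field; auto).
      apply Hb. split; [apply Rdiv_le_0_compat; lra|].
      apply Rmult_le_reg_r with a; [lra|]. unfold Rdiv. rewrite Rmult_assoc, Rinv_l; lra.
Qed.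

Lemma segment_bound_v (f : C -> C) (x b : R) : 0 < b ->
  (forall y, - b <= y <= b -> cdiff f (x, y)) ->
  exists M, 0 <= M /\ forall y, - b <= y <= b -> Cmod (f (x, y)) <= M.
Proof.
  intros Hb H.
  destruct (cdiff_segment_bounded f (x, - b) (0, 2 * b)) as (M & HM & HB).
  - intros t Ht.
    replace (Cplus _ _) with ((x, - b + 2 * b * t) : C)
      by (unfold Cplus, Cmult, RtoC; simpl; f_equal; ring).
    apply H. nra.
  - exists M. split; auto. intros y Hy. specialize (HB ((y + b) / (2 * b))).
    replace (Cplus _ _) with ((x, y) : C) in HB
      by (unfold Cplus, Cmult, RtoC; simpl; f_equal; field; lra).
    apply HB. split; [apply Rdiv_le_0_compat; lra|].
    apply Rmult_le_reg_r with (2 * b); [lra|]. unfold Rdiv. rewrite Rmult_assoc, Rinv_l; lra.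
Qed.

Definition tends0 (u : nat -> C) : Prop :=
  forall e, 0 < e -> exists N, forall n, (N <= n)%nat -> Cmod (u n) <= e.

(** Uniform convergence without a name for the limit: Goursat's theorem is only applied to single
    members of the sequence, so no regularity of the limit has to be proved. *)
Definition unif_cauchy (D : nat -> C -> C) (P : C -> Prop) : Prop :=
  forall e, 0 < e -> exists N, forall n m, (N <= n)%nat -> (N <= m)%nat ->
    forall z, P z -> Cmod (Cminus (D n z) (D m z)) <= e.

(* Unique continuation for the limit of D: the limit vanishes at 0 if it vanishes on the far
   side of a rectangle that is longer (2b) than twice its depth (dl). *)
Lemma continuation_step (D : nat -> C -> C) (dl b : R) : 0 < dl -> dl < b ->
  (forall n x y, 0 <= x <= dl -> - b <= y <= b -> cdiff (D n) (x, y)) ->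
  unif_cauchy D (fun z => 0 <= fst z <= dl /\ - b <= snd z <= b) ->
  (forall y, - b <= y <= b -> tends0 (fun n => D n (dl, y))) ->
  tends0 (fun n => D n (RtoC 0)).
Proof.
  intros Hdl Hdb Hdiff HC Hedge e He.
  (* One member [D N1] supplies the bound [M] and the window [eta], so that both, and then [lam],
     are fixed before the index [n] that is to be contradicted. *)
  destruct (HC (e / 8)) as [N1 HN1]; [lra|].
  destruct (segment_bound_h (D N1) dl (- b)) as (M1 & HM1 & HB1);
    [lra|intros; apply Hdiff; lra|].
  destruct (segment_bound_h (D N1) dl b) as (M2 & HM2 & HB2);
    [lra|intros; apply Hdiff; lra|].
  destruct (segment_bound_v (D N1) 0 b) as (M3 & HM3 & HB3);
    [lra|intros; apply Hdiff; lra|].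
  set (M := M1 + M2 + M3 + e / 8).
  destruct (Hdiff N1 0 0) as [l0 Hl0]; [lra|lra|].
  destruct (cderiv_lipschitz _ _ _ Hl0) as (d0 & Hd0 & Hlip).
  pose proof (Cmod_ge_0 l0) as Hl0p.
  (* [eta <= b - dl] gives [eta^2 <= b^2 - dl^2], so the horizontal edges decay at least as fast as
     the outer part of the near side. *)
  set (eta := Rmin (Rmin (d0 / 2) (e / (8 * (Cmod l0 + 1)))) (Rmin (b - dl) b)).
  assert (Heta : 0 < eta).
  { repeat apply Rmin_pos; try lra. apply Rdiv_lt_0_compat; lra. }
  assert (Heta1 : eta <= d0 / 2) by (unfold eta; eapply Rle_trans; [apply Rmin_l|apply Rmin_l]).
  assert (Heta2 : eta <= e / (8 * (Cmod l0 + 1)))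
    by (unfold eta; eapply Rle_trans; [apply Rmin_l|apply Rmin_r]).
  assert (Heta3 : eta <= b - dl) by (unfold eta; eapply Rle_trans; [apply Rmin_r|apply Rmin_l]).
  assert (Heta4 : eta <= b) by (unfold eta; eapply Rle_trans; [apply Rmin_r|apply Rmin_r]).
  clearbody eta.
  assert (Hnear : forall y, - eta <= y <= eta ->
     Cmod (Cminus (D N1 (0, y)) (D N1 (0, 0))) <= e / 8).
  { intros y Hy. assert (Ey : Cmod (0, y) <= eta).
    { eapply Rle_trans; [apply Cmod_le_sum|]. simpl. rewrite Rabs_R0.
      assert (Rabs y <= eta) by (apply Rabs_le; lra). lra. }
    specialize (Hlip (0, y) ltac:(lra)).
    replace (Cplus (0, 0) (0, y)) with ((0, y) : C) in Hlip
      by (unfold Cplus; simpl; f_equal; ring).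
    eapply Rle_trans; [apply Hlip|].
    apply Rle_trans with ((Cmod l0 + 1) * (e / (8 * (Cmod l0 + 1)))); [|right; field; lra].
    apply Rmult_le_compat_l; lra. }
  set (a := e / 4 * eta). assert (Ha : 0 < a) by (apply Rmult_lt_0_compat; lra).
  set (Z := (2 * b + 2 * dl) * M).
  assert (HMpos : 0 < M) by (unfold M; lra).
  assert (HZ : 0 < Z) by (apply Rmult_lt_0_compat; lra).
  set (k := 3 / 4 * eta ^ 2).
  assert (Hk : 0 < k) by (apply Rmult_lt_0_compat; [lra|apply pow_lt; auto]).
  (* Then [a lam k = Z + 1], and [exp (lam k) > lam k] makes [t] exceed all terms carrying [M]. *)
  set (lam := (Z + 1) / (a * k)).
  assert (Hak : 0 < a * k) by now apply Rmult_lt_0_compat.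
  assert (Hlam : 0 < lam) by (apply Rdiv_lt_0_compat; lra).
  assert (Hkey : Z * exp (- lam * eta ^ 2) < a * exp (- lam * eta ^ 2 / 4)).
  { assert (E : exp (- lam * eta ^ 2 / 4) = exp (lam * k) * exp (- lam * eta ^ 2)).
    { rewrite <- exp_plus. f_equal. unfold k. field. }
    rewrite E, <- Rmult_assoc. apply Rmult_lt_compat_r; [apply exp_pos|].
    pose proof (exp_ineq1 (lam * k) ltac:(apply Rgt_not_eq, Rmult_lt_0_compat; auto)) as Hexp.
    apply Rlt_trans with (a * (lam * k)).
    - replace (a * (lam * k)) with (Z + 1) by (unfold lam; field; lra). lra.
    - apply Rmult_lt_compat_l; lra. }
  set (t := a * exp (- lam * eta ^ 2 / 4)).
  assert (Ht : 0 < t) by (apply Rmult_lt_0_compat; auto; apply exp_pos).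
  set (q := 2 * b * exp (lam * dl ^ 2)).
  assert (Hq : 0 < q) by (apply Rmult_lt_0_compat; [lra|apply exp_pos]).
  (* This tolerance on the far side is chosen after [lam] so that its contribution is exactly [t];
     the peak bound then reads [2 t < t + t]. *)
  set (e' := t / q). assert (He' : 0 < e') by now apply Rdiv_lt_0_compat.
  destruct (HC (e' / 2)) as [N2 HN2]; [lra|].
  exists (Nat.max N1 N2). intros n Hn.
  destruct (Rle_dec (Cmod (D n (RtoC 0))) e) as [|Hgt]; auto. exfalso.
  apply Rnot_le_lt in Hgt.
  set (w := D n (0, 0)). change (D n (RtoC 0)) with w in Hgt.
  (* The unimodular factor [c] turns [w] onto the positive real axis, so near 0 the real part of [c]
     times [D n] stays above [e - 3 e / 8]. *)
  set (c := Cdiv (Cconj w) (RtoC (Cmod w))).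
  assert (Hw : RtoC (Cmod w) <> RtoC 0).
  { intros E. apply RtoC_inj in E. lra. }
  assert (Hc : Cmod c = 1).
  { unfold c. rewrite Cmod_div, Cmod_conj, Cmod_R, Rabs_pos_eq; auto using Cmod_ge_0. field.
    lra. }
  assert (Hcw : Cmult c w = RtoC (Cmod w)).
  { unfold c. replace (Cmult (Cdiv (Cconj w) (RtoC (Cmod w))) w) with
      (Cdiv (Cmult w (Cconj w)) (RtoC (Cmod w))) by (field; auto).
    rewrite <- Cmod2_conj. rewrite RtoC_pow. field. auto. }
  assert (Hclose : forall x y, 0 <= x <= dl -> - b <= y <= b ->
     Cmod (Cminus (D n (x, y)) (D N1 (x, y))) <= e / 8).
  { intros. apply HN1; simpl; auto; lia. }
  assert (HgM : forall x y, 0 <= x <= dl -> - b <= y <= b -> Cmod (D N1 (x, y)) <= M - e / 8 ->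
     Cmod (Cmult c (D n (x, y))) <= M).
  { intros x y Hx Hy HH. rewrite Cmod_mult, Hc, Rmult_1_l.
    pose proof (Cmod_le_sub (D n (x, y)) (D N1 (x, y))). pose proof (Hclose x y Hx Hy). lra. }
  pose proof (gaussian_peak_bound (fun z => Cmult c (D n z)) dl b lam eta e e' M) as G.
  assert (HG : e / 2 * eta * exp (- lam * eta ^ 2 / 4) <=
    2 * b * M * exp (- lam * eta ^ 2) + 2 * dl * M * exp (lam * (dl ^ 2 - b ^ 2))
    + 2 * b * e' * exp (lam * dl ^ 2)).
  { apply G; try lra.
    - intros x y Hx Hy. apply cdiff_mult; [apply cdiff_const|auto].
    - intros x Hx. split; apply HgM; try lra.
      + pose proof (HB1 x Hx). unfold M; lra.
      + pose proof (HB2 x Hx). unfold M; lra.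
    - intros y Hy. apply HgM; try lra. pose proof (HB3 y Hy). unfold M; lra.
    - intros y Hy. rewrite Cmod_mult, Hc, Rmult_1_l.
      (* On the far side convergence to 0 is only pointwise. Comparison with a later index, which
         may depend on [y], makes the bound at [n] uniform in [y]. *)
      destruct (Hedge y Hy (e' / 2)) as [N3 HN3]; [lra|].
      pose proof (HN3 (Nat.max N2 N3) ltac:(lia)) as K1.
      pose proof (HN2 n (Nat.max N2 N3) ltac:(lia) ltac:(lia) (dl, y) ltac:(simpl; lra)) as K2.
      pose proof (Cmod_le_sub (D n (dl, y)) (D (Nat.max N2 N3) (dl, y))). lra.
    - intros y Hy.
      assert (K : Cmod (Cminus (D n (0, y)) w) <= 3 * (e / 8)).
      { eapply Rle_trans; [apply (Cmod_sub_triangle _ (D N1 (0, y)))|].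
        eapply Rle_trans; [apply Rplus_le_compat_l, (Cmod_sub_triangle _ (D N1 (0, 0)))|].
        pose proof (Hclose 0 y ltac:(lra) ltac:(lra)). pose proof (Hnear y Hy).
        pose proof (Hclose 0 0 ltac:(lra) ltac:(lra)) as K3. rewrite Cmod_sub_sym in K3.
        unfold w. lra. }
      assert (K' : Rabs (fst (Cminus (Cmult c (D n (0, y))) (RtoC (Cmod w)))) <= 3 * (e / 8)).
      { eapply Rle_trans; [apply Rabs_fst_le|].
        rewrite <- Hcw. replace (Cminus _ _) with (Cmult c (Cminus (D n (0, y)) w)) by ring.
        rewrite Cmod_mult, Hc. lra. }
      change (fst (Cminus (Cmult c (D n (0, y))) (RtoC (Cmod w)))) with
        (fst (Cmult c (D n (0, y))) + - Cmod w) in K'.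
      apply Rabs_le_between in K'. lra. }
  assert (HE : exp (lam * (dl ^ 2 - b ^ 2)) <= exp (- lam * eta ^ 2)).
  { apply exp_le_mono. assert (eta ^ 2 <= b ^ 2 - dl ^ 2) by nra. nra. }
  assert (HT : e / 2 * eta * exp (- lam * eta ^ 2 / 4) = 2 * t) by (unfold t, a; field).
  assert (Hlast : 2 * b * e' * exp (lam * dl ^ 2) = t).
  { transitivity (e' * q); [unfold q; ring|unfold e'; field; lra]. }
  assert (Hmid : 2 * dl * M * exp (lam * (dl ^ 2 - b ^ 2)) <= 2 * dl * M * exp (- lam * eta ^ 2)).
  { apply Rmult_le_compat_l; auto. apply Rmult_le_pos; lra. }
  fold t in Hkey. unfold Z in Hkey. lra.
Qed.

(** The affine map [z0 + w z] places the model rectangle anywhere and in any direction, with [z0]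
    the midpoint of its near side. It has to stay in some [Re s >= sigma > 0], where the sequence is
    uniformly Cauchy. *)
Lemma continuation_step_at (D : nat -> C -> C) (z0 w : C) (dl b sigma : R) :
  (forall n z, 0 < fst z -> z <> RtoC 1 -> cdiff (D n) z) ->
  (forall s S, 0 < s -> unif_cauchy D (fun z => s <= fst z /\ Cmod z <= S)) ->
  0 < dl -> dl < b -> 0 < sigma ->
  (forall x y, 0 <= x <= dl -> - b <= y <= b ->
     sigma <= fst (Cplus z0 (Cmult w (x, y))) /\ Cplus z0 (Cmult w (x, y)) <> RtoC 1) ->
  (forall y, - b <= y <= b -> tends0 (fun n => D n (Cplus z0 (Cmult w (dl, y))))) ->
  tends0 (fun n => D n z0).
Proof.
  intros Hdiff HC Hdl Hdb Hs Hin Hedge.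
  assert (H : tends0 (fun n => D n (Cplus z0 (Cmult w (RtoC 0))))).
  { apply (continuation_step (fun n z => D n (Cplus z0 (Cmult w z))) dl b); auto.
    - intros n x y Hx Hy. destruct (Hin x y Hx Hy) as [H1 H2].
      apply (cdiff_comp (fun z => Cplus z0 (Cmult w z)) (D n)); [apply cdiff_affine|].
      apply Hdiff; auto. lra.
    - intros e He.
      destruct (HC sigma (Cmod z0 + Cmod w * (dl + b)) Hs e He) as [N HN].
      exists N. intros n m Hn Hm [x y] [Hx Hy]. simpl in Hx, Hy. apply HN; auto. split.
      + now apply Hin.
      + eapply Rle_trans; [apply Cmod_triangle|]. apply Rplus_le_compat_l.
        rewrite Cmod_mult. apply Rmult_le_compat_l; [apply Cmod_ge_0|].
        eapply Rle_trans; [apply Cmod_le_sum|]. simpl.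
        apply Rplus_le_compat; apply Rabs_le; lra. }
  replace (Cplus z0 (Cmult w (RtoC 0))) with z0 in H by ring. exact H.
Qed.

(* From Re s > 1 the continuation first moves left above the point 1, then diagonally down
   towards the real axis, and finally down onto 1/2. *)
Lemma continuation_around_one (D : nat -> C -> C) :
  (forall n z, 0 < fst z -> z <> RtoC 1 -> cdiff (D n) z) ->
  (forall s S, 0 < s -> unif_cauchy D (fun z => s <= fst z /\ Cmod z <= S)) ->
  (forall z, 1 < fst z -> tends0 (fun n => D n z)) ->
  tends0 (fun n => D n (RtoC (1 / 2))).
Proof.
  intros Hdiff HC H1.
  (* The half-length must exceed the depth, so moving from [x0] past 1 needs more than [1 - x0] of
     free height below [y0]. The hypothesis [x0 + y0 > 1] provides it: the lower edge stays at
     height [(x0 + y0 - 1) / 3]. *)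
  assert (HA : forall x0 y0, 1 / 10 < x0 -> 0 < y0 -> 1 < x0 + y0 ->
    tends0 (fun n => D n (x0, y0))).
  { intros x0 y0 Hx Hy Hxy. destruct (Rlt_dec 1 x0) as [|Hx1]; [now apply H1|].
    apply (continuation_step_at D (x0, y0) (RtoC 1) (1 - x0 + (x0 + y0 - 1) / 3)
             (1 - x0 + (x0 + y0 - 1) * 2 / 3) (1 / 10)); auto; try lra.
    - intros x y Hx' Hy'. split.
      + simpl. lra.
      + intros E. apply (f_equal snd) in E. simpl in E. lra.
    - intros y Hy'. apply H1. simpl. lra. }
  (* Along [1 + i] the sum of the coordinates rises by [2 h + m / 2], just past 1. The excursion to
     the left is at most [h + m / 2], and [x0 - 1 / 10 - h = 3 x0 / 2 + y0 / 2 - 6 / 10] is positive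
     because [x0 > 2 / 5]. *)
  assert (HB : forall x0 y0, 2 / 5 < x0 -> 0 < y0 -> tends0 (fun n => D n (x0, y0))).
  { intros x0 y0 Hx Hy. destruct (Rlt_dec 1 (x0 + y0)) as [|Hxy]; [apply HA; lra|].
    set (h := (1 - x0 - y0) / 2). set (m := Rmin (x0 - 1 / 10 - h) y0).
    assert (Hm : 0 < m) by (apply Rmin_pos; unfold h; lra).
    assert (Hm1 : m <= x0 - 1 / 10 - h) by apply Rmin_l.
    assert (Hm2 : m <= y0) by apply Rmin_r.
    assert (Hh : 0 <= h) by (unfold h; lra).
    assert (Eh : 2 * h = 1 - x0 - y0) by (unfold h; lra). clearbody m h.
    apply (continuation_step_at D (x0, y0) (1, 1) (h + m / 4) (h + m / 2) (1 / 10)); auto; try lra.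
    - intros x y Hx' Hy'. split.
      + simpl. lra.
      + intros E. pose proof (f_equal fst E) as E1. pose proof (f_equal snd E) as E2.
        simpl in E1, E2. lra.
    - intros y Hy'.
      replace (Cplus (x0, y0) (Cmult (1, 1) (h + m / 4, y))) with
        ((x0 + (h + m / 4 - y), y0 + (h + m / 4 + y)) : C)
        by (unfold Cplus, Cmult; simpl; f_equal; ring).
      apply HA; lra. }
  (* With direction [i] the near side is the real segment of half-length 6/100 around 1/2, away from
     1, and the far side lies at height 1/20, where [HB] applies. *)
  apply (continuation_step_at D (RtoC (1 / 2)) Ci (1 / 20) (6 / 100) (1 / 10)); auto; try lra.
  - intros x y Hx Hy. split.
    + simpl. lra.
    + intros E. apply (f_equal fst) in E. simpl in E. lra.
  - intros y Hy.
    replace (Cplus (RtoC (1 / 2)) (Cmult Ci (1 / 20, y))) with ((1 / 2 - y, 1 / 20) : C)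
      by (unfold Cplus, Cmult, Ci, RtoC; simpl; f_equal; ring).
    apply HB; lra.
Qed.

(** * Regularised partial sums *)

Lemma Csum1_ext f g N : (forall n, (1 <= n <= N)%nat -> f n = g n) -> Csum1 f N = Csum1 g N.
Proof.
  induction N; intros H; simpl; auto. rewrite IHN by (intros; apply H; lia).
  now rewrite (H (S N)) by lia.
Qed.

Lemma Csum1_plus f g N : Csum1 (fun n => Cplus (f n) (g n)) N = Cplus (Csum1 f N) (Csum1 g N).
Proof. induction N; simpl; [|rewrite IHN]; ring. Qed.

Lemma Csum1_scal a f N : Csum1 (fun n => Cmult a (f n)) N = Cmult a (Csum1 f N).
Proof. induction N; simpl; [|rewrite IHN]; ring. Qed.

Lemma Csum1_const a N : Csum1 (fun _ => a) N = Cmult (RtoC (INR N)) a.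
Proof.
  induction N; [simpl; ring|]. simpl Csum1. rewrite IHN, S_INR, RtoC_plus. ring.
Qed.

Lemma Csum1_add f N M :
  Csum1 f (N + M) = Cplus (Csum1 f N) (Csum1 (fun n => f (N + n)%nat) M).
Proof.
  induction M; [rewrite Nat.add_0_r; simpl; ring|].
  rewrite Nat.add_succ_r. simpl. rewrite IHM. rewrite Nat.add_succ_r. ring.
Qed.

Lemma Csum1_single f N b : (1 <= b <= N)%nat ->
  (forall n, (1 <= n <= N)%nat -> n <> b -> f n = RtoC 0) -> Csum1 f N = f b.
Proof.
  induction N; intros Hb H; [lia|]. simpl.
  destruct (Nat.eq_dec b (S N)) as [->|Hne].
  - rewrite (Csum1_ext f (fun _ => RtoC 0)) by (intros; apply H; lia).
    rewrite Csum1_const. ring.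
  - rewrite IHN by (intros; try apply H; lia). rewrite (H (S N)) by lia. ring.
Qed.

Fixpoint Rsum1 (f : nat -> R) (n : nat) : R :=
  match n with O => 0 | S n' => Rsum1 f n' + f n end.

Lemma Rsum1_le f g N : (forall n, (1 <= n <= N)%nat -> f n <= g n) -> Rsum1 f N <= Rsum1 g N.
Proof.
  induction N; intros H; simpl; [lra|].
  pose proof (H (S N) ltac:(lia)). assert (Rsum1 f N <= Rsum1 g N) by (apply IHN; intros; apply H; lia).
  lra.
Qed.

Lemma Rsum1_scal a f N : Rsum1 (fun n => a * f n) N = a * Rsum1 f N.
Proof. induction N; simpl; [|rewrite IHN]; ring. Qed.

Lemma Rsum1_const a N : Rsum1 (fun _ => a) N = INR N * a.
Proof. induction N; [simpl; ring|]. simpl Rsum1. rewrite IHN, S_INR. ring. Qed.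

Lemma Cmod_Csum1_le f g N : (forall n, (1 <= n <= N)%nat -> Cmod (f n) <= g n) ->
  Cmod (Csum1 f N) <= Rsum1 g N.
Proof.
  induction N; intros H; simpl; [rewrite Cmod_0; lra|].
  eapply Rle_trans; [apply Cmod_triangle|].
  apply Rplus_le_compat; [apply IHN; intros|]; apply H; lia.
Qed.

Lemma cdiff_Csum1 (f : nat -> C -> C) z N : (forall n, cdiff (f n) z) ->
  cdiff (fun s => Csum1 (fun n => f n s) N) z.
Proof.
  intros H. induction N; simpl; [apply cdiff_const|].
  apply (cdiff_plus (fun s => Csum1 (fun n => f n s) N) (f (S N))); auto.
Qed.

(* t^s for t > 0; junk for t <= 0, where ln is not the logarithm. *)
Definition pw (t : R) (s : C) : C := cexp (Cmult s (RtoC (ln t))).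

Lemma Cmod_pw t s : Cmod (pw t s) = Rpower t (fst s).
Proof. unfold pw. rewrite Cmod_cexp. unfold Rpower. f_equal. simpl. ring. Qed.

Lemma pw_real t r : pw t (RtoC r) = RtoC (Rpower t r).
Proof.
  unfold pw, cexp, Rpower, RtoC, Cmult; simpl.
  replace (r * 0 + 0 * ln t) with 0 by ring. rewrite cos_0, sin_0.
  replace (r * ln t - 0 * 0) with (r * ln t) by ring. f_equal; ring.
Qed.

Lemma cpow_pw n s : cpow n s = pw (INR n) s.
Proof.
  unfold cpow, pw, cexp, Re, Im. simpl.
  replace (fst s * ln (INR n) - snd s * 0) with (fst s * ln (INR n)) by ring.
  replace (fst s * 0 + snd s * ln (INR n)) with (snd s * ln (INR n)) by ring. reflexivity.
Qed.

Lemma pw_quot a b s : 0 < a -> 0 < b -> Cmult (pw b s) (pw a (Copp s)) = pw (a / b) (Copp s).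
Proof.
  intros Ha Hb. unfold pw. rewrite <- cexp_plus. f_equal.
  rewrite ln_div by auto. rewrite RtoC_minus. ring.
Qed.

Lemma pw_minus_1 t s : 0 < t -> pw t (Cminus s (RtoC 1)) = Cmult (RtoC (/ t)) (pw t s).
Proof.
  intros Ht. unfold pw.
  replace (Cmult (Cminus s (RtoC 1)) (RtoC (ln t))) with
    (Cplus (RtoC (- ln t)) (Cmult s (RtoC (ln t)))) by (rewrite RtoC_opp; ring).
  rewrite cexp_plus. f_equal. unfold cexp, RtoC; simpl.
  rewrite cos_0, sin_0, exp_Ropp, exp_ln by auto. f_equal; ring.
Qed.

Lemma cdiff_pw (t : R) (a b z : C) : cdiff (fun s => pw t (Cplus a (Cmult b s))) z.
Proof.
  unfold pw.
  apply (cdiff_comp (fun s => Cmult (Cplus a (Cmult b s)) (RtoC (ln t))) cexp); [|apply cdiff_cexp].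
  apply cdiff_mult; [apply cdiff_affine|apply cdiff_const].
Qed.

Lemma is_derive_fst_pw s t : 0 < t ->
  is_derive (fun t => fst (pw t s)) t (fst (Cmult s (pw t (Cminus s (RtoC 1))))).
Proof.
  intros Ht. rewrite pw_minus_1 by auto.
  destruct s as [a b]. unfold pw, cexp, Cmult, RtoC; simpl.
  auto_derive; [lra|].
  replace (b * 0) with 0 by ring. replace (a * 0) with 0 by ring.
  replace (a * ln t + - 0) with (a * ln t - 0) by ring. field. lra.
Qed.

Lemma is_derive_snd_pw s t : 0 < t ->
  is_derive (fun t => snd (pw t s)) t (snd (Cmult s (pw t (Cminus s (RtoC 1))))).
Proof.
  intros Ht. rewrite pw_minus_1 by auto.
  destruct s as [a b]. unfold pw, cexp, Cmult, RtoC; simpl.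
  auto_derive; [lra|].
  replace (b * 0) with 0 by ring. replace (a * 0) with 0 by ring.
  replace (a * ln t + - 0) with (a * ln t - 0) by ring. field. lra.
Qed.

(** The mean value theorem used twice: the slope is [g' c1] for an intermediate [c1], and
    [g' t - g' c1] is at most [K L]. *)
Lemma slope_near_derivative (g g' g'' : R -> R) (u L t K : R) : 0 < L -> u <= t <= u + L ->
  (forall y, u <= y <= u + L -> is_derive g y (g' y)) ->
  (forall y, u <= y <= u + L -> is_derive g' y (g'' y)) ->
  (forall y, u <= y <= u + L -> Rabs (g'' y) <= K) ->
  Rabs (g' t - (g (u + L) - g u) / L) <= K * L.
Proof.
  intros HL Ht Hg Hg' HK.
  assert (Hc : forall (h : R -> R) h', (forall y, u <= y <= u + L -> is_derive h y (h' y)) ->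
    forall a b, u <= a <= u + L -> u <= b <= u + L ->
    exists c, Rmin a b <= c <= Rmax a b /\ h b - h a = h' c * (b - a)).
  { intros h h' Hh a b Ha Hb. apply MVT_gen.
    - intros y Hy. apply Hh. pose proof (Rmin_glb a b u ltac:(lra) ltac:(lra)). pose proof (Rmax_lub a b (u + L) ltac:(lra) ltac:(lra)). lra.
    - intros y Hy. apply derivable_continuous_pt. exists (h' y). apply is_derive_Reals, Hh.
      pose proof (Rmin_glb a b u ltac:(lra) ltac:(lra)). pose proof (Rmax_lub a b (u + L) ltac:(lra) ltac:(lra)). lra. }
  destruct (Hc g g' Hg u (u + L)) as (c1 & Hc1 & E1); [lra|lra|].
  rewrite Rmin_left, Rmax_right in Hc1 by lra.
  destruct (Hc g' g'' Hg' c1 t) as (c2 & Hc2 & E2); [lra|lra|].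
  replace ((g (u + L) - g u) / L) with (g' c1) by (rewrite E1; field; lra).
  rewrite E2, Rabs_mult. apply Rmult_le_compat; try apply Rabs_pos.
  - apply HK. pose proof (Rmin_glb c1 t u ltac:(lra) ltac:(lra)). pose proof (Rmax_lub c1 t (u + L) ltac:(lra) ltac:(lra)). lra.
  - apply Rabs_le. lra.
Qed.

Lemma Rpower_le_anti a b r : 0 < a -> a <= b -> r <= 0 -> Rpower b r <= Rpower a r.
Proof.
  intros Ha Hab Hr. unfold Rpower. apply exp_le_mono.
  assert (ln a <= ln b) by (destruct Hab as [|<-]; [left; apply ln_increasing; lra|lra]).
  nra.
Qed.

(** As [(1 - s) t^(-s)] is the derivative of [t^(1-s)], it is compared here with its average over an
    interval. The mean value theorem is real, so the coordinates are treated separately, whence the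
    factor 2; [-1 <= Re s] puts the largest second derivative at [u]. *)
Lemma pw_slope (s : C) (u L t : R) : 0 < u -> 0 < L -> u <= t <= u + L -> -1 <= fst s ->
  Cmod (Cminus (Cmult (Cminus (RtoC 1) s) (pw t (Copp s)))
          (Cdiv (Cminus (pw (u + L) (Cminus (RtoC 1) s)) (pw u (Cminus (RtoC 1) s))) (RtoC L)))
  <= 2 * (Cmod (Cminus (RtoC 1) s) * Cmod s * Rpower u (- fst s - 1)) * L.
Proof.
  intros Hu HL Ht Hs.
  set (K := Cmod (Cminus (RtoC 1) s) * Cmod s * Rpower u (- fst s - 1)).
  set (r := Cminus (RtoC 1) s).
  assert (Er : Cminus r (RtoC 1) = Copp s) by (unfold r; ring).
  assert (HK : forall y, u <= y <= u + L ->
    Cmod (Cmult r (Cmult (Copp s) (pw y (Cminus (Copp s) (RtoC 1))))) <= K).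
  { intros y Hy. rewrite !Cmod_mult, Cmod_opp, Cmod_pw, <- Rmult_assoc.
    apply Rmult_le_compat_l; [apply Rmult_le_pos; apply Cmod_ge_0|].
    replace (fst (Cminus (Copp s) (RtoC 1))) with (- fst s - 1) by (simpl; ring).
    apply Rpower_le_anti; lra. }
  assert (D1 : forall y, u <= y <= u + L -> is_derive (fun t => fst (Cmult r (pw t (Copp s)))) y
     (fst (Cmult r (Cmult (Copp s) (pw y (Cminus (Copp s) (RtoC 1))))))).
  { intros y Hy. pose proof (is_derive_fst_pw (Copp s) y ltac:(lra)) as A1.
    pose proof (is_derive_snd_pw (Copp s) y ltac:(lra)) as A2.
    unfold Cmult at 1. simpl fst at 1.
    apply (is_derive_minus (fun t => fst r * fst (pw t (Copp s))) (fun t => snd r * snd (pw t (Copp s))));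
    apply is_derive_scal; auto. }
  assert (D2 : forall y, u <= y <= u + L -> is_derive (fun t => snd (Cmult r (pw t (Copp s)))) y
     (snd (Cmult r (Cmult (Copp s) (pw y (Cminus (Copp s) (RtoC 1))))))).
  { intros y Hy. pose proof (is_derive_fst_pw (Copp s) y ltac:(lra)) as A1.
    pose proof (is_derive_snd_pw (Copp s) y ltac:(lra)) as A2.
    unfold Cmult at 1. simpl snd at 1.
    apply (is_derive_plus (fun t => fst r * snd (pw t (Copp s))) (fun t => snd r * fst (pw t (Copp s))));
    apply is_derive_scal; auto. }
  assert (P1 := slope_near_derivative (fun t => fst (pw t r)) (fun t => fst (Cmult r (pw t (Copp s))))
     _ u L t K HL Ht ltac:(intros y Hy; rewrite <- Er; apply is_derive_fst_pw; lra) D1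
     ltac:(intros y Hy; eapply Rle_trans; [apply Rabs_fst_le|apply HK; auto])).
  assert (P2 := slope_near_derivative (fun t => snd (pw t r)) (fun t => snd (Cmult r (pw t (Copp s))))
     _ u L t K HL Ht ltac:(intros y Hy; rewrite <- Er; apply is_derive_snd_pw; lra) D2
     ltac:(intros y Hy; eapply Rle_trans; [apply Rabs_snd_le|apply HK; auto])).
  cbv beta in P1, P2.
  eapply Rle_trans; [apply Cmod_le_sum|].
  assert (EL : forall z : C, Cdiv z (RtoC L) = (fst z / L, snd z / L)).
  { intros z. unfold Cdiv. rewrite <- RtoC_inv by lra.
    unfold Cmult, RtoC; simpl. f_equal; unfold Rdiv; ring. }
  rewrite EL.
  replace (2 * K * L) with (K * L + K * L) by ring.
  apply Rplus_le_compat.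
  - exact P1.
  - exact P2.
Qed.

(* The factor 1 - s removes the pole at 1 of the regularised partial sum over k periods. *)
Definition reg_sum (f : nat -> C) (c : C) (x : R) (q : nat) (k : nat) (s : C) : C :=
  Cminus
    (Cmult (Cminus (RtoC 1) s)
       (Cplus (Cmult (f O) (pw x (Copp s)))
              (Csum1 (fun n => Cmult (f n) (pw (INR n + x) (Copp s))) (k * q))))
    (Cmult c (pw (INR (k * q) + x) (Cminus (RtoC 1) s))).

Definition mean (f : nat -> C) (q : nat) : C := Cdiv (Csum1 f q) (RtoC (INR q)).

Lemma cdiff_reg_sum f c x q k z : cdiff (reg_sum f c x q k) z.
Proof.
  unfold reg_sum.
  apply (cdiff_ext (fun s => Cplus
    (Cmult (Cplus (RtoC 1) (Cmult (Copp (RtoC 1)) s))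
       (Cplus (Cmult (f O) (pw x (Cplus (RtoC 0) (Cmult (Copp (RtoC 1)) s))))
              (Csum1 (fun n => Cmult (f n) (pw (INR n + x) (Cplus (RtoC 0) (Cmult (Copp (RtoC 1)) s)))) (k * q))))
    (Cmult (Copp c) (pw (INR (k * q) + x) (Cplus (RtoC 1) (Cmult (Copp (RtoC 1)) s)))))).
  - intros s.
    replace (Cplus (RtoC 0) (Cmult (Copp (RtoC 1)) s)) with (Copp s) by (ring).
    replace (Cplus (RtoC 1) (Cmult (Copp (RtoC 1)) s)) with (Cminus (RtoC 1) s)
      by (ring).
    ring.
  - apply cdiff_plus; apply cdiff_mult; try apply cdiff_const; try apply cdiff_affine;
      try apply cdiff_pw.
    apply cdiff_plus; [apply cdiff_mult; [apply cdiff_const|apply cdiff_pw]|].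
    apply (cdiff_Csum1 (fun n s => Cmult (f n) (pw (INR n + x) (Cplus (RtoC 0) (Cmult (Copp (RtoC 1)) s))))).
    intros n. apply cdiff_mult; [apply cdiff_const|apply cdiff_pw].
Qed.

Lemma periodic_mul {A : Type} (f : nat -> A) q k n : (forall n, f (n + q)%nat = f n) -> f (k * q + n)%nat = f n.
Proof.
  intros Hp. induction k; [reflexivity|].
  replace (S k * q + n)%nat with (k * q + n + q)%nat by lia. now rewrite Hp.
Qed.

(** If [(1 - s) t^(-s)] is replaced by its average over the period, the sum against [f] is exactly
    the increment of the correction term, so only deviations from the average remain. They gain a
    factor [1 / k], which makes the increments summable as soon as [Re s > 0]. *)
Lemma reg_sum_increment f x q k s : (0 < q)%nat -> 0 < x -> (1 <= k)%nat -> -1 <= fst s ->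
  (forall n, f (n + q)%nat = f n) -> (forall n, Cmod (f n) <= 1) ->
  Cmod (Cminus (reg_sum f (mean f q) x q (S k) s) (reg_sum f (mean f q) x q k s)) <=
  2 * INR q ^ 2 * (Cmod (Cminus (RtoC 1) s) * Cmod s) * Rpower (INR k) (- fst s - 1).
Proof.
  intros Hq Hx Hk Hs Hper Hf.
  assert (Hq0 : 0 < INR q) by (apply lt_0_INR; lia).
  assert (HqC : RtoC (INR q) <> RtoC 0) by (intros E; apply RtoC_inj in E; lra).
  assert (Hk0 : 0 < INR k) by (apply lt_0_INR; lia).
  set (u := INR (k * q) + x).
  assert (Hu : INR k <= u).
  { unfold u. rewrite mult_INR. assert (1 <= INR q) by (apply (le_INR 1); lia). nra. }
  set (r := Cminus (RtoC 1) s).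
  set (A := Cdiv (Cminus (pw (u + INR q) r) (pw u r)) (RtoC (INR q))).
  replace (Cminus (reg_sum f (mean f q) x q (S k) s) (reg_sum f (mean f q) x q k s)) with
    (Csum1 (fun j => Cmult (f j) (Cminus (Cmult r (pw (u + INR j) (Copp s))) A)) q).
  - apply Rle_trans with (Rsum1 (fun _ => 2 * (Cmod r * Cmod s * Rpower (INR k) (- fst s - 1)) * INR q) q).
    + apply Cmod_Csum1_le. intros j Hj. rewrite Cmod_mult.
      apply Rle_trans with (1 * Cmod (Cminus (Cmult r (pw (u + INR j) (Copp s))) A)).
      { apply Rmult_le_compat_r; [apply Cmod_ge_0|apply Hf]. }
      rewrite Rmult_1_l. unfold A, r.
      eapply Rle_trans; [apply pw_slope; auto; try lra|].
      * split; [pose proof (pos_INR j); lra|]. apply Rplus_le_compat_l, le_INR. lia.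
      * apply Rmult_le_compat_r; [lra|]. apply Rmult_le_compat_l; [lra|].
        apply Rmult_le_compat_l; [apply Rmult_le_pos; apply Cmod_ge_0|].
        apply Rpower_le_anti; lra.
    + rewrite Rsum1_const. right. ring.
  - assert (E : Csum1 (fun j => Cmult (f j) (Cminus (Cmult r (pw (u + INR j) (Copp s))) A)) q =
      Cminus (Cmult r (Csum1 (fun j => Cmult (f j) (pw (u + INR j) (Copp s))) q))
             (Cmult (Csum1 f q) A)).
    { rewrite <- Csum1_scal.
      replace (Cmult (Csum1 f q) A) with (Csum1 (fun j => Cmult A (f j)) q)
        by (rewrite Csum1_scal; ring).
      replace (Cminus (Csum1 (fun n => Cmult r (Cmult (f n) (pw (u + INR n) (Copp s)))) q)
         (Csum1 (fun j => Cmult A (f j)) q)) with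
        (Cplus (Csum1 (fun n => Cmult r (Cmult (f n) (pw (u + INR n) (Copp s)))) q)
         (Cmult (Copp (RtoC 1)) (Csum1 (fun j => Cmult A (f j)) q))) by (ring).
      rewrite <- Csum1_scal, <- Csum1_plus. apply Csum1_ext. intros. ring. }
    rewrite E. unfold reg_sum. replace (S k * q)%nat with (k * q + q)%nat by lia.
    rewrite Csum1_add.
    rewrite (Csum1_ext (fun n => Cmult (f (k * q + n)%nat) _)
               (fun j => Cmult (f j) (pw (u + INR j) (Copp s)))).
    2: { intros n _. rewrite periodic_mul by auto. do 2 f_equal.
         unfold u. rewrite plus_INR. ring. }
    replace (INR (k * q + q) + x) with (u + INR q) by (unfold u; rewrite plus_INR; ring).
    fold u r. unfold A, mean. field. auto.
Qed.

Lemma Rpower_neg_small (sg e : R) : 0 < sg -> 0 < e ->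
  exists N, (1 <= N)%nat /\ forall n, (N <= n)%nat -> Rpower (INR n) (- sg) <= e.
Proof.
  intros Hs He.
  destruct (INR_unbounded (Rpower e (- / sg))) as [N HN].
  exists (Nat.max 1 N). split; [lia|]. intros n Hn.
  assert (HT : 0 < Rpower e (- / sg)) by apply exp_pos.
  apply Rle_trans with (Rpower (Rpower e (- / sg)) (- sg)).
  - apply Rpower_le_anti; auto; [|lra].
    assert (INR N <= INR n) by (apply le_INR; lia). lra.
  - rewrite Rpower_mult. replace (- / sg * - sg) with 1 by (field; lra).
    rewrite Rpower_1; lra.
Qed.

(** The mean value theorem dominates a power by a telescoping difference. This replaces comparison
    with an integral, both for the Cauchy property and for the tail of the series at [m / 2]. *)
Lemma Rpower_telescope (sg : R) (k : nat) : 0 < sg -> (2 <= k)%nat ->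
  sg * Rpower (INR k) (- sg - 1) <= Rpower (INR (k - 1)) (- sg) - Rpower (INR k) (- sg).
Proof.
  intros Hs Hk. rewrite minus_INR by lia. simpl (INR 1).
  assert (H2 : 2 <= INR k) by (apply (le_INR 2); lia).
  destruct (MVT_gen (fun t => Rpower t (- sg)) (INR k - 1) (INR k)
              (fun t => - sg * Rpower t (- sg - 1))) as (c & Hc & E).
  - intros t Ht. rewrite Rmin_left in Ht by lra. apply is_derive_Reals.
    apply derivable_pt_lim_power. lra.
  - intros t Ht. rewrite Rmin_left in Ht by lra. apply derivable_continuous_pt.
    exists (- sg * Rpower t (- sg - 1)). apply derivable_pt_lim_power. lra.
  - rewrite Rmin_left, Rmax_right in Hc by lra.
    replace (Rpower (INR k - 1) (- sg) - Rpower (INR k) (- sg)) with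
      (sg * Rpower c (- sg - 1)) by lra.
    apply Rmult_le_compat_l; [lra|]. apply Rpower_le_anti; lra.
Qed.

Lemma reg_sum_cauchy f x q : (0 < q)%nat -> 0 < x ->
  (forall n, f (n + q)%nat = f n) -> (forall n, Cmod (f n) <= 1) ->
  forall sg S, 0 < sg ->
  unif_cauchy (reg_sum f (mean f q) x q) (fun z => sg <= fst z /\ Cmod z <= S).
Proof.
  intros Hq Hx Hper Hf sg S Hsg e He.
  (* [Rabs S] because [S] may be negative; [+ 1] keeps [K] positive when [S = 0]. *)
  set (K := 2 * INR q ^ 2 * ((1 + Rabs S) * Rabs S) / sg + 1).
  assert (HK0 : 0 <= 2 * INR q ^ 2 * ((1 + Rabs S) * Rabs S)).
  { pose proof (Rabs_pos S). pose proof (pow2_ge_0 (INR q)). apply Rmult_le_pos; nra. }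
  assert (HK : 0 < K) by (unfold K; assert (0 <= 2 * INR q ^ 2 * ((1 + Rabs S) * Rabs S) / sg)
    by (apply Rdiv_le_0_compat; lra); lra).
  assert (Hinc : forall m d z, (2 <= m)%nat -> sg <= fst z /\ Cmod z <= S ->
    Cmod (Cminus (reg_sum f (mean f q) x q (m + d) z) (reg_sum f (mean f q) x q m z)) <=
    K * (Rpower (INR (m - 1)) (- sg) - Rpower (INR (m + d - 1)) (- sg))).
  { intros m d z Hm [Hz1 Hz2]. induction d.
    - rewrite Nat.add_0_r. replace (Cminus _ _) with (RtoC 0) by ring. rewrite Cmod_0. lra.
    - rewrite Nat.add_succ_r.
      eapply Rle_trans; [apply (Cmod_sub_triangle _ (reg_sum f (mean f q) x q (m + d) z))|].
      pose proof (reg_sum_increment f x q (m + d) z Hq Hx ltac:(lia) ltac:(lra) Hper Hf) as H1.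
      pose proof (Rpower_telescope sg (m + d) Hsg ltac:(lia)) as H2.
      assert (H3 : Rpower (INR (m + d)) (- fst z - 1) <= Rpower (INR (m + d)) (- sg - 1)).
      { apply Rle_Rpower; [apply (le_INR 1); lia|lra]. }
      assert (H4 : Cmod (Cminus (RtoC 1) z) * Cmod z <= (1 + Rabs S) * Rabs S).
      { assert (Cmod z <= Rabs S) by (eapply Rle_trans; [apply Hz2|apply Rle_abs]).
        apply Rmult_le_compat; auto using Cmod_ge_0. unfold Cminus.
        eapply Rle_trans; [apply Cmod_triangle|]. rewrite Cmod_1, Cmod_opp. lra. }
      assert (P0 : 0 < Rpower (INR (m + d)) (- sg - 1)) by apply exp_pos.
      assert (P1 : 0 < Rpower (INR (m + d)) (- fst z - 1)) by apply exp_pos.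
      pose proof (pow2_ge_0 (INR q)) as Hq2.
      assert (H5 : Cmod (Cminus (reg_sum f (mean f q) x q (Datatypes.S (m + d)) z)
                    (reg_sum f (mean f q) x q (m + d) z)) <=
              (K * sg) * Rpower (INR (m + d)) (- sg - 1)).
      { eapply Rle_trans; [apply H1|].
        apply Rmult_le_compat; [|lra| |lra].
        - apply Rmult_le_pos; [nra|]. apply Rmult_le_pos; apply Cmod_ge_0.
        - apply Rle_trans with (2 * INR q ^ 2 * ((1 + Rabs S) * Rabs S)).
          + apply Rmult_le_compat_l; [nra|auto].
          + replace (K * sg) with (2 * INR q ^ 2 * ((1 + Rabs S) * Rabs S) + sg)
              by (unfold K; field; lra). lra. }
      replace (Datatypes.S (m + d) - 1)%nat with (m + d)%nat by lia.
      assert (H6 := Rmult_le_compat_l K _ _ ltac:(lra) H2). lra. }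
  destruct (Rpower_neg_small sg (e / (2 * K)) Hsg) as (N & HN1 & HN);
    [apply Rdiv_lt_0_compat; lra|].
  exists (N + 2)%nat.
  assert (Hb : forall n z, (N + 2 <= n)%nat -> sg <= fst z /\ Cmod z <= S ->
    Cmod (Cminus (reg_sum f (mean f q) x q n z) (reg_sum f (mean f q) x q (N + 2) z)) <= e / 2).
  { intros n z Hn Hz. replace n with (N + 2 + (n - (N + 2)))%nat by lia.
    eapply Rle_trans; [apply Hinc; auto; lia|].
    assert (0 < Rpower (INR (N + 2 + (n - (N + 2)) - 1)) (- sg)) by apply exp_pos.
    pose proof (HN (N + 2 - 1)%nat ltac:(lia)) as HN'.
    apply Rle_trans with (K * (e / (2 * K))); [apply Rmult_le_compat_l; lra|].
    right. field. lra. }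
  intros n m Hn Hm z Hz.
  eapply Rle_trans; [apply (Cmod_sub_triangle _ (reg_sum f (mean f q) x q (N + 2) z))|].
  pose proof (Hb n z Hn Hz). pose proof (Hb m z Hm Hz) as Hm'.
  rewrite Cmod_sub_sym in Hm'. lra.
Qed.

Lemma Csum1_S f n : Csum1 f (S n) = Cplus (Csum1 f n) (f (S n)).
Proof. reflexivity. Qed.

Lemma sum_n_Csum1 (a : nat -> C) n : sum_n a n = Csum1 (fun i => a (pred i)) (S n).
Proof.
  induction n.
  - rewrite sum_O. simpl. ring.
  - rewrite sum_Sn, IHn. reflexivity.
Qed.

(** Every block of [l] consecutive integers contains one integer congruent to [b], at [n l + b]
    since [1 <= b < l]; the block [n = 0] is the leading term. The [pred] arises because [sum_n]
    includes its last index and index [k] stands for the integer [k + 1]. *)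
Lemma hurL_term_partial_sum (chi : nat -> C) (b l : nat) (s : C) (K : nat) :
  (1 <= b)%nat -> (b < l)%nat ->
  sum_n (hurL_term chi b l s) (pred (S K * l)) =
  Cplus (Cmult (chi b) (pw (INR b / INR l) (Copp s)))
    (Csum1 (fun n => Cmult (chi (b + n * l)%nat) (pw (INR n + INR b / INR l) (Copp s))) K).
Proof.
  intros Hb Hl. rewrite sum_n_Csum1. replace (S (pred (S K * l))) with (S K * l)%nat by lia.
  set (g := fun i => hurL_term chi b l s (pred i)).
  assert (Hl0 : 0 < INR l) by (apply lt_0_INR; lia).
  assert (Hblock : forall n, Csum1 (fun i => g (n * l + i)%nat) l =
    Cmult (chi (b + n * l)%nat) (pw (INR n + INR b / INR l) (Copp s))).
  { intros n. rewrite (Csum1_single _ l b); [|lia|].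
    - unfold g, hurL_term. replace (pred (n * l + b) + 1)%nat with (b + n * l)%nat by lia.
      rewrite Nat.Div0.mod_add, Nat.eqb_refl, !cpow_pw.
      replace (Cmult (pw (INR l) s) (Cmult (chi (b + n * l)%nat) (pw (INR (b + n * l)) (Copp s)))) with
        (Cmult (chi (b + n * l)%nat) (Cmult (pw (INR l) s) (pw (INR (b + n * l)) (Copp s)))) by ring.
      rewrite pw_quot; auto; [|apply lt_0_INR; lia].
      do 2 f_equal. rewrite plus_INR, mult_INR. field. lra.
    - intros i Hi Hne. unfold g, hurL_term.
      replace (pred (n * l + i) + 1)%nat with (i + n * l)%nat by lia.
      rewrite Nat.Div0.mod_add. destruct (Nat.eqb_spec (i mod l) (b mod l)) as [E|]; auto.
      exfalso. rewrite (Nat.mod_small b l) in E by lia.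
      destruct (Nat.eq_dec i l) as [->|].
      + rewrite Nat.Div0.mod_same in E. lia.
      + rewrite Nat.mod_small in E by lia. lia. }
  induction K.
  - pose proof (Hblock 0%nat) as H0. simpl Nat.mul in H0.
    replace (1 * l)%nat with l by lia. simpl Csum1 at 2.
    rewrite (Csum1_ext _ (fun i => g (0 * l + i)%nat)) by (intros; reflexivity).
    rewrite Hblock. simpl. rewrite Nat.add_0_r, Rplus_0_l. ring.
  - replace (S (S K) * l)%nat with (S K * l + l)%nat by lia. rewrite Csum1_add.
    rewrite IHK, (Csum1_S _ K), <- Cplus_assoc. do 2 f_equal. apply (Hblock (S K)).
Qed.

Lemma is_series_C_partial (a : nat -> C) (L : C) : is_series (V := C_NormedModule) a L ->
  forall e, 0 < e -> exists N, forall n, (N <= n)%nat -> Cmod (Cminus (sum_n a n) L) <= e.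
Proof.
  intros H e He.
  (* Balls of [C] are products of balls of the coordinates, hence [e / 2] in each. *)
  destruct (H (ball (M := C_UniformSpace) L (mkposreal (e / 2) ltac:(lra)))) as [N HN].
  { exists (mkposreal (e / 2) ltac:(lra)). auto. }
  exists N. intros n Hn. destruct (HN n Hn) as [H1 H2].
  eapply Rle_trans; [apply Cmod_le_sum|].
  change (Rabs (fst (sum_n a n) + - fst L) < e / 2) in H1.
  change (Rabs (snd (sum_n a n) + - snd L) < e / 2) in H2.
  unfold Cminus, Cplus, Copp. cbn [fst snd]. lra.
Qed.

(** On [Re s > 1] the correction term [c (k q + x)^(1-s)] tends to 0, so the regularisation leaves
    the limit unchanged. *)
Lemma reg_sum_tends_F (chi : nat -> C) (b l q : nat) (F : C -> C) (c : C) (s : C) :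
  (1 <= b)%nat -> (b < l)%nat -> (0 < q)%nat -> 1 < fst s ->
  is_series (V := C_NormedModule) (hurL_term chi b l s) (F s) ->
  tends0 (fun k => Cminus (Cmult (Cminus (RtoC 1) s) (F s))
                     (reg_sum (fun n => chi (b + n * l)%nat) c (INR b / INR l) q k s)).
Proof.
  intros Hb Hl Hq Hs HF e He.
  assert (Hx : 0 < INR b / INR l) by (apply Rdiv_lt_0_compat; apply lt_0_INR; lia).
  set (A := Cmod (Cminus (RtoC 1) s) + 1). pose proof (Cmod_ge_0 (Cminus (RtoC 1) s)).
  set (B := Cmod c + 1). pose proof (Cmod_ge_0 c).
  destruct (is_series_C_partial _ _ HF (e / (2 * A))) as [N1 HN1];
    [apply Rdiv_lt_0_compat; unfold A; lra|].
  destruct (Rpower_neg_small (fst s - 1) (e / (2 * B))) as (N2 & _ & HN2);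
    [lra|apply Rdiv_lt_0_compat; unfold B; lra|].
  exists (S (N1 + N2)). intros k Hk. unfold reg_sum. simpl Nat.mul at 1. rewrite Nat.add_0_r.
  rewrite <- (hurL_term_partial_sum chi b l s (k * q) Hb Hl).
  set (P := sum_n _ _).
  replace (Cminus _ _) with
    (Cplus (Copp (Cmult (Cminus (RtoC 1) s) (Cminus P (F s))))
       (Cmult c (pw (INR (k * q) + INR b / INR l) (Cminus (RtoC 1) s)))) by ring.
  eapply Rle_trans; [apply Cmod_triangle|]. rewrite Cmod_opp, !Cmod_mult, Cmod_pw.
  assert (Hkq : (k <= k * q)%nat) by nia.
  assert (E1 : Cmod (Cminus P (F s)) <= e / (2 * A)) by (apply HN1; nia).
  assert (E2 : Rpower (INR (k * q) + INR b / INR l) (fst (Cminus (RtoC 1) s)) <= e / (2 * B)).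
  { replace (fst (Cminus (RtoC 1) s)) with (- (fst s - 1)) by (simpl; ring).
    eapply Rle_trans; [|apply (HN2 k); lia].
    apply Rpower_le_anti; [apply lt_0_INR; lia| |lra].
    assert (INR k <= INR (k * q)) by (apply le_INR; auto). lra. }
  assert (E3 : Cmod (Cminus (RtoC 1) s) * Cmod (Cminus P (F s)) <= e / 2).
  { apply Rle_trans with (A * (e / (2 * A))); [|right; unfold A; field; lra].
    apply Rmult_le_compat; auto using Cmod_ge_0. unfold A; lra. }
  assert (E4 : Cmod c * Rpower (INR (k * q) + INR b / INR l) (fst (Cminus (RtoC 1) s)) <= e / 2).
  { apply Rle_trans with (B * (e / (2 * B))); [|right; unfold B; field; lra].
    apply Rmult_le_compat; auto using Cmod_ge_0; [left; apply exp_pos|unfold B; lra]. }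
  lra.
Qed.

(** The null sequence carried to 1/2 is [(1 - s) F] minus the regularised sums: [F] cancels in the
    difference of two members, so the sequence is uniformly Cauchy because the sums are. *)
Lemma L_continuation_half (chi : nat -> C) (b l q : nat) (F : C -> C) :
  (1 <= b)%nat -> (b < l)%nat -> (0 < q)%nat ->
  (forall n, chi (n + q)%nat = chi n) -> (forall n, Cmod (chi n) <= 1) ->
  is_L_continuation chi b l F ->
  let f := fun n => chi (b + n * l)%nat in
  tends0 (fun k => Cminus (Cmult (RtoC (1 / 2)) (F (RtoC (1 / 2))))
                     (reg_sum f (mean f q) (INR b / INR l) q k (RtoC (1 / 2)))).
Proof.
  intros Hb Hl Hq Hper Hchi [HF1 HF2] f.
  assert (Hx : 0 < INR b / INR l) by (apply Rdiv_lt_0_compat; apply lt_0_INR; lia).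
  assert (Hfp : forall n, f (n + q)%nat = f n).
  { intros n. unfold f. replace (b + (n + q) * l)%nat with (l * q + (b + n * l))%nat by lia.
    now apply periodic_mul. }
  pose proof (continuation_around_one (fun k s =>
    Cminus (Cmult (Cminus (RtoC 1) s) (F s)) (reg_sum f (mean f q) (INR b / INR l) q k s))) as HU.
  cbv beta in HU.
  replace (Cminus (RtoC 1) (RtoC (1 / 2))) with (RtoC (1 / 2)) in HU
    by (rewrite <- RtoC_minus; f_equal; field).
  apply HU; clear HU.
  - intros k z Hz Hz1.
    apply (cdiff_ext (fun s => Cplus (Cmult (Cplus (RtoC 1) (Cmult (Copp (RtoC 1)) s)) (F s))
       (Cmult (Copp (RtoC 1)) (reg_sum f (mean f q) (INR b / INR l) q k s)))).
    + intros s. ring.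
    + apply cdiff_plus; apply cdiff_mult; try apply cdiff_affine; try apply cdiff_const;
        try apply cdiff_reg_sum.
      now apply ex_derive_cdiff, HF1.
  - intros sg S Hsg e He.
    destruct (reg_sum_cauchy f (INR b / INR l) q Hq Hx Hfp ltac:(intros; apply Hchi) sg S Hsg e He)
      as [N HN].
    exists N. intros n m Hn Hm z Hz.
    replace (Cminus (Cminus _ _) (Cminus _ _)) with
      (Cminus (reg_sum f (mean f q) (INR b / INR l) q m z) (reg_sum f (mean f q) (INR b / INR l) q n z)) by ring.
    now apply HN.
  - intros z Hz. apply reg_sum_tends_F; auto.
Qed.

(** * Inverse square-root sums and the value at 1/2 *)

Lemma Rpower_half t : 0 < t -> Rpower t (1 / 2) = sqrt t.
Proof. intros Ht. rewrite <- Rpower_sqrt by auto. f_equal. lra. Qed.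

Lemma Rpower_minus_half t : 0 < t -> Rpower t (- (1 / 2)) = / sqrt t.
Proof. intros Ht. now rewrite Rpower_Ropp, Rpower_half. Qed.

Lemma inv_sqrt_le_diff t : 0 <= t -> / sqrt (t + 1) <= 2 * sqrt (t + 1) - 2 * sqrt t.
Proof.
  intros Ht. assert (0 < sqrt (t + 1)) by (apply sqrt_lt_R0; lra).
  pose proof (sqrt_sqrt (t + 1) ltac:(lra)). pose proof (sqrt_sqrt t Ht).
  pose proof (sqrt_pos t).
  apply Rmult_le_reg_r with (sqrt (t + 1)); auto. rewrite Rinv_l by lra.
  pose proof (pow2_ge_0 (sqrt (t + 1) - sqrt t)). nra.
Qed.

Lemma inv_sqrt_ge_diff t : 0 < t -> 2 * sqrt (t + 1) - 2 * sqrt t <= / sqrt t.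
Proof.
  intros Ht. assert (0 < sqrt t) by (apply sqrt_lt_R0; lra).
  pose proof (sqrt_sqrt (t + 1) ltac:(lra)). pose proof (sqrt_sqrt t ltac:(lra)).
  pose proof (sqrt_pos (t + 1)).
  apply Rmult_le_reg_r with (sqrt t); auto. rewrite Rinv_l by lra.
  pose proof (pow2_ge_0 (sqrt (t + 1) - sqrt t)). nra.
Qed.

Lemma sum_inv_sqrt_upper x N : 0 < x ->
  Rsum1 (fun n => / sqrt (INR n + x)) N <= 2 * sqrt (INR N + x) - 2 * sqrt x.
Proof.
  intros Hx. induction N; [cbn [Rsum1 INR]; rewrite Rplus_0_l; lra|].
  cbn [Rsum1]. pose proof (inv_sqrt_le_diff (INR N + x)) as H.
  pose proof (pos_INR N). rewrite S_INR.
  replace (INR N + 1 + x) with (INR N + x + 1) by ring. specialize (H ltac:(lra)). lra.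
Qed.

Lemma sum_inv_sqrt_lower x N : 0 < x ->
  2 * sqrt (INR N + x + 1) - 2 * sqrt (x + 1) <= Rsum1 (fun n => / sqrt (INR n + x)) N.
Proof.
  intros Hx. induction N; [cbn [Rsum1 INR]; rewrite Rplus_0_l; lra|].
  cbn [Rsum1]. pose proof (pos_INR N). rewrite S_INR.
  replace (INR N + 1 + x) with (INR N + x + 1) by ring.
  pose proof (inv_sqrt_ge_diff (INR N + x + 1) ltac:(lra)). lra.
Qed.

(** The constant 3 bounds [2 sqrt (x + 1)] for [x <= 1]. *)
Lemma sum_inv_sqrt_near x N : 0 < x -> x <= 1 ->
  Rabs (Rsum1 (fun n => / sqrt (INR n + x)) N - 2 * sqrt (INR N + x)) <= 3.
Proof.
  intros Hx Hx1. pose proof (sum_inv_sqrt_upper x N Hx). pose proof (sum_inv_sqrt_lower x N Hx).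
  pose proof (sqrt_pos x).
  assert (sqrt (INR N + x) <= sqrt (INR N + x + 1)) by (apply sqrt_le_1_alt; lra).
  assert (sqrt (x + 1) <= 3 / 2).
  { rewrite <- (sqrt_pow2 (3 / 2)) by lra. apply sqrt_le_1_alt. lra. }
  apply Rabs_le. lra.
Qed.

(** Summation by parts in inductive form; the weights decrease, so their variation telescopes.
    Starting at [M] leaves the initial range to a trivial bound. *)
Lemma abel_partial (a : nat -> C) (u : nat -> R) (B : R) (M k : nat) :
  (forall N, Cmod (Csum1 a N) <= B) -> (forall n, u (S n) <= u n) ->
  Cmod (Cminus (Cminus (Csum1 (fun n => Cmult (a n) (RtoC (u n))) (M + k))
                       (Csum1 (fun n => Cmult (a n) (RtoC (u n))) M))
          (Cmult (Cminus (Csum1 a (M + k)) (Csum1 a M)) (RtoC (u (M + k)%nat))))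
  <= 2 * B * (u M - u (M + k)%nat).
Proof.
  intros HB Hu. induction k.
  - rewrite Nat.add_0_r. replace (Cminus _ _) with (RtoC 0) by ring. rewrite Cmod_0. lra.
  - rewrite Nat.add_succ_r, !Csum1_S.
    set (T := Csum1 (fun n => Cmult (a n) (RtoC (u n))) (M + k)) in *.
    set (T0 := Csum1 (fun n => Cmult (a n) (RtoC (u n))) M) in *.
    replace (Cminus _ _) with
      (Cplus (Cminus (Cminus T T0) (Cmult (Cminus (Csum1 a (M + k)) (Csum1 a M)) (RtoC (u (M + k)%nat))))
         (Cmult (Cminus (Csum1 a (M + k)) (Csum1 a M)) (RtoC (u (M + k)%nat - u (S (M + k))))))
      by (rewrite RtoC_minus; ring).
    eapply Rle_trans; [apply Cmod_triangle|].
    rewrite Cmod_mult, Cmod_R.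
    pose proof (Hu (M + k)%nat). rewrite (Rabs_pos_eq (u (M + k)%nat - _)) by lra.
    assert (HD : Cmod (Cminus (Csum1 a (M + k)) (Csum1 a M)) <= 2 * B).
    { unfold Cminus. eapply Rle_trans; [apply Cmod_triangle|]. rewrite Cmod_opp.
      pose proof (HB (M + k)%nat). pose proof (HB M). lra. }
    assert (Cmod (Cminus (Csum1 a (M + k)) (Csum1 a M)) * (u (M + k)%nat - u (S (M + k))) <=
      2 * B * (u (M + k)%nat - u (S (M + k)))) by (apply Rmult_le_compat_r; lra).
    lra.
Qed.

(* Trivial bound for n <= B, partial summation beyond. *)
Lemma weighted_sum_bound (a : nat -> C) (x B : R) (N : nat) : 0 < x -> 1 <= B ->
  (forall n, Cmod (a n) <= 2) -> (forall N, Cmod (Csum1 a N) <= B) ->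
  Cmod (Csum1 (fun n => Cmult (a n) (RtoC (/ sqrt (INR n + x)))) N) <= 8 * sqrt B.
Proof.
  intros Hx HB Ha HS.
  set (u := fun n => / sqrt (INR n + x)).
  change (Cmod (Csum1 (fun n => Cmult (a n) (RtoC (u n))) N) <= 8 * sqrt B).
  assert (Hu0 : forall n, 0 < u n).
  { intros n. apply Rinv_0_lt_compat, sqrt_lt_R0. pose proof (pos_INR n). lra. }
  assert (Hu : forall n, u (S n) <= u n).
  { intros n. unfold u. apply Rinv_le_contravar.
    - apply sqrt_lt_R0. pose proof (pos_INR n). lra.
    - apply sqrt_le_1_alt. rewrite S_INR. lra. }
  assert (HsB : 0 < sqrt B) by (apply sqrt_lt_R0; lra).
  (* The sum of [2 u n] is at most [4 sqrt (INR M + x) - 4 sqrt x <= 4 sqrt (INR M)], and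
     [sqrt 2 <= 3 / 2] gives the 6. *)
  assert (Htriv : forall M, INR M <= 2 * B ->
    Cmod (Csum1 (fun n => Cmult (a n) (RtoC (u n))) M) <= 6 * sqrt B).
  { intros M HM. eapply Rle_trans; [apply (Cmod_Csum1_le _ (fun n => 2 * u n))|].
    - intros n _. rewrite Cmod_mult, Cmod_R. rewrite (Rabs_pos_eq (u n)) by (left; apply Hu0).
      apply Rmult_le_compat_r; auto. left; apply Hu0.
    - rewrite Rsum1_scal. pose proof (sum_inv_sqrt_upper x M Hx) as HU. fold u in HU.
      assert (Hsub : sqrt (INR M + x) <= sqrt (INR M) + sqrt x).
      { pose proof (pos_INR M). pose proof (sqrt_pos (INR M)). pose proof (sqrt_pos x).
        rewrite <- (sqrt_pow2 (sqrt (INR M) + sqrt x)) by lra. apply sqrt_le_1_alt.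
        pose proof (sqrt_sqrt (INR M) ltac:(lra)). pose proof (sqrt_sqrt x ltac:(lra)). nra. }
      assert (HM2 : sqrt (INR M) <= 3 / 2 * sqrt B).
      { rewrite <- (sqrt_pow2 (3 / 2)) by lra. rewrite <- sqrt_mult_alt by lra.
        apply sqrt_le_1_alt. lra. }
      lra. }
  destruct (INR_unbounded B) as [M0 HM0].
  assert (HMex : exists M, (1 <= M)%nat /\ B <= INR M <= 2 * B).
  { clear - HB HM0. induction M0.
    - simpl in HM0. lra.
    - rewrite S_INR in HM0. destruct (Rlt_dec B (INR M0)) as [|Hn]; [auto|].
      exists (S M0). split; [lia|]. rewrite S_INR. lra. }
  destruct HMex as (M & HM1 & HMB & HM2B).
  destruct (Nat.le_ge_cases N M) as [HNM|HNM].
  - assert (INR N <= INR M) by now apply le_INR.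
    pose proof (Htriv N ltac:(lra)). lra.
  - replace N with (M + (N - M))%nat by lia. set (k := (N - M)%nat).
    pose proof (abel_partial a u B M k HS Hu) as HA.
    pose proof (Htriv M HM2B) as HT.
    set (T1 := Csum1 _ (M + k)) in *. set (T0 := Csum1 _ M) in *.
    assert (HD : Cmod (Cmult (Cminus (Csum1 a (M + k)) (Csum1 a M)) (RtoC (u (M + k)%nat)))
        <= 2 * B * u (M + k)%nat).
    { rewrite Cmod_mult, Cmod_R, (Rabs_pos_eq (u _)) by (left; apply Hu0).
      apply Rmult_le_compat_r; [left; apply Hu0|]. unfold Cminus.
      eapply Rle_trans; [apply Cmod_triangle|]. rewrite Cmod_opp.
      pose proof (HS (M + k)%nat). pose proof (HS M). lra. }
    assert (HuM : B * u M <= sqrt B).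
    { unfold u. apply Rmult_le_reg_r with (sqrt (INR M + x)).
      - apply sqrt_lt_R0. lra.
      - rewrite Rmult_assoc, Rinv_l by (apply Rgt_not_eq, sqrt_lt_R0; lra).
        assert (sqrt B <= sqrt (INR M + x)) by (apply sqrt_le_1_alt; lra).
        pose proof (sqrt_sqrt B ltac:(lra)). nra. }
    (* The boundary term [2 B u (M + k)] cancels against the variation, so the range beyond [M]
       costs [2 B u M <= 2 sqrt B] in all. *)
    pose proof (Cmod_le_sub (Cminus T1 T0)
      (Cmult (Cminus (Csum1 a (M + k)) (Csum1 a M)) (RtoC (u (M + k)%nat)))) as H1.
    pose proof (Cmod_le_sub T1 T0) as H2. lra.
Qed.

(** Split [f] into [f - c] and [c]. The first part is at most [8 sqrt B], the second differs from
    the correction term by at most 3, and the factor [1 - s = 1 / 2] brings [8 sqrt B + 3] below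
    [6 sqrt B]. *)
Lemma reg_sum_half_bound (f : nat -> C) (x B : R) (q k : nat) :
  (0 < q)%nat -> 0 < x -> x <= 1 -> 1 <= B -> (forall n, Cmod (f n) <= 1) ->
  (forall N, Cmod (Csum1 (fun n => Cminus (f n) (mean f q)) N) <= B) ->
  Cmod (Cminus (reg_sum f (mean f q) x q k (RtoC (1 / 2)))
          (Cmult (RtoC (1 / 2)) (Cmult (f O) (RtoC (/ sqrt x))))) <= 6 * sqrt B.
Proof.
  intros Hq Hx Hx1 HB Hf HS. set (c := mean f q) in *. set (N := (k * q)%nat).
  assert (Hq0 : 0 < INR q) by (apply lt_0_INR; lia).
  assert (Hc : Cmod c <= 1).
  { unfold c, mean. rewrite Cmod_div.
    - rewrite Cmod_R, Rabs_pos_eq by lra. apply Rmult_le_reg_r with (INR q); auto.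
      unfold Rdiv. rewrite Rmult_assoc, Rinv_l, Rmult_1_r by lra.
      eapply Rle_trans; [apply (Cmod_Csum1_le _ (fun _ => 1)); auto|]. rewrite Rsum1_const. lra.
    - intros E; apply RtoC_inj in E; lra. }
  assert (Hpw : forall t, 0 < t -> pw t (Copp (RtoC (1 / 2))) = RtoC (/ sqrt t)).
  { intros t Ht. rewrite <- RtoC_opp, pw_real, Rpower_minus_half; auto. }
  pose proof (weighted_sum_bound (fun n => Cminus (f n) c) x B N Hx HB) as HW. cbv beta in HW.
  specialize (HW ltac:(intros n; unfold Cminus; eapply Rle_trans; [apply Cmod_triangle|];
    rewrite Cmod_opp; specialize (Hf n); lra) HS).
  pose proof (sum_inv_sqrt_near x N Hx Hx1) as HN.
  assert (E : Csum1 (fun n => Cmult (f n) (pw (INR n + x) (Copp (RtoC (1 / 2))))) N =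
    Cplus (Csum1 (fun n => Cmult (Cminus (f n) c) (RtoC (/ sqrt (INR n + x)))) N)
      (Cmult c (RtoC (Rsum1 (fun n => / sqrt (INR n + x)) N)))).
  { clear - Hpw Hx. induction N; [simpl; ring|]. rewrite !Csum1_S, IHN. cbn [Rsum1].
    rewrite Hpw by (pose proof (pos_INR (S N)); lra). rewrite RtoC_plus. ring. }
  unfold reg_sum. fold N. rewrite E, (Hpw x Hx).
  replace (Cminus (RtoC 1) (RtoC (1 / 2))) with (RtoC (1 / 2))
    by (rewrite <- RtoC_minus; f_equal; field).
  rewrite pw_real, Rpower_half by (pose proof (pos_INR N); lra).
  set (W := Csum1 _ N) in *. set (S1 := Rsum1 _ N) in *. set (r := sqrt (INR N + x)) in *.
  replace (Cminus _ _) with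
    (Cmult (RtoC (1 / 2)) (Cplus W (Cmult c (RtoC (S1 - 2 * r))))).
  - rewrite Cmod_mult, Cmod_R, Rabs_pos_eq by lra.
    assert (Cmod (Cplus W (Cmult c (RtoC (S1 - 2 * r)))) <= 8 * sqrt B + 1 * 3).
    { eapply Rle_trans; [apply Cmod_triangle|]. apply Rplus_le_compat; auto.
      rewrite Cmod_mult, Cmod_R. apply Rmult_le_compat; auto using Cmod_ge_0, Rabs_pos. }
    assert (1 <= sqrt B) by (rewrite <- sqrt_1; apply sqrt_le_1_alt; lra). lra.
  - rewrite RtoC_minus, RtoC_mult.
    assert (E2 : RtoC (1 / 2) = Cinv (RtoC 2)).
    { rewrite <- RtoC_inv by lra. f_equal. field. }
    rewrite E2. field.
Qed.

(** A tolerance [sqrt B] in the limit and [6 sqrt B] for the sum make 7, doubled when the factor 1/2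
    is removed. *)
Lemma L_half_approx (chi : nat -> C) (b l q : nat) (F : C -> C) (B : R) :
  (1 <= b)%nat -> (b < l)%nat -> (0 < q)%nat ->
  (forall n, chi (n + q)%nat = chi n) -> (forall n, Cmod (chi n) <= 1) ->
  is_L_continuation chi b l F ->
  let f := fun n => chi (b + n * l)%nat in
  1 <= B -> (forall N, Cmod (Csum1 (fun n => Cminus (f n) (mean f q)) N) <= B) ->
  Cmod (Cminus (F (RtoC (1 / 2))) (Cmult (chi b) (RtoC (/ sqrt (INR b / INR l))))) <= 14 * sqrt B.
Proof.
  intros Hb Hl Hq Hper Hchi HF f HB HS.
  destruct (L_continuation_half chi b l q F Hb Hl Hq Hper Hchi HF (sqrt B)) as [k Hk].
  { apply sqrt_lt_R0; lra. }
  specialize (Hk k (Nat.le_refl k)). fold f in Hk.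
  assert (Hb0 : 0 < INR b) by (apply lt_0_INR; lia).
  assert (Hl0 : 0 < INR l) by (apply lt_0_INR; lia).
  assert (Hx : 0 < INR b / INR l) by (apply Rdiv_lt_0_compat; auto).
  assert (Hx1 : INR b / INR l <= 1).
  { apply Rmult_le_reg_r with (INR l); auto. unfold Rdiv. rewrite Rmult_assoc, Rinv_l by lra.
    assert (INR b <= INR l) by (apply le_INR; lia). lra. }
  pose proof (reg_sum_half_bound f (INR b / INR l) B q k Hq Hx Hx1 HB
    ltac:(intros; apply Hchi) HS) as HR.
  replace (f O) with (chi b) in HR by (unfold f; f_equal; lia).
  set (R := reg_sum _ _ _ _ _ _) in *.
  set (Y := Cmult (chi b) (RtoC (/ sqrt (INR b / INR l)))) in *.
  pose proof (Cmod_sub_triangle (Cmult (RtoC (1 / 2)) (F (RtoC (1 / 2)))) R (Cmult (RtoC (1 / 2)) Y)) as H.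
  replace (Cminus (Cmult (RtoC (1 / 2)) (F (RtoC (1 / 2)))) (Cmult (RtoC (1 / 2)) Y)) with
    (Cmult (RtoC (1 / 2)) (Cminus (F (RtoC (1 / 2))) Y)) in H by ring.
  rewrite Cmod_mult, Cmod_R, Rabs_pos_eq in H by lra. lra.
Qed.

(** * Gauss sums and the Polya-Vinogradov inequality *)

Lemma Csum1_exchange (f : nat -> nat -> C) N M :
  Csum1 (fun i => Csum1 (fun j => f i j) M) N = Csum1 (fun j => Csum1 (fun i => f i j) N) M.
Proof.
  induction N; simpl.
  - induction M; simpl; [|rewrite <- IHM]; ring.
  - now rewrite IHN, <- Csum1_plus.
Qed.

Lemma RtoC_Rsum1 f N : RtoC (Rsum1 f N) = Csum1 (fun n => RtoC (f n)) N.
Proof. induction N; simpl; auto. now rewrite RtoC_plus, IHN. Qed.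

Lemma Rsum1_ext f g N : (forall n, (1 <= n <= N)%nat -> f n = g n) -> Rsum1 f N = Rsum1 g N.
Proof.
  intros H. apply Rle_antisym; apply Rsum1_le; intros; rewrite H by auto; lra.
Qed.

Lemma Rsum1_plus f g N : Rsum1 (fun n => f n + g n) N = Rsum1 f N + Rsum1 g N.
Proof. induction N; simpl; [|rewrite IHN]; ring. Qed.

Lemma Rsum1_nonneg f N : (forall n, (1 <= n <= N)%nat -> 0 <= f n) -> 0 <= Rsum1 f N.
Proof.
  intros H. replace 0 with (Rsum1 (fun _ => 0) N) by (rewrite Rsum1_const; ring).
  now apply Rsum1_le.
Qed.

Lemma Rsum1_exchange (f : nat -> nat -> R) N M :
  Rsum1 (fun i => Rsum1 (fun j => f i j) M) N = Rsum1 (fun j => Rsum1 (fun i => f i j) N) M.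
Proof.
  induction N; simpl.
  - rewrite Rsum1_const. ring.
  - now rewrite IHN, <- Rsum1_plus.
Qed.

Lemma Rsum1_add f N M : Rsum1 f (N + M) = Rsum1 f N + Rsum1 (fun n => f (N + n)%nat) M.
Proof.
  induction M; [rewrite Nat.add_0_r; simpl; ring|].
  rewrite Nat.add_succ_r. simpl. rewrite IHM, Nat.add_succ_r. ring.
Qed.

Lemma Rsum1_term_le f N k : (1 <= k <= N)%nat -> (forall n, (1 <= n <= N)%nat -> 0 <= f n) ->
  f k <= Rsum1 f N.
Proof.
  induction N; intros Hk H; [lia|]. simpl.
  destruct (Nat.eq_dec k (S N)) as [->|].
  - assert (0 <= Rsum1 f N) by (apply Rsum1_nonneg; intros; apply H; lia). lra.
  - assert (f k <= Rsum1 f N) by (apply IHN; [lia|intros; apply H; lia]).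
    specialize (H (S N) ltac:(lia)). lra.
Qed.

Lemma Rsum1_rev f N : Rsum1 (fun n => f (S N - n)%nat) N = Rsum1 f N.
Proof.
  revert f. induction N; intros f; auto.
  assert (E : Rsum1 f (S N) = f 1%nat + Rsum1 (fun n => f (1 + n)%nat) N).
  { change (S N) with (1 + N)%nat. rewrite Rsum1_add. cbn [Rsum1]. ring. }
  rewrite E, <- (IHN (fun n => f (1 + n)%nat)). cbn [Rsum1].
  replace (S (S N) - S N)%nat with 1%nat by lia.
  rewrite (Rsum1_ext (fun n => f (S (S N) - n)%nat) (fun n => f (1 + (S N - n))%nat)).
  - ring.
  - intros n Hn. f_equal. lia.
Qed.

Lemma Rsum1_blocks (f : nat -> R) d Q : (0 < d)%nat ->
  Rsum1 (fun a => if Nat.eqb (a mod d) 0 then f a else 0) (d * Q) = Rsum1 (fun c => f (d * c)%nat) Q.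
Proof.
  intros Hd. induction Q.
  - now rewrite Nat.mul_0_r.
  - replace (d * S Q)%nat with (d * Q + d)%nat by lia. rewrite Rsum1_add, IHQ. cbn [Rsum1].
    f_equal. destruct d as [|d]; [lia|]. cbn [Rsum1].
    rewrite (Rsum1_ext _ (fun _ => 0)).
    + rewrite Rsum1_const.
      replace (S d * Q + S d)%nat with (S d * S Q)%nat by lia.
      rewrite Nat.mul_comm, Nat.Div0.mod_mul, Nat.eqb_refl. ring.
    + intros n Hn. rewrite (Nat.mul_comm (S d) Q), Nat.add_comm, Nat.Div0.mod_add.
      rewrite Nat.mod_small by lia. destruct (Nat.eqb_spec n 0); [lia|auto].
Qed.

(** * Sums over residues *)

Lemma periodic_mod {A : Type} (phi : nat -> A) P n : (0 < P)%nat ->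
  (forall n, phi (n + P)%nat = phi n) -> phi (n mod P) = phi n.
Proof.
  intros HP H. rewrite (Nat.div_mod_eq n P) at 2. generalize (n / P)%nat (n mod P). intros k r.
  induction k; [f_equal; lia|]. rewrite IHk.
  replace (P * S k + r)%nat with (P * k + r + P)%nat by lia. now rewrite H.
Qed.

(** Trading the residue [P] for 0 and the sum for a fold over a list lets a permutation of
    [0, ..., P - 1] be applied. *)
Lemma periodic_shift_sum (phi : nat -> C) P : (0 < P)%nat ->
  (forall n, phi (n + P)%nat = phi n) ->
  Csum1 phi P = fold_right Cplus (RtoC 0) (map phi (seq 0 P)).
Proof.
  intros HP Hper.
  assert (H1 : forall N, Csum1 phi N = fold_right Cplus (RtoC 0) (map phi (seq 1 N))).
  { intros N. assert (G : forall L a, fold_right Cplus a (map phi L) =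
      Cplus (fold_right Cplus (RtoC 0) (map phi L)) a).
    { induction L; intros; simpl; [ring|]. rewrite IHL. ring. }
    induction N; auto. rewrite seq_S, map_app, fold_right_app. simpl.
    rewrite G, <- IHN. f_equal. ring. }
  rewrite H1. destruct P as [|P]; [lia|].
  rewrite seq_S, map_app, fold_right_app.
  assert (G : forall L a, fold_right Cplus a (map phi L) =
      Cplus (fold_right Cplus (RtoC 0) (map phi L)) a).
  { induction L; intros; simpl; [ring|]. rewrite IHL. ring. }
  rewrite G. simpl. rewrite <- (Hper 0%nat). simpl. ring.
Qed.

Lemma coprime_mul_inj u P i j : Nat.gcd u P = 1%nat -> (i < P)%nat -> (j < P)%nat ->
  (u * i) mod P = (u * j) mod P -> i = j.
Proof.
  assert (W : forall i j, Nat.gcd u P = 1%nat -> (i <= j)%nat -> (j < P)%nat ->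
    (u * i) mod P = (u * j) mod P -> i = j).
  { clear. intros i j Hg Hij Hj E.
    assert (D : Nat.divide P (u * (j - i))).
    { exists ((u * j) / P - (u * i) / P)%nat.
      pose proof (Nat.div_mod_eq (u * i) P) as E1. pose proof (Nat.div_mod_eq (u * j) P) as E2.
      assert ((u * i) / P <= (u * j) / P)%nat by (apply Nat.Div0.div_le_mono; nia).
      rewrite Nat.mul_sub_distr_r, Nat.mul_sub_distr_l. rewrite E in E1.
      rewrite (Nat.mul_comm (u * j / P)), (Nat.mul_comm (u * i / P)). lia. }
    apply Nat.gauss in D; [|rewrite Nat.gcd_comm; exact Hg].
    destruct (Nat.eq_dec (j - i) 0) as [|Hne]; [lia|].
    apply Nat.divide_pos_le in D; lia. }
  intros Hg Hi Hj E. destruct (Nat.le_ge_cases i j); [now apply W|].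
  symmetry. apply W; auto.
Qed.

(** Multiplication by a unit is injective on the residues, hence permutes them. *)
Lemma Csum1_unit_dilate (phi : nat -> C) u P : (0 < P)%nat -> Nat.gcd u P = 1%nat ->
  (forall n, phi (n + P)%nat = phi n) -> Csum1 (fun n => phi (u * n)%nat) P = Csum1 phi P.
Proof.
  intros HP Hg Hper.
  rewrite (periodic_shift_sum phi P), (periodic_shift_sum (fun n => phi (u * n)%nat) P); auto.
  2: { intros n. rewrite Nat.mul_add_distr_l, Nat.add_comm. now apply (periodic_mul phi P u). }
  rewrite (map_ext (fun n => phi (u * n)%nat) (fun n => phi ((u * n) mod P))).
  2: { intros n. symmetry. now apply periodic_mod. }
  rewrite <- (map_map (fun n => (u * n) mod P) phi).
  assert (Hperm : Permutation (map (fun n => (u * n) mod P) (seq 0 P)) (seq 0 P)).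
  { apply NoDup_Permutation_bis.
    - apply FinFun.Injective_map_NoDup_in; [|apply seq_NoDup].
      intros i j Hi Hj. apply in_seq in Hi, Hj. apply coprime_mul_inj; auto; lia.
    - rewrite length_map. auto.
    - intros y Hy. apply in_map_iff in Hy. destruct Hy as (i & <- & _). apply in_seq.
      pose proof (Nat.mod_upper_bound (u * i) P). lia. }
  assert (G : forall L L', Permutation L L' ->
    fold_right Cplus (RtoC 0) (map phi L) = fold_right Cplus (RtoC 0) (map phi L')).
  { intros L L' H. induction H; simpl; auto.
    - now rewrite IHPermutation.
    - ring.
    - congruence. }
  now apply G.
Qed.

Lemma Rsum1_unit_dilate (phi : nat -> R) u P : (0 < P)%nat -> Nat.gcd u P = 1%nat ->
  (forall n, phi (n + P)%nat = phi n) -> Rsum1 (fun n => phi (u * n)%nat) P = Rsum1 phi P.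
Proof.
  intros HP Hg Hper. apply RtoC_inj. rewrite !RtoC_Rsum1.
  apply (Csum1_unit_dilate (fun n => RtoC (phi n))); auto. intros n. now rewrite Hper.
Qed.

Lemma Rsum1_periods (phi : nat -> R) g P : (forall n, phi (n + P)%nat = phi n) ->
  Rsum1 phi (g * P) = INR g * Rsum1 phi P.
Proof.
  intros Hper. induction g; [simpl; ring|].
  replace (S g * P)%nat with (g * P + P)%nat by lia. rewrite Rsum1_add, IHg, S_INR.
  rewrite (Rsum1_ext (fun n => phi (g * P + n)%nat) phi); [ring|].
  intros n _. now apply periodic_mul.
Qed.

(** Write [a = g a'] with [a'] a unit modulo [P]. As [v] runs over [g] periods of length [P], the
    product [a v] meets each multiple of [g] modulo [g P] exactly [g] times. *)
Lemma Rsum1_dilate (Phi : nat -> R) a g P : (0 < P)%nat -> (0 < g)%nat ->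
  Nat.gcd a (g * P) = g -> (forall n, Phi (n + g * P)%nat = Phi n) ->
  Rsum1 (fun v => Phi (a * v)%nat) (g * P) = INR g * Rsum1 (fun v => Phi (g * v)%nat) P.
Proof.
  intros HP Hg Hgcd Hper.
  destruct (Nat.gcd_divide_l a (g * P)) as [a' Ha]. rewrite Hgcd in Ha.
  assert (Hco : Nat.gcd a' P = 1%nat).
  { rewrite Ha, (Nat.mul_comm a'), Nat.gcd_mul_mono_l in Hgcd. nia. }
  set (phi := fun v => Phi (g * v)%nat).
  assert (Hphi : forall n, phi (n + P)%nat = phi n).
  { intros n. unfold phi. now rewrite Nat.mul_add_distr_l. }
  rewrite (Rsum1_ext _ (fun v => phi (a' * v)%nat)) by (intros; unfold phi; f_equal; subst a; lia).
  rewrite (Rsum1_periods (fun v => phi (a' * v)%nat)).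
  - now rewrite (Rsum1_unit_dilate phi).
  - intros n. rewrite Nat.mul_add_distr_l, Nat.add_comm. now apply periodic_mul.
Qed.

(* e(n/q) *)
Definition ez (q n : nat) : C :=
  (cos (2 * PI * INR n / INR q), sin (2 * PI * INR n / INR q)).

Lemma ez_add q a b : ez q (a + b) = Cmult (ez q a) (ez q b).
Proof.
  unfold ez, Cmult; simpl. rewrite plus_INR.
  replace (2 * PI * (INR a + INR b) / INR q) with
    (2 * PI * INR a / INR q + 2 * PI * INR b / INR q) by (unfold Rdiv; ring).
  rewrite cos_plus, sin_plus. f_equal; ring.
Qed.

Lemma ez_0 q : ez q 0 = RtoC 1.
Proof.
  unfold ez, RtoC. replace (2 * PI * INR 0 / INR q) with 0 by (simpl; unfold Rdiv; ring).
  now rewrite cos_0, sin_0.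
Qed.

Lemma ez_self q : (0 < q)%nat -> ez q q = RtoC 1.
Proof.
  intros Hq. unfold ez, RtoC. assert (0 < INR q) by (apply lt_0_INR; lia).
  replace (2 * PI * INR q / INR q) with (2 * PI) by (field; lra).
  now rewrite cos_2PI, sin_2PI.
Qed.

Lemma ez_mul q a n : ez q (a * n) = Cpow (ez q a) n.
Proof.
  induction n; [rewrite Nat.mul_0_r; apply ez_0|].
  rewrite Nat.mul_succ_r, ez_add, IHn. simpl. ring.
Qed.

Lemma ez_periodic q n : (0 < q)%nat -> ez q (n + q) = ez q n.
Proof. intros Hq. rewrite ez_add, ez_self by auto. ring. Qed.

Lemma ez_multiple q k : (0 < q)%nat -> ez q (k * q) = RtoC 1.
Proof. intros Hq. rewrite Nat.mul_comm, ez_mul, ez_self by auto. apply Cpow_1_l. Qed.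

Lemma ez_scale d q n : (0 < d)%nat -> (0 < q)%nat -> ez (d * q) (d * n) = ez q n.
Proof.
  intros Hd Hq. unfold ez. rewrite !mult_INR.
  assert (0 < INR d) by (apply lt_0_INR; lia). assert (0 < INR q) by (apply lt_0_INR; lia).
  replace (2 * PI * (INR d * INR n) / (INR d * INR q)) with (2 * PI * INR n / INR q); auto.
  field. lra.
Qed.

Lemma Cmod_ez q n : Cmod (ez q n) = 1.
Proof.
  unfold Cmod, ez; simpl. rewrite !Rmult_1_r.
  pose proof (sin2_cos2 (2 * PI * INR n / INR q)) as H. unfold Rsqr in H.
  rewrite Rplus_comm, H. apply sqrt_1.
Qed.

(** The cubic Taylor bound [x - x^3 / 6] with [x^2 <= 4], which follows from [PI <= 4]. The factor
    1/3 is later compensated by [PI >= 3]. *)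
Lemma sin_ge_third x : 0 <= x -> x <= PI / 2 -> x / 3 <= sin x.
Proof.
  intros H0 H1. pose proof PI_4 as HPI.
  destruct (pre_sin_bound x 0 H0 ltac:(lra)) as [H _].
  unfold sin_approx, sin_term in H. simpl in H.
  apply Rle_trans with (2 := H). assert (x ^ 2 <= 4) by nra.
  replace (1 * (x * 1 / 1) + -1 * 1 * (x * (x * (x * 1)) / (1 + 1 + 1 + 1 + 1 + 1))) with
    (x - x * x ^ 2 / 6) by field.
  nra.
Qed.

Lemma Cmod_one_minus_ez q r : (0 < r)%nat -> (r < q)%nat ->
  Cmod (Cminus (RtoC 1) (ez q r)) = 2 * sin (PI * (INR r / INR q)).
Proof.
  intros Hr Hq. assert (H0 : 0 < INR r) by (apply lt_0_INR; lia).
  assert (H1 : INR r < INR q) by (apply lt_INR; auto).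
  set (y := PI * (INR r / INR q)).
  assert (Hy : 0 <= sin y).
  { assert (0 < INR r / INR q) by (apply Rdiv_lt_0_compat; lra).
    assert (INR r / INR q <= 1).
    { apply Rmult_le_reg_r with (INR q); [lra|]. unfold Rdiv.
      rewrite Rmult_assoc, Rinv_l; lra. }
    pose proof PI_RGT_0. apply sin_ge_0; unfold y; nra. }
  unfold ez. replace (2 * PI * INR r / INR q) with (2 * y) by (unfold y; field; lra).
  rewrite cos_2a_sin, sin_2a. unfold Cmod, Cminus, Cplus, Copp, RtoC. cbn [fst snd].
  replace (_ + _) with ((2 * sin y) ^ 2).
  - apply sqrt_pow2. lra.
  - pose proof (sin2_cos2 y) as H. unfold Rsqr in H.
    replace ((1 + - (1 - 2 * sin y * sin y)) ^ 2 + (0 + - (2 * sin y * cos y)) ^ 2) with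
      (4 * (sin y * sin y) * (sin y * sin y + cos y * cos y)) by ring.
    rewrite H. ring.
Qed.

(** The quotient is [1 / sin (PI r / q)], at most [q] over the smaller of [r] and [q - r]. Taking
    both fractions removes the case distinction and makes the bound sum to two harmonic sums. *)
Lemma inv_one_minus_ez_le q r : (0 < r)%nat -> (r < q)%nat ->
  0 < Cmod (Cminus (RtoC 1) (ez q r)) /\
  2 / Cmod (Cminus (RtoC 1) (ez q r)) <= INR q / INR r + INR q / INR (q - r).
Proof.
  intros Hr Hq. rewrite Cmod_one_minus_ez by auto.
  assert (H0 : 0 < INR r) by (apply lt_0_INR; lia).
  assert (Hqr : 0 < INR (q - r)) by (apply lt_0_INR; lia).
  assert (Eqr : INR (q - r) = INR q - INR r) by (apply minus_INR; lia).
  assert (Hq0 : 0 < INR q) by lra.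
  pose proof PI2_3_2 as HPI.
  assert (B : forall k, 0 < k -> k <= INR q / 2 -> k / INR q <= sin (PI * (k / INR q))).
  { intros k Hk Hk2. assert (0 < k / INR q) by (apply Rdiv_lt_0_compat; lra).
    assert (k / INR q <= 1 / 2).
    { apply Rmult_le_reg_r with (INR q); [lra|]. unfold Rdiv at 1.
      rewrite Rmult_assoc, Rinv_l; lra. }
    eapply Rle_trans; [|apply sin_ge_third; nra]. nra. }
  assert (I1 : 0 < INR q / INR r) by now apply Rdiv_lt_0_compat.
  assert (I2 : 0 < INR q / INR (q - r)) by now apply Rdiv_lt_0_compat.
  assert (Fin : forall k, 0 < k -> k / INR q <= sin (PI * (INR r / INR q)) ->
     0 < 2 * sin (PI * (INR r / INR q)) /\ 2 / (2 * sin (PI * (INR r / INR q))) <= INR q / k).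
  { intros k Hk Hs. assert (0 < k / INR q) by (apply Rdiv_lt_0_compat; lra). split; [lra|].
    replace (2 / (2 * sin (PI * (INR r / INR q)))) with (/ sin (PI * (INR r / INR q)))
      by (field; lra).
    replace (INR q / k) with (/ (k / INR q)) by (field; lra).
    apply Rinv_le_contravar; auto. }
  destruct (Rle_dec (INR r) (INR q / 2)) as [Hle|Hgt].
  - destruct (Fin (INR r) H0 (B _ H0 Hle)). split; lra.
  - assert (Hs : INR (q - r) / INR q <= sin (PI * (INR r / INR q))).
    { replace (PI * (INR r / INR q)) with (PI - PI * (INR (q - r) / INR q))
        by (rewrite Eqr; field; lra).
      rewrite sin_PI_x. apply B; lra. }
    destruct (Fin (INR (q - r)) Hqr Hs). split; lra.
Qed.

Lemma geometric_sum z N :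
  Cmult (Cminus (RtoC 1) z) (Csum1 (fun n => Cpow z n) N) = Cmult z (Cminus (RtoC 1) (Cpow z N)).
Proof.
  induction N; [simpl; ring|]. rewrite Csum1_S, Cmult_plus_distr_l, IHN. simpl. ring.
Qed.

Lemma geometric_sum_bound z N : Cmod z = 1 -> 0 < Cmod (Cminus (RtoC 1) z) ->
  Cmod (Csum1 (fun n => Cpow z n) N) <= 2 / Cmod (Cminus (RtoC 1) z).
Proof.
  intros Hz H. apply Rmult_le_reg_l with (Cmod (Cminus (RtoC 1) z)); auto.
  rewrite <- Cmod_mult, geometric_sum, Cmod_mult, Hz.
  replace (Cmod (Cminus (RtoC 1) z) * (2 / Cmod (Cminus (RtoC 1) z))) with 2 by (field; lra).
  unfold Cminus. rewrite Rmult_1_l. eapply Rle_trans; [apply Cmod_triangle|].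
  rewrite Cmod_opp, Cmod_pow, Hz, pow1, Cmod_1. lra.
Qed.

Lemma geometric_sum_full z q : 0 < Cmod (Cminus (RtoC 1) z) -> Cpow z q = RtoC 1 ->
  Csum1 (fun n => Cpow z n) q = RtoC 0.
Proof.
  intros H Hz. pose proof (geometric_sum z q) as E. rewrite Hz in E.
  replace (Cmult z (Cminus (RtoC 1) (RtoC 1))) with (RtoC 0) in E by ring.
  apply Cmod_eq_0. apply (f_equal Cmod) in E. rewrite Cmod_mult, Cmod_0 in E. nra.
Qed.

(** Representatives run over [1, ..., q], the range of [Csum1]. The equation is shifted by [q]
    because [n = 0] has the larger representative [q]. *)
Lemma periodic_residue {A : Type} (f : nat -> A) q n : (0 < q)%nat ->
  (forall n, f (n + q)%nat = f n) -> exists r, (1 <= r <= q)%nat /\ f n = f r /\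
  exists k, (n + q = r + k * q)%nat.
Proof.
  intros Hq Hper. pose proof (Nat.div_mod_eq n q) as E.
  pose proof (Nat.mod_upper_bound n q ltac:(lia)) as Hb.
  destruct (Nat.eq_dec (n mod q) 0) as [H0|H0].
  - exists q. repeat split; try lia.
    + rewrite <- (periodic_mod f q n), H0 by auto. symmetry. apply (Hper 0%nat).
    + exists (n / q)%nat. lia.
  - exists (n mod q). repeat split; try lia.
    + symmetry. now apply periodic_mod.
    + exists (S (n / q)). lia.
Qed.

(** * Gauss sums of a Dirichlet character *)

Section DirichletCharacter.
Variables (q : nat) (chi : nat -> C).
Hypothesis Hchi : is_dirichlet_char q chi.

Let Hq : (0 < q)%nat := dc_q_pos _ _ Hchi.
Let Hper : forall n, chi (n + q)%nat = chi n := dc_periodic _ _ Hchi.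

(** Periodicity makes [chi] bounded, and [|chi n|^k = |chi (n^k)|] would be unbounded in [k] if
    [|chi n|] exceeded 1. *)
Lemma char_Cmod_le_1 n : Cmod (chi n) <= 1.
Proof.
  set (M := Rsum1 (fun i => Cmod (chi i)) q).
  assert (HM : forall n, Cmod (chi n) <= M).
  { intros m. destruct (periodic_residue chi q m Hq Hper) as (r & Hr & -> & _).
    apply (Rsum1_term_le (fun i => Cmod (chi i))); auto. intros; apply Cmod_ge_0. }
  destruct (Rle_dec (Cmod (chi n)) 1) as [|Hgt]; auto. exfalso. apply Rnot_le_lt in Hgt.
  assert (Hpow : forall k, Cmod (chi (n ^ k)%nat) = Cmod (chi n) ^ k).
  { induction k; simpl.
    - rewrite (dc_one _ _ Hchi). apply Cmod_1.
    - now rewrite (dc_mult _ _ Hchi), Cmod_mult, IHk. }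
  destruct (Pow_x_infinity (Cmod (chi n))) with (b := M + 1) as [k Hk].
  - rewrite Rabs_pos_eq; [lra|apply Cmod_ge_0].
  - specialize (Hk k (Nat.le_refl k)). rewrite <- Hpow, Rabs_pos_eq in Hk by apply Cmod_ge_0.
    specialize (HM (n ^ k)%nat). lra.
Qed.

Definition gauss (a : nat) : C := Csum1 (fun n => Cmult (chi n) (ez q (a * n))) q.

Lemma ez_dilate_periodic a n : ez q (a * (n + q)) = ez q (a * n).
Proof.
  rewrite Nat.mul_add_distr_l, ez_add, ez_multiple by auto. ring.
Qed.

Lemma gauss_periodic a : gauss (a + q) = gauss a.
Proof.
  unfold gauss. apply Csum1_ext. intros n _.
  now rewrite !(Nat.mul_comm _ n), ez_dilate_periodic.
Qed.

(** Substitute [v n] for [n]. Only the multiplier [v] has to be a unit; [a] is arbitrary, as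
    imprimitive characters require. *)
Lemma gauss_unit a v : Nat.gcd v q = 1%nat -> Cmult (chi v) (gauss (a * v)) = gauss a.
Proof.
  intros Hv. unfold gauss.
  rewrite <- (Csum1_unit_dilate (fun n => Cmult (chi n) (ez q (a * n))) v q Hq Hv).
  - rewrite <- Csum1_scal. apply Csum1_ext. intros n _.
    rewrite (dc_mult _ _ Hchi), Nat.mul_assoc. ring.
  - intros n. now rewrite ez_dilate_periodic, Hper.
Qed.

Lemma ez_conj_self n : Cmult (ez q n) (Cconj (ez q n)) = RtoC 1.
Proof. rewrite <- Cmod2_conj, Cmod_ez. f_equal. ring. Qed.

Lemma ez_orthogonality m n : (1 <= m <= q)%nat -> (1 <= n <= q)%nat -> n <> m ->
  Csum1 (fun a => Cmult (ez q (a * n)) (Cconj (ez q (a * m)))) q = RtoC 0.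
Proof.
  intros Hm Hn Hne. set (z := Cmult (ez q n) (Cconj (ez q m))).
  rewrite (Csum1_ext _ (fun a => Cpow z a)).
  (* Exponents are natural numbers, so the ratio is [e((n - m)/q)] or the conjugate of
     [e((m - n)/q)]. *)
  - assert (Hz : exists r, (0 < r < q)%nat /\ (z = ez q r \/ z = Cconj (ez q r))).
    { destruct (Nat.lt_ge_cases m n) as [H|H].
      - exists (n - m)%nat. split; [lia|left]. unfold z.
        replace (ez q n) with (Cmult (ez q (n - m)) (ez q m)) by (rewrite <- ez_add; f_equal; lia).
        rewrite <- Cmult_assoc, ez_conj_self. ring.
      - exists (m - n)%nat. split; [lia|right]. unfold z.
        replace (ez q m) with (Cmult (ez q (m - n)) (ez q n)) by (rewrite <- ez_add; f_equal; lia).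
        rewrite Cmult_conj. replace (Cmult _ _) with
          (Cmult (Cconj (ez q (m - n))) (Cmult (ez q n) (Cconj (ez q n)))) by ring.
        rewrite ez_conj_self. ring. }
    apply geometric_sum_full.
    + destruct Hz as (r & Hr & Hz).
      destruct (inv_one_minus_ez_le q r) as [H0 _]; try lia.
      destruct Hz as [-> | ->]; auto.
      rewrite <- Cmod_conj, Cminus_conj, Cconj_conj.
      replace (Cconj (RtoC 1)) with (RtoC 1); auto.
      unfold Cconj, RtoC; simpl; f_equal; ring.
    + unfold z. rewrite Cpow_mult_l, <- Cpow_conj, <- !ez_mul, !ez_multiple by auto.
      unfold Cconj, Cmult, RtoC; simpl; f_equal; ring.
  - intros a _. unfold z. rewrite Cpow_mult_l, <- Cpow_conj, <- !ez_mul.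
    now rewrite !(Nat.mul_comm _ a).
Qed.

Lemma char_fourier_residue m : (1 <= m <= q)%nat ->
  Csum1 (fun a => Cmult (gauss a) (Cconj (ez q (a * m)))) q = Cmult (RtoC (INR q)) (chi m).
Proof.
  intros Hm.
  rewrite (Csum1_ext _ (fun a => Csum1 (fun n => Cmult (chi n)
     (Cmult (ez q (a * n)) (Cconj (ez q (a * m))))) q)).
  - rewrite Csum1_exchange. rewrite (Csum1_single _ q m); auto.
    + rewrite Csum1_scal, (Csum1_ext _ (fun _ => RtoC 1)).
      * rewrite Csum1_const. ring.
      * intros a _. apply ez_conj_self.
    + intros n Hn Hne. rewrite Csum1_scal, ez_orthogonality by auto. ring.
  - intros a _. unfold gauss. rewrite Cmult_comm, <- Csum1_scal. apply Csum1_ext.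
    intros n _. ring.
Qed.

(** Finite Fourier inversion, extended from [1, ..., q] to every [y] because it is applied at the
    points [b + n l] of a progression. *)
Lemma char_fourier y :
  Csum1 (fun a => Cmult (gauss a) (Cconj (ez q (a * y)))) q = Cmult (RtoC (INR q)) (chi y).
Proof.
  destruct (periodic_residue chi q y Hq Hper) as (r & Hr & E & k & Hk).
  rewrite E, <- char_fourier_residue by auto. apply Csum1_ext. intros a _. do 2 f_equal.
  rewrite <- (ez_dilate_periodic a y), Hk.
  rewrite Nat.mul_add_distr_l, ez_add, Nat.mul_assoc, ez_multiple by auto. ring.
Qed.

(** Its value is Euler's phi of [q], which never has to be computed. *)
Definition char_mass : R := Rsum1 (fun n => Cmod (chi n) ^ 2) q.

Lemma char_mass_pos : 0 < char_mass.
Proof.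
  apply Rlt_le_trans with (Cmod (chi 1%nat) ^ 2).
  - rewrite (dc_one _ _ Hchi), Cmod_1. lra.
  - apply (Rsum1_term_le (fun n => Cmod (chi n) ^ 2)); [lia|]. intros; apply pow2_ge_0.
Qed.

(** Expanding one of the two factors leaves the inversion formula at each [m]. *)
Lemma gauss_parseval : Rsum1 (fun a => Cmod (gauss a) ^ 2) q = INR q * char_mass.
Proof.
  apply RtoC_inj. rewrite RtoC_mult. unfold char_mass. rewrite !RtoC_Rsum1.
  rewrite (Csum1_ext _ (fun a => Csum1 (fun m => Cmult (Cconj (chi m))
     (Cmult (gauss a) (Cconj (ez q (a * m))))) q)).
  - rewrite Csum1_exchange, <- Csum1_scal. apply Csum1_ext. intros m Hm.
    rewrite Csum1_scal, char_fourier, Cmod2_conj. ring.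
  - intros a _. rewrite Cmod2_conj. unfold gauss at 2.
    assert (E : forall f N, Cconj (Csum1 f N) = Csum1 (fun n => Cconj (f n)) N).
    { intros f N. induction N; simpl.
      - unfold Cconj, RtoC; simpl; f_equal; ring.
      - now rewrite Cplus_conj, IHN. }
    rewrite E, <- Csum1_scal. apply Csum1_ext. intros m _. rewrite Cmult_conj. ring.
Qed.

(* |G(av)| = |G(a)| for every unit v, and each residue is av for at most gcd(a,q) values of v,
   so Parseval's identity bounds |G(a)|; the total mass of chi cancels. *)
Lemma gauss_bound a : (1 <= a)%nat -> Cmod (gauss a) ^ 2 <= INR q * INR (Nat.gcd a q).
Proof.
  intros Ha. set (g := Nat.gcd a q).
  destruct (Nat.gcd_divide_r a q) as [P HP]. fold g in HP.
  assert (Hg : (0 < g)%nat) by (destruct g; lia).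
  assert (HP0 : (0 < P)%nat) by (destruct P; lia).
  rewrite Nat.mul_comm in HP.
  set (Phi := fun n => Cmod (gauss n) ^ 2).
  (* At units [G(a) = chi(v) G(a v)] turns the weight into [|chi v|^4 <= 1]; at non-units the weight
     is 0. *)
  assert (H1 : Cmod (gauss a) ^ 2 * char_mass <= Rsum1 (fun v => Phi (a * v)%nat) q).
  { unfold char_mass. rewrite <- Rsum1_scal. apply Rsum1_le. intros v _. unfold Phi.
    destruct (Nat.eq_dec (Nat.gcd v q) 1) as [Hv|Hv].
    - rewrite <- (gauss_unit a v Hv), Cmod_mult.
      pose proof (char_Cmod_le_1 v). pose proof (Cmod_ge_0 (chi v)).
      pose proof (pow2_ge_0 (Cmod (gauss (a * v)))).
      assert (Cmod (chi v) ^ 4 <= 1) by (rewrite <- (pow1 4); apply pow_incr; lra).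
      replace ((Cmod (chi v) * Cmod (gauss (a * v))) ^ 2 * Cmod (chi v) ^ 2) with
        (Cmod (chi v) ^ 4 * Cmod (gauss (a * v)) ^ 2) by ring.
      nra.
    - apply (dc_zero _ _ Hchi) in Hv. rewrite Hv, Cmod_0. pose proof (pow2_ge_0 (Cmod (gauss (a * v)))).
      lra. }
  (* The products [a v] run [g] times over the multiples of [g]; enlarging these to all residues
     brings in Parseval's identity. *)
  assert (H2 : Rsum1 (fun v => Phi (a * v)%nat) q <= INR g * Rsum1 Phi q).
  { rewrite HP at 1. rewrite (Rsum1_dilate Phi a g P); auto.
    - apply Rmult_le_compat_l; [apply pos_INR|].
      rewrite <- (Rsum1_blocks Phi g P Hg), <- HP. apply Rsum1_le. intros n _.
      pose proof (pow2_ge_0 (Cmod (gauss n))). destruct (Nat.eqb _ _); unfold Phi; lra.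
    - rewrite <- HP. reflexivity.
    - intros n. rewrite <- HP. unfold Phi. now rewrite gauss_periodic. }
  unfold Phi in H2 at 2. rewrite gauss_parseval in H2.
  pose proof char_mass_pos as Hm. apply Rmult_le_reg_r with char_mass; auto. nra.
Qed.

(* w(n) bounds every incomplete geometric sum of ratio e(n/q). *)
Definition ez_weight (Q n : nat) : R :=
  if Nat.eqb (n mod Q) 0 then 0 else 2 / Cmod (Cminus (RtoC 1) (ez Q n)).

Lemma ez_mod Q n : (0 < Q)%nat -> ez Q n = ez Q (n mod Q).
Proof.
  intros HQ. symmetry. apply periodic_mod; auto. intros; now apply ez_periodic.
Qed.

(** If [q] divides [a l], the sequence is constant and equals its mean, which is why [ez_weight] is
    0 there. Otherwise the mean vanishes, as a full geometric period, and an incomplete geometric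
    sum remains. *)
Lemma additive_partial_sum a b l N :
  let E := fun n => Cconj (ez q (a * (b + n * l))) in
  Cmod (Csum1 (fun n => Cminus (E n) (mean E q)) N) <= ez_weight q (a * l).
Proof.
  intros E.
  assert (HqR : 0 < INR q) by (apply lt_0_INR; lia).
  assert (HqC : RtoC (INR q) <> RtoC 0) by (intros H; apply RtoC_inj in H; lra).
  assert (EE : forall n, E n = Cmult (Cconj (ez q (a * b))) (Cpow (Cconj (ez q (a * l))) n)).
  { intros n. unfold E. replace (a * (b + n * l))%nat with (a * b + a * l * n)%nat by lia.
    now rewrite ez_add, Cmult_conj, (ez_mul q (a * l)), Cpow_conj. }
  set (z := Cconj (ez q (a * l))) in *. set (w := Cconj (ez q (a * b))) in *.
  unfold mean. rewrite (Csum1_ext E (fun n => Cmult w (Cpow z n))) by auto.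
  unfold ez_weight. destruct (Nat.eqb_spec ((a * l) mod q) 0) as [H0|H0].
  - assert (Hz : z = RtoC 1).
    { unfold z. rewrite ez_mod, H0, ez_0 by auto. unfold Cconj, RtoC; simpl; f_equal; ring. }
    rewrite (Csum1_ext _ (fun _ => RtoC 0)).
    + rewrite Csum1_const, Cmult_0_r, Cmod_0. lra.
    + intros n _. rewrite (Csum1_ext _ (fun _ => w)).
      * rewrite Csum1_const, EE, Hz, Cpow_1_l. field. auto.
      * intros k _. rewrite Hz, Cpow_1_l. ring.
  - pose proof (Nat.mod_upper_bound (a * l) q ltac:(lia)).
    destruct (inv_one_minus_ez_le q ((a * l) mod q)) as [Hpos _]; try lia.
    rewrite <- ez_mod in Hpos by auto.
    assert (Hzm : Cmod (Cminus (RtoC 1) z) = Cmod (Cminus (RtoC 1) (ez q (a * l)))).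
    { unfold z. rewrite <- Cmod_conj, Cminus_conj, Cconj_conj. do 2 f_equal.
      unfold Cconj, RtoC; simpl; f_equal; ring. }
    rewrite <- Hzm in *.
    rewrite Csum1_scal, geometric_sum_full; auto.
    + rewrite (Csum1_ext _ (fun n => Cmult w (Cpow z n))).
      * rewrite Csum1_scal, Cmod_mult. unfold w. rewrite Cmod_conj, Cmod_ez, Rmult_1_l.
        apply geometric_sum_bound; auto. unfold z. now rewrite Cmod_conj, Cmod_ez.
      * intros n _. rewrite EE. field. auto.
    + unfold z. rewrite <- Cpow_conj, <- ez_mul, ez_multiple by auto.
      unfold Cconj, RtoC; simpl; f_equal; ring.
Qed.

(** Completion: Fourier inversion writes [f] as a combination of additive characters, subtracting
    the mean passes to each of them, and the Gauss sums enter only through their moduli. *)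
Lemma char_progression_completion b l N :
  let f := fun n => chi (b + n * l)%nat in
  Cmod (Csum1 (fun n => Cminus (f n) (mean f q)) N) <=
  / sqrt (INR q) * Rsum1 (fun a => INR (Nat.gcd a q) * ez_weight q (a * l)) q.
Proof.
  intros f.
  assert (HqR : 0 < INR q) by (apply lt_0_INR; lia).
  assert (HqC : RtoC (INR q) <> RtoC 0) by (intros H; apply RtoC_inj in H; lra).
  assert (Hsq : 0 < sqrt (INR q)) by now apply sqrt_lt_R0.
  set (E := fun a n => Cconj (ez q (a * (b + n * l)))).
  assert (Hf : forall n, f n = Cmult (Cinv (RtoC (INR q))) (Csum1 (fun a => Cmult (gauss a) (E a n)) q)).
  { intros n. unfold f, E. rewrite char_fourier. field. auto. }
  assert (Hmean : mean f q =
    Cmult (Cinv (RtoC (INR q))) (Csum1 (fun a => Cmult (gauss a) (mean (E a) q)) q)).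
  { unfold mean at 1. rewrite (Csum1_ext f _ q (fun n _ => Hf n)), Csum1_scal, Csum1_exchange.
    unfold Cdiv. rewrite (Cmult_comm (Cmult _ _)). f_equal.
    rewrite <- Csum1_scal. apply Csum1_ext. intros a _. rewrite Csum1_scal. unfold mean, Cdiv. ring. }
  assert (HS : Csum1 (fun n => Cminus (f n) (mean f q)) N =
    Cmult (Cinv (RtoC (INR q)))
      (Csum1 (fun a => Cmult (gauss a) (Csum1 (fun n => Cminus (E a n) (mean (E a) q)) N)) q)).
  { rewrite (Csum1_ext (fun a => Cmult (gauss a) _)
      (fun a => Csum1 (fun n => Cmult (gauss a) (Cminus (E a n) (mean (E a) q))) N))
      by (intros; now rewrite Csum1_scal).
    rewrite Csum1_exchange, <- Csum1_scal. apply Csum1_ext. intros n _.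
    rewrite Hf, Hmean. unfold Cminus.
    replace (Cplus (Cmult (Cinv (RtoC (INR q))) (Csum1 (fun a => Cmult (gauss a) (E a n)) q))
      (Copp (Cmult (Cinv (RtoC (INR q))) (Csum1 (fun a => Cmult (gauss a) (mean (E a) q)) q))))
      with (Cmult (Cinv (RtoC (INR q))) (Cplus (Csum1 (fun a => Cmult (gauss a) (E a n)) q)
         (Cmult (Copp (RtoC 1)) (Csum1 (fun a => Cmult (gauss a) (mean (E a) q)) q)))) by ring.
    f_equal. rewrite <- Csum1_scal, <- Csum1_plus. apply Csum1_ext. intros a _. ring. }
  rewrite HS, Cmod_mult, Cmod_inv, Cmod_R, Rabs_pos_eq by (auto; lra).
  apply Rle_trans with (/ INR q * Rsum1 (fun a => sqrt (INR q) *
     (INR (Nat.gcd a q) * ez_weight q (a * l))) q).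
  - apply Rmult_le_compat_l; [left; now apply Rinv_0_lt_compat|].
    apply Cmod_Csum1_le. intros a Ha. rewrite Cmod_mult, <- Rmult_assoc.
    apply Rmult_le_compat; auto using Cmod_ge_0; [|apply additive_partial_sum].
    pose proof (gauss_bound a ltac:(lia)) as HG.
    assert (H1 : 1 <= INR (Nat.gcd a q)).
    { apply (le_INR 1). destruct (Nat.gcd a q) eqn:E0; [|lia].
      apply Nat.gcd_eq_0 in E0. lia. }
    rewrite <- (sqrt_pow2 (Cmod (gauss a))) by apply Cmod_ge_0.
    (* The square root of the gcd is enlarged to the gcd. The later sum over divisors tolerates
       this, since only [q / d] residues are multiples of [d]. *)
    apply Rle_trans with (sqrt (INR q * INR (Nat.gcd a q) ^ 2)).
    + apply sqrt_le_1_alt. eapply Rle_trans; [apply HG|]. apply Rmult_le_compat_l; nra.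
    + rewrite sqrt_mult_alt by lra. rewrite sqrt_pow2 by lra. lra.
  - rewrite Rsum1_scal. right. rewrite <- Rmult_assoc. f_equal.
    rewrite <- (sqrt_sqrt (INR q)) at 1 by lra. field. lra.
Qed.

End DirichletCharacter.

(** * The divisor bound and harmonic sums *)

Definition tau (n : nat) : nat := length (filter (fun d => Nat.eqb (n mod d) 0) (seq 1 n)).

Lemma in_divisors n d : (0 < n)%nat ->
  In d (filter (fun d => Nat.eqb (n mod d) 0) (seq 1 n)) <-> Nat.divide d n.
Proof.
  intros Hn. rewrite filter_In, in_seq, Nat.eqb_eq. split.
  - intros [Hd E]. apply Nat.Lcm0.mod_divide; auto.
  - intros Hd. pose proof (Nat.divide_pos_le d n Hn Hd).
    assert (d <> 0)%nat by (intros ->; destruct Hd; lia).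
    split; [lia|]. now apply Nat.Lcm0.mod_divide.
Qed.

Lemma divide_prime_power_mul p a m d : (forall d, Nat.divide d p -> d = 1%nat \/ d = p) ->
  (0 < p)%nat -> Nat.divide d (p ^ a * m) ->
  exists i d', (i <= a)%nat /\ Nat.divide d' m /\ d = (p ^ i * d')%nat.
Proof.
  intros Hp Hp0. revert d. induction a; intros d Hd.
  - exists 0%nat, d. rewrite Nat.pow_0_r, Nat.mul_1_l in *. auto.
  - rewrite Nat.pow_succ_r', <- Nat.mul_assoc in Hd.
    destruct (Hp (Nat.gcd d p) (Nat.gcd_divide_r d p)) as [H|H].
    + apply Nat.gauss in Hd; auto. destruct (IHa d Hd) as (i & d' & Hi & Hd' & E).
      exists i, d'. auto.
    + destruct (Nat.gcd_divide_l d p) as [d1 Hd1]. rewrite H in Hd1. subst d.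
      rewrite (Nat.mul_comm d1) in Hd. apply Nat.mul_divide_cancel_l in Hd; [|lia].
      destruct (IHa d1 Hd) as (i & d' & Hi & Hd' & E).
      exists (S i), d'. split; [lia|split; auto]. rewrite Nat.pow_succ_r', E. lia.
Qed.

(** Every divisor is a product [p^i d'] with [i <= a] and [d'] dividing [m]; a list of all such
    products, possibly with repetitions, suffices for an upper bound. *)
Lemma tau_prime_power_mul p a m : (forall d, Nat.divide d p -> d = 1%nat \/ d = p) ->
  (0 < p)%nat -> (0 < m)%nat -> (tau (p ^ a * m) <= (a + 1) * tau m)%nat.
Proof.
  intros Hp Hp0 Hm. unfold tau.
  assert (Hn : (0 < p ^ a * m)%nat).
  { assert (p ^ a <> 0)%nat by (apply Nat.pow_nonzero; lia). lia. }
  set (L := filter (fun d => Nat.eqb (m mod d) 0) (seq 1 m)).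
  replace ((a + 1) * length L)%nat with
    (length (map (fun x => p ^ fst x * snd x)%nat (list_prod (seq 0 (a + 1)) L)))
    by (now rewrite length_map, length_prod, length_seq).
  apply NoDup_incl_length.
  - apply NoDup_filter, seq_NoDup.
  - intros d Hd. apply in_divisors in Hd; auto.
    destruct (divide_prime_power_mul p a m d Hp Hp0 Hd) as (i & d' & Hi & Hd' & E).
    apply in_map_iff. exists (i, d'). split; [now rewrite E|].
    apply in_prod; [apply in_seq; lia|]. now apply in_divisors.
Qed.

Lemma least_divisor n : (2 <= n)%nat -> exists p, (2 <= p)%nat /\ Nat.divide p n /\
  forall d, (2 <= d)%nat -> Nat.divide d n -> (p <= d)%nat.
Proof.
  intros Hn.
  destruct (dec_inh_nat_subset_has_unique_least_element (fun d => (2 <= d)%nat /\ Nat.divide d n))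
    as (p & [[H1 H2] H3] & _).
  - intros d. apply classic.
  - exists n. split; auto. apply Nat.divide_refl.
  - exists p. split; auto.
Qed.

Lemma extract_power p n : (2 <= p)%nat -> (0 < n)%nat ->
  exists a m, n = (p ^ a * m)%nat /\ ~ Nat.divide p m.
Proof.
  intros Hp. induction n as [n IH] using lt_wf_ind. intros Hn.
  destruct (classic (Nat.divide p n)) as [[k Hk]|H].
  - destruct (IH k) as (a & m & E & Hm); [nia|destruct k; lia|].
    exists (S a), m. split; auto. rewrite Nat.pow_succ_r'. lia.
  - exists 0%nat, n. split; auto. rewrite Nat.pow_0_r. lia.
Qed.

Lemma Rpower_pow_base p eps a : (0 < p)%nat ->
  Rpower (INR (p ^ a)) eps = Rpower (INR p) eps ^ a.
Proof.
  intros Hp. assert (0 < INR p) by (apply lt_0_INR; lia).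
  rewrite pow_INR, <- (Rpower_pow a (INR p)), <- (Rpower_pow a (Rpower (INR p) eps)), !Rpower_mult;
    auto; [|apply exp_pos]. f_equal. ring.
Qed.

(** [tau n / n^eps] is controlled one prime at a time: [(a + 1) / p^(a eps)] is at most 1 once
    [p^eps >= 2], and at most [C0] for the finitely many smaller primes. *)
Lemma tau_bound eps : 0 < eps -> exists K, 0 < K /\
  forall n, (0 < n)%nat -> INR (tau n) <= K * Rpower (INR n) eps.
Proof.
  intros He.
  set (t := eps * ln 2). assert (Hln : 0 < ln 2) by (rewrite <- ln_1; apply ln_increasing; lra).
  assert (Ht : 0 < t) by (apply Rmult_lt_0_compat; auto).
  (* Chosen so that [a + 1 <= C0 (1 + a t) <= C0 exp (a t)], where [exp (a t) = 2^(a eps)]. *)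
  set (C0 := / t + 1). assert (HC0 : 1 <= C0) by (unfold C0; pose proof (Rinv_0_lt_compat t Ht); lra).
  destruct (INR_unbounded (Rpower 2 (/ eps))) as [P0 HP0].
  assert (Hlarge : forall p a, (P0 <= p)%nat -> (0 < p)%nat -> INR (a + 1) <= Rpower (INR p) eps ^ a).
  { intros p a Hp Hp0. assert (H2 : 2 <= Rpower (INR p) eps).
    { apply Rle_trans with (Rpower (Rpower 2 (/ eps)) eps).
      - rewrite Rpower_mult, Rinv_l, Rpower_1; lra.
      - apply Rle_Rpower_l; [lra|]. split; [apply exp_pos|].
        assert (INR P0 <= INR p) by now apply le_INR. lra. }
    apply Rle_trans with (2 ^ a); [|apply pow_incr; lra].
    clear. rewrite plus_INR. simpl (INR 1). induction a; [simpl; lra|].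
    rewrite S_INR. simpl. pose proof (pos_INR a). lra. }
  assert (Hsmall : forall p a, (2 <= p)%nat -> INR (a + 1) <= C0 * Rpower (INR p) eps ^ a).
  { intros p a Hp. assert (Hp2 : 2 <= INR p) by (apply (le_INR 2); auto).
    apply Rle_trans with (C0 * exp (INR a * t)).
    - assert (1 + INR a * t <= exp (INR a * t)).
      { destruct (Req_dec (INR a * t) 0) as [->|Hne]; [rewrite exp_0; lra|].
        left. now apply exp_ineq1. }
      apply Rle_trans with (C0 * (1 + INR a * t)); [|apply Rmult_le_compat_l; lra].
      rewrite plus_INR. simpl (INR 1). unfold C0. pose proof (pos_INR a).
      pose proof (Rinv_0_lt_compat t Ht).
      replace ((/ t + 1) * (1 + INR a * t)) with (/ t + INR a + 1 + INR a * t) by (field; lra).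
      assert (0 <= INR a * t) by (apply Rmult_le_pos; lra). lra.
    - apply Rmult_le_compat_l; [lra|].
      replace (exp (INR a * t)) with (Rpower 2 eps ^ a).
      + apply pow_incr. split; [left; apply exp_pos|]. apply Rle_Rpower_l; lra.
      + rewrite <- Rpower_pow by apply exp_pos. rewrite Rpower_mult. unfold Rpower, t.
        f_equal. ring. }
  (* Here [k] bounds the nontrivial divisors from below, and the truncated [P0 - k] counts the small
     candidates left. Removing the full power of the least divisor [p] raises [k] to [S p], so each
     small prime is charged at most one factor [C0]. *)
  assert (Main : forall n, (0 < n)%nat -> forall k,
    (forall d, (2 <= d)%nat -> Nat.divide d n -> (k <= d)%nat) ->
    INR (tau n) <= C0 ^ (P0 - k) * Rpower (INR n) eps).
  { intros n. induction n as [n IH] using lt_wf_ind. intros Hn k Hk.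
    destruct (Nat.eq_dec n 1) as [->|Hn1].
    - change (tau 1) with 1%nat. simpl INR. unfold Rpower; rewrite ln_1, Rmult_0_r, exp_0.
      pose proof (pow_R1_Rle C0 (P0 - k) HC0). lra.
    - destruct (least_divisor n) as (p & Hp2 & Hpn & Hpmin); [lia|].
      assert (Hpp : forall d, Nat.divide d p -> d = 1%nat \/ d = p).
      { intros d Hd. assert (Hdn : Nat.divide d n) by (eapply Nat.divide_trans; eauto).
        assert (d <= p)%nat by (apply Nat.divide_pos_le; auto; lia).
        assert (d <> 0)%nat by (intros ->; destruct Hd; lia).
        destruct (Nat.eq_dec d 1); [now left|right]. specialize (Hpmin d ltac:(lia) Hdn). lia. }
      destruct (extract_power p n Hp2 Hn) as (a & m & E & Hm).
      assert (Ha : a <> 0%nat).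
      { intros ->. rewrite Nat.pow_0_r, Nat.mul_1_l in E. now subst m. }
      assert (Hm0 : (0 < m)%nat) by (destruct m; lia).
      assert (Hpa : (2 <= p ^ a)%nat).
      { destruct a; [lia|]. rewrite Nat.pow_succ_r'.
        assert (p ^ a <> 0)%nat by (apply Nat.pow_nonzero; lia). nia. }
      specialize (IH m ltac:(nia) Hm0 (S p)).
      assert (IH' : INR (tau m) <= C0 ^ (P0 - S p) * Rpower (INR m) eps).
      { apply IH. intros d Hd Hdm.
        assert (Hdn : Nat.divide d n) by (subst n; now apply Nat.divide_mul_r).
        specialize (Hpmin d Hd Hdn). destruct (Nat.eq_dec p d); [subst; contradiction|lia]. }
      clear IH. assert (Hkp : (k <= p)%nat) by (apply Hk; auto).
      assert (Hpa0 : 0 < Rpower (INR p) eps ^ a) by (apply pow_lt, exp_pos).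
      assert (Hfac : INR (a + 1) * C0 ^ (P0 - S p) <= C0 ^ (P0 - k) * Rpower (INR p) eps ^ a).
      { destruct (Nat.le_gt_cases P0 p) as [H|H].
        - replace (P0 - S p)%nat with 0%nat by lia. rewrite pow_O, Rmult_1_r.
          pose proof (Hlarge p a H ltac:(lia)). pose proof (pow_R1_Rle C0 (P0 - k) HC0). nra.
        - apply Rle_trans with (C0 ^ (P0 - p) * Rpower (INR p) eps ^ a).
          + replace (P0 - p)%nat with (S (P0 - S p)) by lia. simpl.
            pose proof (Hsmall p a Hp2). pose proof (pow_R1_Rle C0 (P0 - S p) HC0). nra.
          + apply Rmult_le_compat_r; [lra|]. apply Rle_pow; [auto|lia]. }
      pose proof (le_INR _ _ (tau_prime_power_mul p a m Hpp ltac:(lia) Hm0)) as HT.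
      rewrite <- E, mult_INR in HT.
      assert (HR : Rpower (INR n) eps = Rpower (INR p) eps ^ a * Rpower (INR m) eps).
      { rewrite E, mult_INR, <- Rpower_mult_distr, Rpower_pow_base by (try apply lt_0_INR; lia).
        reflexivity. }
      rewrite HR. eapply Rle_trans; [apply HT|].
      assert (0 < Rpower (INR m) eps) by apply exp_pos. pose proof (pos_INR (a + 1)). nra. }
  exists (C0 ^ P0). split; [apply pow_lt; lra|]. intros n Hn.
  rewrite <- (Nat.sub_0_r P0). apply Main; auto. intros; lia.
Qed.

Definition harm (n : nat) : R := Rsum1 (fun k => / INR k) n.

Lemma harm_mono n m : (n <= m)%nat -> harm n <= harm m.
Proof.
  intros H. unfold harm. replace m with (n + (m - n))%nat by lia. rewrite Rsum1_add.
  assert (0 <= Rsum1 (fun k => / INR (n + k)) (m - n)).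
  { apply Rsum1_nonneg. intros k Hk. left. apply Rinv_0_lt_compat, lt_0_INR. lia. }
  lra.
Qed.

Lemma harm_log n : (0 < n)%nat -> harm n <= 1 + ln (INR n).
Proof.
  unfold harm. induction n; intros Hn; [lia|]. destruct n as [|n].
  - simpl. rewrite ln_1. lra.
  - specialize (IHn ltac:(lia)). cbn [Rsum1] in *.
    assert (H0 : 0 < INR (S n)) by (apply lt_0_INR; lia).
    assert (H1 : INR (S (S n)) = INR (S n) + 1) by apply S_INR.
    assert (/ INR (S (S n)) <= ln (INR (S (S n))) - ln (INR (S n))); [|lra].
    rewrite <- ln_div by lra. rewrite <- (ln_exp (/ INR (S (S n)))).
    assert (Hexp : exp (/ INR (S (S n))) <= INR (S (S n)) / INR (S n)).
    { replace (INR (S (S n)) / INR (S n)) with (/ (1 - / INR (S (S n))))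
        by (rewrite H1; field; lra).
      rewrite <- (Rinv_inv (exp _)), <- exp_Ropp. apply Rinv_le_contravar.
      - rewrite H1. assert (/ (INR (S n) + 1) < 1); [|lra].
        rewrite <- Rinv_1 at 2. apply Rinv_lt_contravar; lra.
      - assert (Hne : - / INR (S (S n)) <> 0).
        { assert (0 < / INR (S (S n))) by (apply Rinv_0_lt_compat; lra). lra. }
        pose proof (exp_ineq1 _ Hne). lra. }
    destruct Hexp as [Hlt|Heq]; [left; apply ln_increasing; auto; apply exp_pos|].
    rewrite Heq. lra.
Qed.

Lemma harm_bound eps n : 0 < eps -> (0 < n)%nat -> harm n <= (1 + / eps) * Rpower (INR n) eps.
Proof.
  intros He Hn. eapply Rle_trans; [now apply harm_log|].
  assert (Hn1 : 1 <= INR n) by (apply (le_INR 1); lia).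
  assert (Hl : 0 <= ln (INR n)) by (rewrite <- ln_1; destruct Hn1 as [|<-]; [left; apply ln_increasing; lra|lra]).
  assert (1 + eps * ln (INR n) <= Rpower (INR n) eps).
  { unfold Rpower. destruct (Req_dec (eps * ln (INR n)) 0) as [->|Hne]; [rewrite exp_0; lra|].
    left. now apply exp_ineq1. }
  pose proof (Rinv_0_lt_compat eps He).
  apply Rle_trans with ((1 + / eps) * (1 + eps * ln (INR n))); [|apply Rmult_le_compat_l; lra].
  replace ((1 + / eps) * (1 + eps * ln (INR n))) with
    (1 + / eps + eps * ln (INR n) + ln (INR n)) by (field; lra).
  assert (0 <= eps * ln (INR n)) by (apply Rmult_le_pos; lra). lra.
Qed.

(** * Sums of the geometric weights and the progression bound *)

Lemma ez_weight_nonneg Q n : (0 < Q)%nat -> 0 <= ez_weight Q n.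
Proof.
  intros HQ. unfold ez_weight. destruct (Nat.eqb_spec (n mod Q) 0); [lra|].
  pose proof (Nat.mod_upper_bound n Q ltac:(lia)).
  destruct (inv_one_minus_ez_le Q (n mod Q)) as [H0 _]; try lia.
  rewrite <- ez_mod in H0 by auto. apply Rdiv_le_0_compat; lra.
Qed.

Lemma ez_weight_sum P : (0 < P)%nat -> Rsum1 (ez_weight P) P <= 2 * INR P * harm P.
Proof.
  intros HP. destruct P as [|N]; [lia|]. cbn [Rsum1].
  unfold ez_weight at 2. rewrite Nat.Div0.mod_same, Nat.eqb_refl.
  assert (H : Rsum1 (ez_weight (S N)) N <=
    Rsum1 (fun v => INR (S N) * / INR v + INR (S N) * / INR (S N - v)) N).
  { apply Rsum1_le. intros v Hv. unfold ez_weight. rewrite Nat.mod_small by lia.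
    destruct (Nat.eqb_spec v 0); [lia|]. apply inv_one_minus_ez_le; lia. }
  rewrite Rsum1_plus, !Rsum1_scal, (Rsum1_rev (fun v => / INR v) N) in H.
  fold (harm N) in H. pose proof (harm_mono N (S N) ltac:(lia)). pose proof (pos_INR (S N)). nra.
Qed.

(** Multiplication by [l] covers the multiples of [g], each [g] times, and the weight at [g v]
    modulo [Q] is the weight at [v] modulo [P = Q / g]. The product [g P] restores [Q], so the bound
    does not depend on [l]. *)
Lemma ez_weight_dilate_sum Q l : (0 < Q)%nat ->
  Rsum1 (fun c => ez_weight Q (l * c)) Q <= 2 * INR Q * harm Q.
Proof.
  intros HQ. set (g := Nat.gcd l Q).
  destruct (Nat.gcd_divide_r l Q) as [P HP]. fold g in HP.
  assert (Hg : (0 < g)%nat) by (destruct g; lia).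
  assert (HP0 : (0 < P)%nat) by (destruct P; lia).
  rewrite Nat.mul_comm in HP.
  assert (E : Rsum1 (fun c => ez_weight Q (l * c)) Q = INR g * Rsum1 (fun v => ez_weight Q (g * v)) P).
  { pose proof (Rsum1_dilate (ez_weight Q) l g P HP0 Hg) as D. rewrite <- HP in D. apply D.
    - reflexivity.
    - intros n. unfold ez_weight.
      replace (n + Q)%nat with (n + 1 * Q)%nat by lia. rewrite Nat.Div0.mod_add.
      now rewrite Nat.mul_1_l, ez_periodic. }
  rewrite E, (Rsum1_ext _ (ez_weight P)).
  - assert (HPQ : (P <= Q)%nat) by nia.
    pose proof (ez_weight_sum P HP0). pose proof (harm_mono P Q HPQ).
    rewrite HP at 1. rewrite mult_INR. pose proof (pos_INR g). pose proof (pos_INR P).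
    apply Rle_trans with (INR g * (2 * INR P * harm Q)); [|lra].
    apply Rmult_le_compat_l; auto. nra.
  - intros v _. unfold ez_weight. rewrite HP, Nat.Div0.mul_mod_distr_l, ez_scale by auto.
    destruct (Nat.eqb_spec (v mod P) 0) as [H0|H0].
    + now rewrite H0, Nat.mul_0_r.
    + destruct (Nat.eqb_spec (g * (v mod P)) 0) as [H1|H1]; [nia|reflexivity].
Qed.

(** The gcd is one of the common divisors [d] of [a] and [q], so it is at most their sum. After
    exchanging the sums, [a = d c] lowers the modulus to [q / d] and the factor [d] restores [q]:
    every divisor contributes the same bound. *)
Lemma gcd_weight_sum q l : (0 < q)%nat ->
  Rsum1 (fun a => INR (Nat.gcd a q) * ez_weight q (a * l)) q <=
  INR (tau q) * (2 * INR q * harm q).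
Proof.
  intros Hq.
  set (t := fun d a => (if Nat.eqb (q mod d) 0 then INR d else 0) *
                       (if Nat.eqb (a mod d) 0 then ez_weight q (a * l) else 0)).
  assert (Ht : forall d a, 0 <= t d a).
  { intros d a. unfold t. pose proof (pos_INR d). pose proof (ez_weight_nonneg q (a * l) Hq).
    destruct (Nat.eqb _ _); destruct (Nat.eqb _ _); nra. }
  apply Rle_trans with (Rsum1 (fun a => Rsum1 (fun d => t d a) q) q).
  - apply Rsum1_le. intros a Ha.
    replace (INR (Nat.gcd a q) * ez_weight q (a * l)) with (t (Nat.gcd a q) a).
    + apply (Rsum1_term_le (fun d => t d a)); auto. split.
      * destruct (Nat.gcd a q) eqn:E0; [apply Nat.gcd_eq_0 in E0|]; lia.
      * apply Nat.divide_pos_le; auto. apply Nat.gcd_divide_r.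
    + unfold t.
      rewrite (proj2 (Nat.Lcm0.mod_divide q (Nat.gcd a q)) (Nat.gcd_divide_r a q)).
      rewrite (proj2 (Nat.Lcm0.mod_divide a (Nat.gcd a q)) (Nat.gcd_divide_l a q)).
      now rewrite Nat.eqb_refl.
  - rewrite Rsum1_exchange.
    assert (Etau : forall (p : nat -> bool) N, Rsum1 (fun d => if p d then 1 else 0) N =
      INR (length (filter p (seq 1 N)))).
    { intros p N. induction N; [reflexivity|]. cbn [Rsum1].
      rewrite IHN, seq_S, filter_app, length_app, plus_INR. simpl.
      destruct (p (S N)); simpl; ring. }
    unfold tau. rewrite <- Etau, Rmult_comm, <- Rsum1_scal. apply Rsum1_le. intros d Hd.
    unfold t. rewrite Rsum1_scal. destruct (Nat.eqb_spec (q mod d) 0) as [H0|H0]; [|lra].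
    apply Nat.Lcm0.mod_divide in H0. destruct H0 as [Q HQ].
    rewrite Nat.mul_comm in HQ.
    assert (HQ0 : (0 < Q)%nat) by (destruct Q; lia).
    rewrite HQ at 1. rewrite (Rsum1_blocks (fun a => ez_weight q (a * l))) by lia.
    rewrite (Rsum1_ext _ (fun c => ez_weight Q (l * c))).
    + assert (HPQ : (Q <= q)%nat) by nia.
      pose proof (ez_weight_dilate_sum Q l HQ0). pose proof (harm_mono Q q HPQ).
      rewrite HQ at 1. rewrite mult_INR. pose proof (pos_INR d). pose proof (pos_INR Q).
      apply Rle_trans with (INR d * (2 * INR Q * harm q)); [|lra].
      apply Rmult_le_compat_l; auto. nra.
    + intros c _. unfold ez_weight.
      replace (d * c * l)%nat with (d * (l * c))%nat by lia.
      rewrite HQ, Nat.Div0.mul_mod_distr_l, ez_scale by lia.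
      destruct (Nat.eqb_spec ((l * c) mod Q) 0) as [E0|E0].
      * now rewrite E0, Nat.mul_0_r.
      * destruct (Nat.eqb_spec (d * ((l * c) mod Q)) 0) as [E1|E1]; [nia|reflexivity].
Qed.

(** Half of [eps] pays for the divisor function, half for the harmonic sum. [K >= 1] keeps the bound
    at least 1, as the later partial summation requires. *)
Lemma char_progression_bound eps : 0 < eps -> exists K, 1 <= K /\
  forall q chi, is_dirichlet_char q chi -> forall b l N,
  let f := fun n => chi (b + n * l)%nat in
  Cmod (Csum1 (fun n => Cminus (f n) (mean f q)) N) <= K * Rpower (INR q) (1 / 2 + eps).
Proof.
  intros He.
  destruct (tau_bound (eps / 2)) as (K1 & HK1 & Ht); [lra|].
  set (K2 := 1 + / (eps / 2)).
  assert (HK2 : 1 <= K2) by (unfold K2; assert (0 < / (eps / 2)) by (apply Rinv_0_lt_compat; lra); lra).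
  exists (2 * K1 * K2 + 1). split; [nra|]. intros q chi Hchi b l N f.
  pose proof (dc_q_pos _ _ Hchi) as Hq.
  assert (HqR : 0 < INR q) by (apply lt_0_INR; lia).
  assert (Hsq : 0 < sqrt (INR q)) by now apply sqrt_lt_R0.
  eapply Rle_trans; [apply (char_progression_completion q chi Hchi)|].
  eapply Rle_trans; [apply Rmult_le_compat_l; [left; now apply Rinv_0_lt_compat|now apply gcd_weight_sum]|].
  set (T := Rpower (INR q) (eps / 2)). assert (HT : 0 < T) by apply exp_pos.
  assert (E1 : INR (tau q) <= K1 * T) by now apply Ht.
  assert (E2 : harm q <= K2 * T) by (apply harm_bound; auto; lra).
  assert (E3 : Rpower (INR q) (1 / 2 + eps) = sqrt (INR q) * (T * T)).
  { unfold T. rewrite <- !Rpower_plus, <- Rpower_half, <- Rpower_plus by auto. f_equal. lra. }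
  assert (H0 : 0 <= harm q) by (apply (harm_mono 0 q); lia).
  replace (/ sqrt (INR q) * (INR (tau q) * (2 * INR q * harm q))) with
    (2 * sqrt (INR q) * (INR (tau q) * harm q)).
  - rewrite E3.
    assert (E4 : INR (tau q) * harm q <= (K1 * T) * (K2 * T))
      by (apply Rmult_le_compat; auto using pos_INR).
    assert (0 < T * T) by nra.
    apply Rle_trans with (2 * sqrt (INR q) * ((K1 * T) * (K2 * T))).
    + apply Rmult_le_compat_l; lra.
    + replace ((2 * K1 * K2 + 1) * (sqrt (INR q) * (T * T))) with
        (2 * sqrt (INR q) * (K1 * T * (K2 * T)) + sqrt (INR q) * (T * T)) by ring. nra.
  - rewrite <- (sqrt_sqrt (INR q)) at 3 by lra. field. lra.
Qed.

(** * The moment formula *)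

(** Partial summation returns the square root of the progression bound, so the exponent
    [1 / 2 + 2 eps] becomes [1 / 4 + eps]. *)
Lemma L_half_convexity eps : 0 < eps -> exists K, 0 < K /\
  forall q chi, is_dirichlet_char q chi -> forall b l F, (1 <= b)%nat -> (b < l)%nat ->
  is_L_continuation chi b l F ->
  Cmod (Cminus (F (RtoC (1 / 2))) (Cmult (chi b) (RtoC (/ sqrt (INR b / INR l)))))
    <= K * Rpower (INR q) (1 / 4 + eps).
Proof.
  intros He. destruct (char_progression_bound (2 * eps)) as (K & HK & H); [lra|].
  exists (14 * sqrt K). split; [apply Rmult_lt_0_compat; [lra|apply sqrt_lt_R0; lra]|].
  intros q chi Hchi b l F Hb Hl HF.
  pose proof (dc_q_pos _ _ Hchi) as Hq.
  assert (Hq1 : 1 <= INR q) by (apply (le_INR 1); lia).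
  assert (HR : 1 <= Rpower (INR q) (1 / 2 + 2 * eps)).
  { apply Rle_trans with (Rpower (INR q) 0); [rewrite Rpower_O; lra|apply Rle_Rpower; lra]. }
  assert (HB : 1 <= K * Rpower (INR q) (1 / 2 + 2 * eps)) by nra.
  eapply Rle_trans.
  - apply (L_half_approx chi b l q F (K * Rpower (INR q) (1 / 2 + 2 * eps)) Hb Hl Hq
      (dc_periodic _ _ Hchi) (char_Cmod_le_1 q chi Hchi) HF HB).
    intros N. apply (H q chi Hchi b l N).
  - rewrite sqrt_mult_alt by lra. rewrite Rmult_assoc. right. do 2 f_equal.
    rewrite <- Rpower_half, Rpower_mult by apply exp_pos. f_equal. lra.
Qed.

(** One factor is replaced at a time; the bound on the perturbed product is carried along because
    the induction step multiplies by it. *)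
Lemma Cprod1_perturb (a A : nat -> C) (X E : R) (m : nat) : 0 <= X -> 0 <= E ->
  (forall i, (1 <= i <= m)%nat -> Cmod (a i) <= X) ->
  (forall i, (1 <= i <= m)%nat -> Cmod (Cminus (A i) (a i)) <= E) ->
  Cmod (Cprod1 A m) <= (X + E) ^ m /\
  Cmod (Cminus (Cprod1 A m) (Cprod1 a m)) <= (X + E) ^ m - X ^ m.
Proof.
  intros HX HE. induction m; intros Ha HA.
  - simpl. rewrite Cmod_1. replace (Cminus (RtoC 1) (RtoC 1)) with (RtoC 0) by ring.
    rewrite Cmod_0. lra.
  - destruct IHm as [I1 I2]; [intros; apply Ha; lia|intros; apply HA; lia|].
    specialize (Ha (S m) ltac:(lia)). specialize (HA (S m) ltac:(lia)).
    assert (HAm : Cmod (A (S m)) <= X + E).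
    { eapply Rle_trans; [apply (Cmod_le_sub _ (a (S m)))|]. lra. }
    assert (P1 : 0 <= (X + E) ^ m) by (apply pow_le; lra).
    cbn [Cprod1 pow]. split.
    + rewrite Cmod_mult, Rmult_comm. apply Rmult_le_compat; auto using Cmod_ge_0.
    + replace (Cminus _ _) with
        (Cplus (Cmult (Cprod1 A m) (Cminus (A (S m)) (a (S m))))
               (Cmult (Cminus (Cprod1 A m) (Cprod1 a m)) (a (S m)))) by ring.
      eapply Rle_trans; [apply Cmod_triangle|]. rewrite !Cmod_mult.
      assert (Cmod (Cprod1 A m) * Cmod (Cminus (A (S m)) (a (S m))) <= (X + E) ^ m * E)
        by (apply Rmult_le_compat; auto using Cmod_ge_0).
      assert (Cmod (Cminus (Cprod1 A m) (Cprod1 a m)) * Cmod (a (S m)) <= ((X + E) ^ m - X ^ m) * X)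
        by (apply Rmult_le_compat; auto using Cmod_ge_0).
      lra.
Qed.

(** The difference is at most [m E (X + E)^(m-1)], and [(X + E)^n <= 2^n (X^n + E^n)] by comparison
    with the larger of [X] and [E]. *)
Lemma pow_add_le (X E : R) (m : nat) : 0 <= X -> 0 <= E -> (1 <= m)%nat ->
  (X + E) ^ m - X ^ m <= INR m * 2 ^ (m - 1) * (E * X ^ (m - 1) + E ^ m).
Proof.
  intros HX HE Hm. destruct m as [|k]; [lia|]. clear Hm.
  replace (S k - 1)%nat with k by lia.
  assert (H1 : forall n, (X + E) ^ n <= 2 ^ n * (X ^ n + E ^ n)).
  { intros n. rewrite Rmult_plus_distr_l, <- !Rpow_mult_distr.
    assert (0 <= (2 * X) ^ n) by (apply pow_le; lra).
    assert (0 <= (2 * E) ^ n) by (apply pow_le; lra).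
    destruct (Rle_dec X E).
    - assert ((X + E) ^ n <= (2 * E) ^ n) by (apply pow_incr; lra). lra.
    - assert ((X + E) ^ n <= (2 * X) ^ n) by (apply pow_incr; lra). lra. }
  assert (H2 : forall n, (X + E) ^ S n - X ^ S n <= INR (S n) * E * (X + E) ^ n).
  { induction n; [simpl; lra|].
    rewrite (S_INR (S n)).
    assert (X ^ S n <= (X + E) ^ S n) by (apply pow_incr; lra).
    assert (0 <= (X + E) ^ n) by (apply pow_le; lra).
    assert (0 <= INR (S n) * E * (X + E) ^ n * E).
    { repeat apply Rmult_le_pos; auto. apply pos_INR. }
    change ((X + E) ^ S (S n)) with ((X + E) * (X + E) ^ S n).
    change (X ^ S (S n)) with (X * X ^ S n).
    replace ((X + E) * (X + E) ^ S n - X * X ^ S n) with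
      (X * ((X + E) ^ S n - X ^ S n) + E * (X + E) ^ S n) by ring.
    apply Rle_trans with (X * (INR (S n) * E * (X + E) ^ n) + E * (X + E) ^ S n).
    - apply Rplus_le_compat_r, Rmult_le_compat_l; auto.
    - replace ((INR (S n) + 1) * E * (X + E) ^ S n) with
        (X * (INR (S n) * E * (X + E) ^ n) + INR (S n) * E * (X + E) ^ n * E + E * (X + E) ^ S n)
        by (simpl pow; ring).
      lra. }
  eapply Rle_trans; [apply H2|].
  replace (INR (S k) * 2 ^ k * (E * X ^ k + E ^ S k)) with
    (INR (S k) * E * (2 ^ k * (X ^ k + E ^ k))) by (simpl pow; ring).
  apply Rmult_le_compat_l; auto. apply Rmult_le_pos; auto. apply pos_INR.
Qed.

Lemma natmax1_ge f m i : (1 <= i <= m)%nat -> (f i <= natmax1 f m)%nat.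
Proof.
  induction m; intros Hi; [lia|]. simpl. destruct (Nat.eq_dec i (S m)) as [->|]; [lia|].
  specialize (IHm ltac:(lia)). lia.
Qed.

Lemma Cprod1_le_1 (f : nat -> C) m : (forall i, (1 <= i <= m)%nat -> Cmod (f i) <= 1) ->
  Cmod (Cprod1 f m) <= 1.
Proof.
  induction m; intros H; simpl; [rewrite Cmod_1; lra|].
  rewrite Cmod_mult. pose proof (H (S m) ltac:(lia)).
  assert (Cmod (Cprod1 f m) <= 1) by (apply IHm; intros; apply H; lia).
  pose proof (Cmod_ge_0 (Cprod1 f m)). pose proof (Cmod_ge_0 (f (S m))). nra.
Qed.

Lemma Cprod1_scal (f : nat -> C) (x : R) m :
  Cprod1 (fun i => Cmult (f i) (RtoC x)) m = Cmult (Cprod1 f m) (RtoC (x ^ m)).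
Proof.
  induction m; simpl; [ring|]. rewrite IHm, RtoC_mult. ring.
Qed.

Lemma inv_sqrt_ratio_pow b l m : (1 <= b)%nat -> (b < l)%nat ->
  (/ sqrt (INR b / INR l)) ^ m = Rpower (INR l) (INR m / 2) * Rpower (INR b) (- (INR m / 2)).
Proof.
  intros Hb Hl. assert (Hb0 : 0 < INR b) by (apply lt_0_INR; lia).
  assert (Hl0 : 0 < INR l) by (apply lt_0_INR; lia).
  assert (Hx : 0 < INR b / INR l) by now apply Rdiv_lt_0_compat.
  rewrite <- Rpower_minus_half by auto. rewrite <- Rpower_pow by apply exp_pos.
  rewrite Rpower_mult. unfold Rpower. rewrite <- exp_plus, ln_div by auto. f_equal. field.
Qed.

(** The first term is kept apart because the telescoping bound needs an index of at least 2; the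
    rest costs the factor [1 / (r - 1) <= 2]. *)
Lemma Rpower_tail (r : R) (l k : nat) : 3 / 2 <= r -> (1 <= l)%nat ->
  Rsum1 (fun n => Rpower (INR (l - 1 + n)) (- r)) k <= 3 * Rpower (INR l) (1 - r).
Proof.
  intros Hr Hl.
  assert (Hl1 : 1 <= INR l) by (apply (le_INR 1); auto).
  assert (P : forall x, 0 < Rpower x (1 - r)) by (intros; apply exp_pos).
  destruct k as [|k]; [simpl; specialize (P (INR l)); lra|].
  assert (H : Rsum1 (fun n => Rpower (INR (l - 1 + n)) (- r)) (S k) <=
    Rpower (INR l) (- r) + 2 * (Rpower (INR l) (1 - r) - Rpower (INR (l + k)) (1 - r))).
  { induction k.
    - cbn [Rsum1]. replace (l - 1 + 1)%nat with l by lia. rewrite Nat.add_0_r. lra.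
    - cbn [Rsum1] in *. pose proof (Rpower_telescope (r - 1) (l + S k) ltac:(lra) ltac:(lia)) as T.
      replace (- (r - 1) - 1) with (- r) in T by ring. replace (- (r - 1)) with (1 - r) in T by ring.
      replace (l + S k - 1)%nat with (l + k)%nat in T by lia.
      replace (l - 1 + S (S k))%nat with (l + S k)%nat by lia.
      assert (P0 : 0 < Rpower (INR (l + S k)) (- r)) by apply exp_pos. nra. }
  assert (Rpower (INR l) (- r) <= Rpower (INR l) (1 - r)) by (apply Rle_Rpower; lra).
  specialize (P (INR (l + k))). lra.
Qed.

(** The cut at [l - 1] is the range of [b]. A far partial sum stands in for [L], at the cost of an
    arbitrary [e]. *)
Lemma series_head_error (c : nat -> C) (r : R) (l : nat) (L : C) :
  3 / 2 <= r -> (1 <= l)%nat -> (forall n, Cmod (c n) <= 1) ->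
  is_series (V := C_NormedModule) (L_term c (RtoC r)) L ->
  Cmod (Cminus (Csum1 (fun n => Cmult (c n) (RtoC (Rpower (INR n) (- r)))) (l - 1)) L)
    <= 3 * Rpower (INR l) (1 - r).
Proof.
  intros Hr Hl Hc HL. apply le_epsilon. intros e He.
  destruct (is_series_C_partial _ _ HL e He) as [N HN]. specialize (HN (l + N)%nat ltac:(lia)).
  rewrite sum_n_Csum1 in HN.
  rewrite (Csum1_ext _ (fun n => Cmult (c n) (RtoC (Rpower (INR n) (- r))))) in HN.
  2: { intros n Hn. unfold L_term. replace (pred n + 1)%nat with n by lia.
       now rewrite cpow_pw, <- RtoC_opp, pw_real. }
  replace (S (l + N)) with (l - 1 + (N + 2))%nat in HN by lia.
  eapply Rle_trans; [eapply Cmod_sub_triangle|]. apply Rplus_le_compat; [|exact HN].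
  rewrite Csum1_add.
  replace (Cminus _ _) with
    (Copp (Csum1 (fun n => Cmult (c (l - 1 + n)%nat) (RtoC (Rpower (INR (l - 1 + n)) (- r)))) (N + 2)))
    by ring.
  rewrite Cmod_opp. eapply Rle_trans; [|apply Rpower_tail; eauto].
  apply Cmod_Csum1_le. intros n _. rewrite Cmod_mult, Cmod_R.
  assert (0 < Rpower (INR (l - 1 + n)) (- r)) by apply exp_pos.
  rewrite Rabs_pos_eq by lra. specialize (Hc (l - 1 + n)%nat). nra.
Qed.

Theorem theorem3p3 :
  forall (m : nat), (3 <= m)%nat ->
  forall eps : R, 0 < eps ->
  exists K : R,
  forall (q : nat -> nat) (chi : nat -> nat -> C) (l : nat) (psi : nat -> C)
         (F : nat -> nat -> C -> C) (Lmain : C),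
    (forall i, (1 <= i <= m)%nat -> is_dirichlet_char (q i) (chi i)) ->
    is_dirichlet_char l psi ->
    (forall i b, (1 <= i <= m)%nat -> (1 <= b <= l - 1)%nat ->
       is_L_continuation (chi i) b l (F i b)) ->
    is_series
      (L_term (fun n => Cmult (Cprod1 (fun i => chi i n) m) (psi n))
              (RtoC (INR m / 2)))
      Lmain ->
    let qstar := INR (natmax1 q m) in
    Cmod (Cminus
            (Csum1 (fun b => Cmult (psi b)
                       (Cprod1 (fun i => F i b (RtoC (1 / 2))) m)) (l - 1))
            (Cmult (RtoC (Rpower (INR l) (INR m / 2))) Lmain))
    <= K * (Rpower qstar (INR m / 4 + eps) * INR l
            + Rpower qstar (1 / 4 + eps) * Rpower (INR l) (INR m / 2 - 1 / 2 + eps)).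
Proof.
  intros m Hm eps He.
  assert (Hm3 : 3 <= INR m) by (apply (le_INR 3) in Hm; simpl in Hm; lra).
  (* The m-th power of the error of one factor multiplies its exponent by [m]. *)
  set (eps' := eps / INR m). assert (He' : 0 < eps') by (apply Rdiv_lt_0_compat; lra).
  assert (Ee : INR m * eps' = eps) by (unfold eps'; field; lra).
  destruct (L_half_convexity eps' He') as (K0 & HK0 & Happrox).
  set (A := INR m * 2 ^ (m - 1)).
  assert (HA : 0 < A) by (apply Rmult_lt_0_compat; [lra|apply pow_lt; lra]).
  assert (Hinv : 0 < / eps) by now apply Rinv_0_lt_compat.
  (* [A] comes from the binomial estimate, [K0 (1 + / eps)] from the mixed terms and their harmonic
     sum, [K0^m] from the pure error terms, and 3 from the tail of the series. *)
  exists (A * (K0 * (1 + / eps) + K0 ^ m) + 3).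
  intros q chi l psi F Lmain Hchi Hpsi HF HL qstar.
  pose proof (dc_q_pos _ _ Hpsi) as Hl.
  assert (Hl1 : 1 <= INR l) by (apply (le_INR 1); lia).
  assert (HQq : forall i, (1 <= i <= m)%nat -> 1 <= INR (q i) <= qstar).
  { intros i Hi. split.
    - apply (le_INR 1). pose proof (dc_q_pos _ _ (Hchi i Hi)). lia.
    - apply le_INR. now apply natmax1_ge. }
  assert (HQ : 1 <= qstar) by (specialize (HQq 1%nat ltac:(lia)); lra).
  set (E := K0 * Rpower qstar (1 / 4 + eps')).
  assert (HE : 0 < E) by (apply Rmult_lt_0_compat; auto; apply exp_pos).
  assert (Hpsi1 := char_Cmod_le_1 l psi Hpsi).
  set (c := fun n => Cmult (Cprod1 (fun i => chi i n) m) (psi n)).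
  assert (Hc : forall n, Cmod (c n) <= 1).
  { intros n. unfold c. rewrite Cmod_mult.
    assert (Cmod (Cprod1 (fun i => chi i n) m) <= 1).
    { apply Cprod1_le_1. intros i Hi. apply (char_Cmod_le_1 (q i) (chi i)); auto. }
    pose proof (Hpsi1 n). pose proof (Cmod_ge_0 (Cprod1 (fun i => chi i n) m)).
    pose proof (Cmod_ge_0 (psi n)). nra. }
  set (r := INR m / 2). assert (Hr : 3 / 2 <= r) by (unfold r; lra).
  set (X := fun b : nat => / sqrt (INR b / INR l)).
  pose proof (series_head_error c r l Lmain Hr ltac:(lia) Hc HL) as Hhead.
  set (T := Csum1 (fun n => Cmult (c n) (RtoC (Rpower (INR n) (- r)))) (l - 1)) in *.
  set (S0 := Csum1 _ (l - 1)).
  (* The leading terms reproduce the head of the series exactly, because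
     [(l/b)^(m/2) = l^(m/2) b^(-m/2)]. *)
  assert (HT : Cmult (RtoC (Rpower (INR l) r)) T =
    Csum1 (fun b => Cmult (psi b) (Cprod1 (fun i => Cmult (chi i b) (RtoC (X b))) m)) (l - 1)).
  { unfold T. rewrite <- Csum1_scal. apply Csum1_ext. intros b Hb.
    rewrite Cprod1_scal. unfold X. rewrite inv_sqrt_ratio_pow by lia. fold r.
    rewrite RtoC_mult. unfold c. ring. }
  assert (Hterm : forall b, (1 <= b <= l - 1)%nat ->
    Cmod (Cminus (Cmult (psi b) (Cprod1 (fun i => F i b (RtoC (1 / 2))) m))
       (Cmult (psi b) (Cprod1 (fun i => Cmult (chi i b) (RtoC (X b))) m))) <=
    A * (E * Rpower (INR l) (r - 1 / 2)) * / INR b + A * E ^ m).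
  { intros b Hb. assert (Hb0 : 0 < INR b) by (apply lt_0_INR; lia).
    assert (Hb1 : 1 <= INR b) by (apply (le_INR 1); lia).
    assert (HX : 0 < X b).
    { apply Rinv_0_lt_compat, sqrt_lt_R0, Rdiv_lt_0_compat; lra. }
    destruct (Cprod1_perturb (fun i => Cmult (chi i b) (RtoC (X b)))
       (fun i => F i b (RtoC (1 / 2))) (X b) E m) as [_ HP]; try lra.
    - intros i Hi. rewrite Cmod_mult, Cmod_R, Rabs_pos_eq by lra.
      pose proof (char_Cmod_le_1 _ _ (Hchi i Hi) b). nra.
    - intros i Hi. eapply Rle_trans; [apply (Happrox (q i) (chi i) (Hchi i Hi) b l); auto; lia|].
      unfold E. apply Rmult_le_compat_l; [lra|]. specialize (HQq i Hi).
      apply Rle_Rpower_l; lra.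
    - replace (Cminus _ _) with (Cmult (psi b) (Cminus (Cprod1 (fun i => F i b (RtoC (1 / 2))) m)
        (Cprod1 (fun i => Cmult (chi i b) (RtoC (X b))) m))) by ring.
      rewrite Cmod_mult.
      apply Rle_trans with (1 * ((X b + E) ^ m - X b ^ m)).
      { apply Rmult_le_compat; auto using Cmod_ge_0. }
      rewrite Rmult_1_l.
      eapply Rle_trans; [apply pow_add_le; lra || lia|]. fold A.
      (* [m >= 3] makes [r - 1 / 2 >= 1], so the power of [b] is at most [1 / b] and the sum over
         [b] is harmonic. *)
      assert (HXm : X b ^ (m - 1) <= Rpower (INR l) (r - 1 / 2) * / INR b).
      { unfold X. rewrite inv_sqrt_ratio_pow by lia. rewrite minus_INR by lia. simpl (INR 1).
        replace ((INR m - 1) / 2) with (r - 1 / 2) by (unfold r; field).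
        apply Rmult_le_compat_l; [left; apply exp_pos|].
        rewrite <- (Rpower_1 (INR b)) at 2 by auto. rewrite <- Rpower_Ropp.
        apply Rle_Rpower; lra. }
      assert (E * X b ^ (m - 1) <= E * (Rpower (INR l) (r - 1 / 2) * / INR b))
        by (apply Rmult_le_compat_l; lra).
      apply Rle_trans with (A * (E * (Rpower (INR l) (r - 1 / 2) * / INR b) + E ^ m));
        [apply Rmult_le_compat_l; lra|right; ring]. }
  assert (HS : Cmod (Cminus S0 (Cmult (RtoC (Rpower (INR l) r)) T)) <=
    A * (E * Rpower (INR l) (r - 1 / 2)) * harm (l - 1) + INR (l - 1) * (A * E ^ m)).
  { rewrite HT. unfold S0.
    replace (Cminus _ _) with (Csum1 (fun b =>
      Cminus (Cmult (psi b) (Cprod1 (fun i => F i b (RtoC (1 / 2))) m))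
       (Cmult (psi b) (Cprod1 (fun i => Cmult (chi i b) (RtoC (X b))) m))) (l - 1)).
    - eapply Rle_trans; [apply Cmod_Csum1_le; exact Hterm|].
      rewrite Rsum1_plus, Rsum1_const, Rsum1_scal. apply Rle_refl.
    - clear. induction (l - 1)%nat; [simpl; ring|]. rewrite !Csum1_S, IHn. ring. }
  assert (HQm : E ^ m = K0 ^ m * Rpower qstar (INR m / 4 + eps)).
  { unfold E. rewrite Rpow_mult_distr. f_equal. rewrite <- Rpower_pow by apply exp_pos.
    rewrite Rpower_mult. f_equal. rewrite Rmult_plus_distr_r, (Rmult_comm eps'), Ee. field. }
  assert (HEle : E <= K0 * Rpower qstar (1 / 4 + eps)).
  { unfold E. apply Rmult_le_compat_l; [lra|]. apply Rle_Rpower; [auto|]. nra. }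
  set (W1 := Rpower qstar (INR m / 4 + eps)) in *.
  set (W2 := Rpower qstar (1 / 4 + eps)) in *.
  assert (HW1 : 1 <= W1).
  { unfold W1. apply Rle_trans with (Rpower qstar 0); [rewrite Rpower_O; lra|apply Rle_Rpower; lra]. }
  assert (HW2 : 0 < W2) by apply exp_pos.
  set (V := Rpower (INR l) (r - 1 / 2 + eps)).
  assert (HV : 0 < V) by apply exp_pos.
  assert (HVh : Rpower (INR l) (r - 1 / 2) * harm (l - 1) <= (1 + / eps) * V).
  { assert (harm (l - 1) <= (1 + / eps) * Rpower (INR l) eps).
    { eapply Rle_trans; [apply (harm_mono _ l); lia|]. apply harm_bound; auto. }
    unfold V. rewrite Rpower_plus.
    assert (0 < Rpower (INR l) (r - 1 / 2)) by apply exp_pos. nra. }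
  (* The tail [3 l^(1-r)] times [l^r] is [3 l], covered by the first error term because
     [W1 >= 1]. *)
  assert (Hmain : Cmod (Cminus (Cmult (RtoC (Rpower (INR l) r)) T)
                     (Cmult (RtoC (Rpower (INR l) r)) Lmain)) <= 3 * INR l).
  { replace (Cminus _ _) with (Cmult (RtoC (Rpower (INR l) r)) (Cminus T Lmain)) by ring.
    assert (P : 0 < Rpower (INR l) r) by apply exp_pos.
    rewrite Cmod_mult, Cmod_R, Rabs_pos_eq by lra.
    apply Rle_trans with (Rpower (INR l) r * (3 * Rpower (INR l) (1 - r))).
    - apply Rmult_le_compat_l; lra.
    - replace (Rpower (INR l) r * (3 * Rpower (INR l) (1 - r))) with
        (3 * (Rpower (INR l) r * Rpower (INR l) (1 - r))) by ring.
      rewrite <- Rpower_plus. replace (r + (1 - r)) with 1 by ring. rewrite Rpower_1; lra. }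
  assert (Hh0 : 0 <= harm (l - 1)) by (apply (harm_mono 0); lia).
  assert (Hfirst : A * (E * Rpower (INR l) (r - 1 / 2)) * harm (l - 1) <=
     A * (K0 * (1 + / eps)) * (W2 * V)).
  { replace (A * (E * Rpower (INR l) (r - 1 / 2)) * harm (l - 1)) with
      (A * (E * (Rpower (INR l) (r - 1 / 2) * harm (l - 1)))) by ring.
    replace (A * (K0 * (1 + / eps)) * (W2 * V)) with (A * ((K0 * W2) * ((1 + / eps) * V))) by ring.
    apply Rmult_le_compat_l; [lra|]. apply Rmult_le_compat; try lra.
    apply Rmult_le_pos; auto. left; apply exp_pos. }
  assert (HKm : 0 < K0 ^ m) by now apply pow_lt.
  assert (Hsecond : INR (l - 1) * (A * E ^ m) <= A * K0 ^ m * (W1 * INR l)).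
  { rewrite HQm. assert (INR (l - 1) <= INR l) by (apply le_INR; lia).
    replace (A * K0 ^ m * (W1 * INR l)) with (INR l * (A * (K0 ^ m * W1))) by ring.
    assert (0 <= A * (K0 ^ m * W1)) by (apply Rmult_le_pos; [lra|apply Rmult_le_pos; lra]).
    apply Rmult_le_compat_r; lra. }
  eapply Rle_trans; [apply (Cmod_sub_triangle _ (Cmult (RtoC (Rpower (INR l) r)) T))|].
  clearbody A W1 W2 V.
  assert (HWl : INR l <= W1 * INR l) by nra.
  assert (HWV : 0 < W2 * V) by now apply Rmult_lt_0_compat.
  assert (B1 : 0 <= A * (K0 * (1 + / eps)) * (W1 * INR l)).
  { repeat apply Rmult_le_pos; lra. }
  assert (B2 : 0 <= A * K0 ^ m * (W2 * V)) by (repeat apply Rmult_le_pos; lra).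
  replace ((A * (K0 * (1 + / eps) + K0 ^ m) + 3) * (W1 * INR l + W2 * V)) with
    (A * (K0 * (1 + / eps)) * (W1 * INR l) + A * (K0 * (1 + / eps)) * (W2 * V)
     + A * K0 ^ m * (W1 * INR l) + A * K0 ^ m * (W2 * V) + 3 * (W1 * INR l) + 3 * (W2 * V)) by ring.
  lra.
Qed.
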